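(* Let $D$ be a Borel probability measure on $\mathcal R$ which is invariant and ergodic with respect to the action of the infinite symmetric group $S_\infty$ (finite permutations of $\mathbb N$ acting by simultaneous permutation of rows and columns). (1) $D$ is the matrix distribution $D_T$ of some metric triple $T=(X,\rho,\mu)$ if and only if for each $\epsilon>0$ there exists an integer $N$ such that $$D\Big\{r\in\mathcal R:\ \lim_{n\to\infty}\frac{|\{j:1\le j\le n,\ \min_{1\le i\le N} r_{i,j}<\epsilon\}|}{n}>1-\epsilon\Big\}>1-\epsilon .$$ (2) $D$ is the matrix distribution of some metric triple $T=(X,\rho,\mu)$ with $(X,\rho)$ compact if and only if for each $\epsilon>0$ there exists an integer $N$ such that $$D\{r\in\mathcal R:\ \min_{1\le i\le N} r_{i,j}<\epsilon \text{ for all } j>N\}>1-\epsilon .$$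
   Context: $\mathcal R$ is the set of infinite real matrices $r=\{r_{i,j}\}_{i,j\ge1}$ with $r_{i,i}=0$, $r_{i,j}\ge0$, $r_{i,j}=r_{j,i}$, $r_{i,k}+r_{k,j}\ge r_{i,j}$, with the weak (entrywise/product) topology. A metric triple $T=(X,\rho,\mu)$ is a Polish space $(X,\rho)$ with a Borel probability measure $\mu$. Its matrix distribution $D_T$ is the image of the product measure $\mu^{\mathbb N}$ on $X^{\mathbb N}$ under the map $F_T(\{x_i\}_{i\ge1})=\{\rho(x_i,x_j)\}_{i,j\ge1}\in\mathcal R$. *)

(* Defs.v *)
From HB Require Import structures.
From mathcomp Require Import all_boot all_order all_algebra.
From mathcomp Require Import all_classical all_reals all_analysis.
Set Implicit Arguments. Unset Strict Implicit. Unset Printing Implicit Defensive.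
Import Order.TTheory GRing.Theory Num.Theory.
Import numFieldTopology.Exports numFieldNormedType.Exports.
Local Open Scope classical_set_scope.
Local Open Scope ring_scope.

(* The space of infinite real matrices, with the weak (product) topology.
   Indices are 0-based: the paper's r_{i,j} (i,j >= 1) is  r (i-1, j-1). *)
Definition Mat (R : realType) : topologicalType := {ptws (nat * nat) -> R}.

Definition MatB (R : realType) : measurableType (sigma_display (@open (Mat R))) :=
  g_sigma_algebraType (@open (Mat R)).

Definition distmat (R : realType) : set (MatB R) :=
  [set r | (forall i, r (i, i) = 0) /\ (forall i j, 0 <= r (i, j)) /\
           (forall i j, r (i, j) = r (j, i)) /\
           (forall i j k, r (i, j) <= r (i, k) + r (k, j))].

Definition finite_perm (s : nat -> nat) : Prop :=
  bijective s /\ exists n, forall i, (n <= i)%N -> s i = i.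

Definition perm_act (R : realType) (s : nat -> nat) (r : MatB R) : MatB R :=
  fun ij => r (s ij.1, s ij.2).

Definition Sinf_invariant (R : realType) (D : probability (MatB R) R) : Prop :=
  forall s, finite_perm s -> forall B : set (MatB R), measurable B ->
    D (perm_act s @^-1` B) = D B.

Definition Sinf_ergodic (R : realType) (D : probability (MatB R) R) : Prop :=
  forall B : set (MatB R), measurable B ->
    (forall s, finite_perm s -> perm_act s @^-1` B = B) ->
    D B = 0%E \/ D B = 1%E.

Definition is_metric (R : realType) (X : Type) (rho : X -> X -> R) : Prop :=
  (forall x y, 0 <= rho x y) /\ (forall x y, rho x y = 0 <-> x = y) /\
  (forall x y, rho x y = rho y x) /\
  (forall x y z, rho x z <= rho x y + rho y z).

Definition rho_open (R : realType) (X : Type) (rho : X -> X -> R) : set (set X) :=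
  [set U | forall x, U x -> exists2 e : R, 0 < e & forall y, rho x y < e -> U y].

Definition rho_complete (R : realType) (X : Type) (rho : X -> X -> R) : Prop :=
  forall u : nat -> X,
    (forall e : R, 0 < e -> exists N, forall m n, (N <= m)%N -> (N <= n)%N -> rho (u m) (u n) < e) ->
    exists x, forall e : R, 0 < e -> exists N, forall n, (N <= n)%N -> rho (u n) x < e.

Definition rho_separable (R : realType) (X : Type) (rho : X -> X -> R) : Prop :=
  exists s : nat -> X, forall x (e : R), 0 < e -> exists n, rho x (s n) < e.

Definition polish (R : realType) (X : Type) (rho : X -> X -> R) : Prop :=
  is_metric rho /\ rho_complete rho /\ rho_separable rho.

Definition rho_compact (R : realType) (X : Type) (rho : X -> X -> R) : Prop :=
  forall F : set (set X), F `<=` rho_open rho -> \bigcup_(U in F) U = setT ->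
    exists s : seq (set X), (forall U, U \in s -> F U) /\
      (forall x, exists2 U, U \in s & U x).

Definition XB (R : realType) (X : pointedType) (rho : X -> X -> R)
  : measurableType (sigma_display (rho_open rho)) :=
  g_sigma_algebraType (rho_open rho).

Definition cylinders (R : realType) (X : pointedType) (rho : X -> X -> R)
  : set (set (nat -> X)) :=
  [set C | exists n (A : set (XB rho)), measurable A /\ C = [set x | A (x n)]].

Definition XNB (R : realType) (X : pointedType) (rho : X -> X -> R)
  : measurableType (sigma_display (cylinders rho)) :=
  g_sigma_algebraType (cylinders rho).

Definition is_product_measure (R : realType) (X : pointedType) (rho : X -> X -> R)
  (mu : probability (XB rho) R) (nu : probability (XNB rho) R) : Prop :=
  forall (n : nat) (A : nat -> set (XB rho)), (forall i, measurable (A i)) ->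
    nu [set x : XNB rho | forall i, (i < n)%N -> A i (x i)] = (\prod_(i < n) mu (A i))%E.

Definition FT (R : realType) (X : pointedType) (rho : X -> X -> R)
  (x : XNB rho) : MatB R := fun ij => rho (x ij.1) (x ij.2).

Definition is_matrix_distribution_of (R : realType) (X : pointedType) (rho : X -> X -> R)
  (mu : probability (XB rho) R) (D : probability (MatB R) R) : Prop :=
  exists nu : probability (XNB rho) R, is_product_measure mu nu /\
    forall B : set (MatB R), measurable B -> D B = nu (@FT _ _ rho @^-1` B).

Definition is_matrix_distribution (R : realType) (D : probability (MatB R) R) : Prop :=
  exists (X : pointedType) (rho : X -> X -> R) (mu : probability (XB rho) R),
    polish rho /\ is_matrix_distribution_of mu D.

Definition is_compact_matrix_distribution (R : realType) (D : probability (MatB R) R) : Prop :=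
  exists (X : pointedType) (rho : X -> X -> R) (mu : probability (XB rho) R),
    polish rho /\ rho_compact rho /\ is_matrix_distribution_of mu D.

Definition close_frac (R : realType) (r : MatB R) (N : nat) (eps : R) (n : nat) : R :=
  (#|[pred j : 'I_n | [exists i : 'I_N, r (nat_of_ord i, nat_of_ord j) < eps]]|)%:R / n%:R.

Definition good_set1 (R : realType) (N : nat) (eps : R) : set (MatB R) :=
  [set r | distmat r /\
     exists2 l : R, close_frac r N eps n @[n --> \oo] --> l & 1 - eps < l].

Definition good_set2 (R : realType) (N : nat) (eps : R) : set (MatB R) :=
  [set r | distmat r /\
     forall j, (N <= j)%N -> exists2 i, (i < N)%N & r (i, j) < eps].

Definition cond1 (R : realType) (D : probability (MatB R) R) : Prop :=
  forall eps : R, 0 < eps -> exists N : nat,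
    ((1 - eps)%:E < D (good_set1 N eps))%E.

Definition cond2 (R : realType) (D : probability (MatB R) R) : Prop :=
  forall eps : R, 0 < eps -> exists N : nat,
    ((1 - eps)%:E < D (good_set2 N eps))%E.

(* Main.v *)
(* By exchangeability, column frequencies of a D-random matrix r converge almost surely, and
   cond1 says that finitely many balls around the indices 0, ..., N-1 capture almost all columns,
   i.e. that the empirical measures of r are tight in the completion X_r of (N, r).  Coding an
   index j by the word of the first indices at distance < 2^-k from j (k = 0, 1, ...), the limit
   word frequencies form a consistent weight on words, hence define a law mu_r on X_r, realized
   from a uniform variable.  The averages of a Lipschitz function f of an m x m corner over all
   m-tuples of indices < n converge to its expectation for an i.i.d. mu_r-sample.  These averages
   are exactly invariant under finite permutations for n large and their expectations tend to
   E_D f, so by ergodicity the limit is E_D f for almost every r: D is the matrix distribution of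
   (X_r, mu_r).  Under cond2 almost every r is totally bounded, so X_r is compact.

   Conversely, in a separable space almost every sampled point is an accumulation point of the
   other ones, so the expected limit frequency of the columns close to the first N indices tends
   to 1, and Markov's inequality gives cond1; in a compact space every sequence lies in finitely
   many small balls, and cond2 holds because each of them is first hit at a finite time. *)
Require Import Defs.
From HB Require Import structures.
From mathcomp Require Import all_boot all_order all_algebra.
From mathcomp Require Import all_classical all_reals all_analysis.
From mathcomp Require Import measurable_realfun.
From mathcomp Require Import ring lra zify.
Set Implicit Arguments.
Unset Strict Implicit.
Unset Printing Implicit Defensive.
Import Order.TTheory GRing.Theory Num.Theory.
Import numFieldTopology.Exports numFieldNormedType.Exports.
Local Open Scope classical_set_scope.
Local Open Scope ring_scope.

(** * Measurable predicates and bounded expectations *)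

(** Only events about single columns need a law of large numbers; it follows from second moments,
    because exchangeable events have constant pair probabilities. Averages over m-tuples are then
    treated for one fixed [r]: up to an error of order [2^-k] a corner depends only on the words of
    its indices, and the counts of tuples with given words factorize.

    The obstacle is loss of mass: the limit frequencies of countably many words may sum to less than
    1. Tightness prevents this, and this is what [cond1] is used for.

    Words are made of first close rows, not of cells of a space that is yet to be built, so that
    having a given word is a condition on finitely many rows which is the same for all later
    columns.

    Until ergodicity is used, each [r] has its own law. Ergodicity enters once, to make the limit of
    the averages of one test function constant; countably many test functions determine a law, so
    almost every [r] reconstructs [D]. *)

Section MeasurablePredicates.
Context d (T : measurableType d) (R : realType).
Implicit Types (P Q : T -> Prop) (f g : T -> R).

Lemma measurable_exists (I : countType) (P : I -> T -> Prop) :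
  (forall i, measurable [set x | P i x]) -> measurable [set x | exists i, P i x].
Proof.
move=> mP; rewrite (_ : [set x | _] = \bigcup_i [set x | P i x]).
  apply: countable_bigcupT_measurable => //; exact: countableP.
by apply/seteqP; split=> x /= [i]; exists i.
Qed.

Lemma measurable_not P : measurable [set x | P x] -> measurable [set x | ~ P x].
Proof. exact: measurableC. Qed.

Lemma measurable_forall (I : countType) (P : I -> T -> Prop) :
  (forall i, measurable [set x | P i x]) -> measurable [set x | forall i, P i x].
Proof.
move=> mP; rewrite (_ : [set x | _] = ~` [set x | exists i, ~ P i x]).
  by apply: measurableC; apply: measurable_exists => i; exact: measurable_not.
apply/seteqP; split=> x /= Px; first by move=> [i]; apply.
by move=> i; apply: contrapT => nP; apply: Px; exists i.
Qed.

Lemma measurable_andP P Q : measurable [set x | P x] -> measurable [set x | Q x] ->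
  measurable [set x | P x /\ Q x].
Proof. exact: measurableI. Qed.

Lemma measurable_cstP (A : Prop) : measurable [set _ : T | A].
Proof.
have [a|a] := pselect A.
  by rewrite (_ : [set _ | A] = setT)//; apply/seteqP; split.
by rewrite (_ : [set _ | A] = set0)//; apply/seteqP; split.
Qed.

Lemma measurable_implyP (A : Prop) P : (A -> measurable [set x | P x]) ->
  measurable [set x | A -> P x].
Proof.
move=> mP; have [a|a] := pselect A.
  rewrite (_ : [set x | _] = [set x | P x]); first exact: mP.
  by apply/seteqP; split=> x /=; auto.
by rewrite (_ : [set x | _] = setT)//; apply/seteqP; split=> // x _ /a.
Qed.

Lemma measurable_boolP (b : T -> bool) : measurable_fun setT b -> measurable [set x | b x].
Proof. by move=> mb; have := mb measurableT [set true]; rewrite setTI; exact. Qed.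

Lemma measurable_ltP f g : measurable_fun setT f -> measurable_fun setT g ->
  measurable [set x | f x < g x].
Proof. by move=> mf mg; apply: measurable_boolP; exact: measurable_fun_ltr. Qed.

Lemma measurable_leP f g : measurable_fun setT f -> measurable_fun setT g ->
  measurable [set x | f x <= g x].
Proof. by move=> mf mg; apply: measurable_boolP; exact: measurable_fun_ler. Qed.

Lemma measurable_lt_rat f : (forall q : rat, measurable [set x | f x < ratr q]) ->
  measurable_fun setT f.
Proof.
move=> mf; apply: (measurability _ (RGenInftyO.measurableE R)).
move=> _ [_ [x ->] <-]; rewrite setTI.
rewrite (_ : _ @^-1` _ = [set y | exists q : rat, ratr q <= x /\ f y < ratr q]).
  apply: measurable_exists => q; apply: measurable_andP => //.
  exact: measurable_cstP.
apply/seteqP; split=> y /=; rewrite in_itv/=.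
  move=> fx; have [q] := rat_in_itvoo fx; rewrite in_itv/= => /andP[fq qx].
  by exists q; rewrite (ltW qx).
by move=> [q [qx fq]]; exact: lt_le_trans qx.
Qed.

End MeasurablePredicates.

Section Expectation.
Context d (T : measurableType d) (R : realType) (P : probability T R).
Implicit Types (f g : T -> R) (A B : set T).

(** Boundedness is preferred to integrability because it is stable under products. *)
Definition mbounded f := measurable_fun setT f /\ exists M : R, forall x, `|f x| <= M.

Definition Ex f : R := (\int[P]_x f x)%R.

Definition pr A : R := fine (P A).

Lemma pr_EFin A : measurable A -> P A = (pr A)%:E.
Proof. by move=> mA; rewrite /pr fineK// fin_num_measure. Qed.

Lemma pr_ge0 A : 0 <= pr A.
Proof. exact: fine_ge0. Qed.

Lemma le_pr A B : measurable A -> measurable B -> A `<=` B -> pr A <= pr B.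
Proof.
move=> mA mB AB; rewrite -lee_fin -!pr_EFin//.
by apply: le_measure => //; rewrite inE.
Qed.

Lemma prT : pr setT = 1.
Proof. by rewrite /pr probability_setT. Qed.

Lemma pr_le1 A : measurable A -> pr A <= 1.
Proof. by move=> mA; rewrite -prT; exact: le_pr. Qed.

Lemma mbounded_integrable f : mbounded f -> P.-integrable setT (EFin \o f).
Proof.
move=> [mf [M fM]]; apply: (@le_integrable _ _ _ P setT measurableT _ (EFin \o cst M)).
- exact/measurable_EFinP.
- move=> x _ /=; rewrite lee_fin (le_trans (fM x))//.
  by rewrite ler_norm.
- by apply: finite_measure_integrable_cst.
Qed.

Lemma mbounded_cst c : mbounded (fun=> c).
Proof. by split; [exact: measurable_cst|exists `|c|]. Qed.

Lemma mboundedD f g : mbounded f -> mbounded g -> mbounded (fun x => f x + g x).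
Proof.
move=> [mf [M fM]] [mg [N gN]]; split; first exact: measurable_funD.
by exists (M + N) => x; rewrite (le_trans (ler_normD _ _))// lerD.
Qed.

Lemma mboundedM f g : mbounded f -> mbounded g -> mbounded (fun x => f x * g x).
Proof.
move=> [mf [M fM]] [mg [N gN]]; split; first exact: measurable_funM.
by exists (M * N) => x; rewrite normrM ler_pM.
Qed.

Lemma mboundedZ c f : mbounded f -> mbounded (fun x => c * f x).
Proof. by apply: mboundedM; exact: mbounded_cst. Qed.

Lemma mboundedB f g : mbounded f -> mbounded g -> mbounded (fun x => f x - g x).
Proof.
move=> bf bg; have := mboundedD bf (mboundedZ (-1) bg).
by congr mbounded; apply/funext => x; rewrite mulN1r.
Qed.

Lemma mbounded_norm f : mbounded f -> mbounded (fun x => `|f x|).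
Proof.
move=> [mf [M fM]]; split; first exact: measurableT_comp.
by exists M => x; rewrite normr_id.
Qed.

Lemma mbounded_sum (I : Type) (r : seq I) (F : I -> T -> R) :
  (forall i, mbounded (F i)) -> mbounded (fun x => \sum_(i <- r) F i x).
Proof.
move=> bF; elim: r => [|i r IH].
  by under eq_fun do rewrite big_nil; exact: mbounded_cst.
by under eq_fun do rewrite big_cons; exact: mboundedD.
Qed.

Lemma mbounded_indic A : measurable A -> mbounded (\1_A : T -> R).
Proof.
move=> mA; split; first exact: measurable_indic.
by exists 1 => x; rewrite indicE; case: (_ \in _); rewrite ?normr1 ?normr0.
Qed.

Lemma ExD f g : mbounded f -> mbounded g -> Ex (fun x => f x + g x) = Ex f + Ex g.
Proof. by move=> /mbounded_integrable bf /mbounded_integrable bg; exact: RintegralD. Qed.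

Lemma ExZ c f : mbounded f -> Ex (fun x => c * f x) = c * Ex f.
Proof. by move=> /mbounded_integrable bf; exact: RintegralZl. Qed.

Lemma ExB f g : mbounded f -> mbounded g -> Ex (fun x => f x - g x) = Ex f - Ex g.
Proof. by move=> /mbounded_integrable bf /mbounded_integrable bg; exact: RintegralB. Qed.

Lemma Ex_cst c : Ex (fun=> c) = c.
Proof. by rewrite /Ex Rintegral_cst// [fine _]prT mulr1. Qed.

Lemma Ex_sum (I : Type) (r : seq I) (F : I -> T -> R) :
  (forall i, mbounded (F i)) ->
  Ex (fun x => \sum_(i <- r) F i x) = \sum_(i <- r) Ex (F i).
Proof.
move=> bF; elim: r => [|i r IH].
  by under eq_fun do rewrite big_nil; rewrite Ex_cst big_nil.
under eq_fun do rewrite big_cons.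
by rewrite ExD ?IH ?big_cons//; exact: mbounded_sum.
Qed.

Lemma le_Ex f g : mbounded f -> mbounded g -> (forall x, f x <= g x) -> Ex f <= Ex g.
Proof.
move=> /mbounded_integrable bf /mbounded_integrable bg fg.
by apply: le_Rintegral => // x _; exact: fg.
Qed.

Lemma Ex_ge0 f : (forall x, 0 <= f x) -> 0 <= Ex f.
Proof. by move=> f0; apply: Rintegral_ge0. Qed.

Lemma le_normr_Ex f : mbounded f -> `|Ex f| <= Ex (fun x => `|f x|).
Proof. by move=> /mbounded_integrable bf; exact: le_normr_Rintegral. Qed.

Lemma Ex_indic A : measurable A -> Ex (\1_A : T -> R) = pr A.
Proof.
by move=> mA; rewrite /Ex /Rintegral integral_indic// setIT.
Qed.

Lemma Ex_EFin f : mbounded f -> (\int[P]_x (f x)%:E)%E = (Ex f)%:E.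
Proof.
move=> bf; rewrite /Ex /Rintegral fineK//.
exact: (@integrable_fin_num _ _ _ P setT measurableT _ (mbounded_integrable bf)).
Qed.

Lemma Ex_dct (F : nat -> T -> R) f M : (forall n, measurable_fun setT (F n)) ->
  measurable_fun setT f -> (forall n x, `|F n x| <= M) ->
  {ae P, forall x, F n x @[n --> \oo] --> f x} ->
  Ex (F n) @[n --> \oo] --> Ex f.
Proof.
move=> mF mf FM Ff.
have [|||||ifi _ cvE] := @dominated_convergence _ _ _ P setT measurableT
  (fun n x => (F n x)%:E) (fun x => (f x)%:E) (fun=> M%:E).
- by move=> n; exact/measurable_EFinP.
- exact/measurable_EFinP.
- apply: filterS Ff => x Fx _; apply: cvg_EFin => //; exact: nearW.
- exact: finite_measure_integrable_cst.
- by apply: aeW => x n _; rewrite lee_fin.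
have bF n : mbounded (F n) by split => //; exists M.
have : (Ex (F n))%:E @[n --> \oo] --> (Ex f)%:E.
  rewrite [X in _ --> X](_ : _ = (\int[P]_x (f x)%:E)%E); last first.
    by rewrite /Ex /Rintegral fineK//; exact: (integrable_fin_num measurableT ifi).
  by under eq_fun do rewrite -Ex_EFin//.
by move/fine_cvgP => [].
Qed.

End Expectation.

Lemma Ex_comp d d' (T : measurableType d) (T' : measurableType d') (R : realType)
  (P : probability T R) (Q : probability T' R) (X : T -> T') (f : T' -> R) :
  measurable_fun setT X -> (forall B, measurable B -> Q B = P (X @^-1` B)) ->
  mbounded f -> Ex Q f = Ex P (fun x => f (X x)).
Proof.
move=> mX QP bf.
rewrite /Ex /Rintegral; congr fine.
rewrite -(@integral_pushforward _ _ _ _ _ X mX P setT (EFin \o f)) //.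
- apply: eq_measure_integral => A mA _; rewrite /pushforward.
  exact: QP.
- apply/measurable_EFinP; exact: bf.1.
- apply: mbounded_integrable; split; last by case: bf => _ [M fM]; exists M.
  by apply: measurableT_comp => //; exact: bf.1.
Qed.

(** * Borel sets of matrices *)

Section MatrixBorel.
Context (R : realType).
Implicit Types (r : MatB R).

(** One-sided rational constraints on finitely many entries: the family is closed under
    intersection, by concatenation of lists, and countable, so that null sets may later be collected
    over all [L]. *)
Definition boxset (L : seq ((nat * nat) * rat)) : set (MatB R) :=
  [set r | all (fun c => r c.1 < ratr c.2) L].

Lemma measurable_coord ij : measurable_fun setT (fun r : MatB R => r ij).
Proof.
apply: measurable_lt_rat => q; apply: sub_sigma_algebra.
have cij : continuous (fun r : Mat R => r ij).
  move=> r; have /pointwise_cvgP : {ptws, nbhs r --> r} by exact: cvg_id.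
  exact.
by have /continuousP/(_ _ (@open_lt _ (ratr q))) := cij.
Qed.

Lemma measurable_boxset L : measurable (boxset L).
Proof.
elim: L => [|c L IH].
  by rewrite (_ : boxset [::] = setT)//; apply/seteqP; split.
rewrite (_ : boxset _ = [set r | r c.1 < ratr c.2] `&` boxset L); last first.
  by apply/seteqP; split=> r /= => [/andP[]|[? ?]]//; apply/andP.
by apply: measurableI => //; apply: measurable_ltP => //; exact: measurable_coord.
Qed.

Lemma setI_boxset L L' : boxset L `&` boxset L' = boxset (L ++ L').
Proof. by apply/seteqP; split=> r; rewrite /boxset /= all_cat => /andP. Qed.

Let itvset (K : seq ((nat * nat) * (rat * rat))) : set (MatB R) :=
  [set r | all (fun c => ratr c.2.1 < r c.1 < ratr c.2.2) K].

Let itvset_sigma K : <<s range boxset >> (itvset K).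
Proof.
pose T := g_sigma_algebraType (range boxset).
have mc c : measurable_fun setT (fun r : T => r c).
  apply: measurable_lt_rat => q; apply: sub_sigma_algebra; exists [:: (c, q)] => //.
  by apply/seteqP; split=> r; rewrite /boxset /= andbT.
change (measurable (itvset K : set T)).
elim: K => [|[c [q q']] K IH].
  by rewrite (_ : itvset [::] = setT)//; apply/seteqP; split.
rewrite (_ : itvset _ = [set r | (ratr q < r c /\ r c < ratr q') /\ itvset K r]); last first.
  apply/seteqP; split=> r /=; first by move=> /andP[/andP[? ?] ?].
  by move=> [[? ?] ?]; apply/andP; split => //; apply/andP.
by do 2?[apply: measurable_andP => //]; apply: measurable_ltP => //; exact: mc.
Qed.

(** If no box fits into [O], then the boxes [K n], which constrain the coordinates of code below [n]
    to within [1/(n+1)] of [r], all contain points outside [O]. These points converge to [r] in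
    every coordinate, hence in the product topology, which contradicts openness. *)
Let itvset_nbhs (O : set (Mat R)) (r : Mat R) : open O -> O r ->
  exists K, itvset K r /\ itvset K `<=` O.
Proof.
move=> oO Or; apply: contrapT => /forallNP noK.
have appr n c : {q : rat * rat | r c - n.+1%:R^-1 < ratr q.1 < r c /\
                                  r c < ratr q.2 < r c + n.+1%:R^-1}.
  apply: cid.
  have [q1] := @rat_in_itvoo R (r c - n.+1%:R^-1) (r c) ltac:(by rewrite ltrBlDr ltrDl).
  have [q2] := @rat_in_itvoo R (r c) (r c + n.+1%:R^-1) ltac:(by rewrite ltrDl).
  by rewrite !in_itv/= => H2 H1; exists (q1, q2).
pose K n := [seq (c, sval (appr n c)) | c <- pmap (@unpickle (nat * nat)%type) (iota 0 n)].
have Kr n : itvset (K n) r.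
  apply/allP => _ /mapP[c _ ->] /=.
  by case: (appr n c) => q /= [/andP[_ H1] /andP[H2 _]]; rewrite H1 H2.
have /choice[s sP] : forall n, exists s, itvset (K n) s /\ ~ O s.
  move=> n; apply: contrapT => /forallNP Ks; apply: (noK (K n)); split => // s Kns.
  by apply: contrapT => nOs; apply: (Ks s).
have sc c : s n c @[n --> \oo] --> r c.
  apply/cvgrPdist_lt => e e0.
  near=> n; have [/allP/(_ (c, sval (appr n c))) + _] := sP n.
  have cn : (pickle c < n)%N by near: n; exact: nbhs_infty_gt.
  have -> : (c, sval (appr n c)) \in K n.
    by apply: map_f; rewrite mem_pmap; apply/mapP; exists (pickle c);
      rewrite ?mem_iota ?pickleK.
  move=> /(_ isT) /=; case: (appr n c) => q /= [/andP[q1 q2] /andP[q3 q4]] /andP[s1 s2].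
  have ne : n.+1%:R^-1 < e by near: n; exact: near_infty_natSinv_lt (PosNum e0).
  rewrite distrC ltr_distl; apply/andP; split.
    by apply: lt_trans s1; apply: le_lt_trans q1; rewrite lerD2l lerN2 ltW.
  by apply: (lt_trans s2); apply: (lt_le_trans q4); rewrite lerD2l ltW.
have cs : {ptws, s @ \oo --> r} by apply/pointwise_cvgP; exact: sc.
have /cs : nbhs r O by exact: open_nbhs_nbhs.
move=> [N _ /(_ N (leqnn _))] /=; exact: (sP N).2.
Unshelve. all: by end_near. Qed.

Lemma MatB_measurableE : @measurable _ (MatB R) = <<s range boxset >>.
Proof.
apply/seteqP; split; last first.
  apply: smallest_sub; first exact: sigma_algebra_measurable.
  by move=> _ [L _ <-]; exact: measurable_boxset.
apply: smallest_sub; first exact: smallest_sigma_algebra.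
move=> O oO; pose T := g_sigma_algebraType (range boxset).
(* Second countability: an open set is the union of the rational boxes inside it, and these are
   countably many. *)
rewrite (_ : O = [set r : T | exists K, itvset K `<=` O /\ itvset K r]).
  apply: (@measurable_exists _ T) => K; apply: measurable_andP; last exact: itvset_sigma.
  exact: measurable_cstP.
apply/seteqP; split=> r; last by move=> [K [KO /KO]].
by move=> /(itvset_nbhs oO)[K [? ?]]; exists K.
Qed.

Lemma measurable_fun_MatB d (T : measurableType d) (f : T -> MatB R) :
  (forall ij, measurable_fun setT (fun x => f x ij)) -> measurable_fun setT f.
Proof.
move=> mf; apply: (measurability _ MatB_measurableE) => _ [_ [L _ <-] <-].
rewrite setTI; elim: L => [|c L IH].
  by rewrite (_ : _ @^-1` _ = setT)//; apply/seteqP; split.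
rewrite (_ : _ @^-1` _ = [set x | f x c.1 < ratr c.2 /\ boxset L (f x)]); last first.
  by apply/seteqP; split=> x /= => [/andP[]|[? ?]]//; apply/andP.
by apply: measurable_andP => //; apply: measurable_ltP.
Qed.

Lemma measurable_perm_act s : measurable_fun setT (@perm_act R s).
Proof. by apply: measurable_fun_MatB => ij; exact: measurable_coord. Qed.

Lemma measurable_distmat : measurable (@distmat R).
Proof.
have mc := measurable_coord.
have meq (f g : MatB R -> R) : measurable_fun setT f -> measurable_fun setT g ->
    measurable [set x | f x = g x].
  move=> mf mg; rewrite (_ : [set x | _] = [set x | f x == g x]); last first.
    by apply/seteqP; split=> x /eqP.
  by apply: measurable_boolP; exact: measurable_fun_eqr.
do !apply: measurable_andP; do !apply: measurable_forall => ?.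
- exact: meq.
- exact: measurable_leP.
- exact: meq.
- by apply: measurable_leP => //; exact: measurable_funD.
Qed.

Lemma eq_probability_boxset (P Q : probability (MatB R) R) :
  (forall L, P (boxset L) = Q (boxset L)) -> forall B, measurable B -> P B = Q B.
Proof.
move=> PQ B mB.
apply: (measure_unique (range boxset) (fun=> setT) MatB_measurableE) => //.
- by move=> _ _ [L _ <-] [L' _ <-]; rewrite setI_boxset; exists (L ++ L').
- by move=> _; exists [::] => //; apply/seteqP; split.
- by rewrite bigcup_const//; exists 0.
- by move=> _ [L _ <-]; exact: PQ.
- by move=> _; rewrite (le_lt_trans (probability_le1 _ _)) ?ltry.
Qed.

End MatrixBorel.

(** * Frequencies *)

Section Frequency.
Context (R : realType).
Implicit Types (Q : nat -> bool).

Definition freq Q n : R := (\sum_(j < n) (Q j)%:R) / n%:R.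

Lemma freq_ge0 Q n : 0 <= freq Q n.
Proof. by rewrite divr_ge0// sumr_ge0. Qed.

Lemma freq_le1 Q n : freq Q n <= 1.
Proof.
rewrite /freq; have [->|n0] := posnP n; first by rewrite invr0 mulr0.
rewrite ler_pdivrMr ?ltr0n// mul1r (le_trans (ler_sum _ (G := fun=> 1) _))//.
  by move=> j _; case: (Q j).
by rewrite sumr_const card_ord.
Qed.

Lemma le_freq Q Q' n : (forall j, Q j -> Q' j) -> freq Q n <= freq Q' n.
Proof.
move=> QQ'; rewrite ler_wpM2r ?invr_ge0// ler_sum// => j _.
by rewrite ler_nat; have := QQ' j; case: (Q j) => // /(_ isT) ->.
Qed.

Lemma freqU Q Q' n : freq (fun j => Q j || Q' j) n <= freq Q n + freq Q' n.
Proof.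
rewrite -mulrDl ler_wpM2r ?invr_ge0// -big_split/= ler_sum// => j _.
by rewrite -natrD ler_nat; case: (Q j); case: (Q' j).
Qed.

Lemma freqC Q n : (0 < n)%N -> freq (fun j => ~~ Q j) n = 1 - freq Q n.
Proof.
move=> n0; apply/eqP; rewrite eq_sym subr_eq -mulrDl -big_split/=.
rewrite (eq_bigr (fun=> 1)); last by move=> j _; case: (Q j); rewrite ?addr0 ?add0r.
by rewrite sumr_const card_ord divff// pnatr_eq0 -lt0n.
Qed.

(** Let [x] be the frequency up to [m] and [t] the number of hits among the [n - m] new terms. The
    difference is [(t - x (n - m)) / n], where [t] and [x (n - m)] both lie in [[0, n - m]]. *)
Lemma freq_dist Q m n : (0 < m <= n)%N -> `|freq Q n - freq Q m| <= (n - m)%:R / m%:R.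
Proof.
move=> /andP[m0 mn].
have m0' : (0 : R) < m%:R by rewrite ltr0n.
have n0' : (0 : R) < n%:R by rewrite ltr0n (leq_trans m0).
have [t [t0 tl St]] : exists t : R, [/\ 0 <= t, t <= (n - m)%:R &
    \sum_(j < n) (Q j)%:R = \sum_(j < m) (Q j)%:R + t].
  exists (\sum_(m <= j < n) (Q j)%:R); split.
  - exact: sumr_ge0.
  - rewrite (le_trans (ler_sum _ (G := fun=> 1) _))//; first by move=> j _; case: (Q j).
    by rewrite sumr_const_nat.
  - rewrite -(big_mkord xpredT (fun j => (Q j)%:R)).
    by rewrite (@big_cat_nat _ _ _ m)//= big_mkord.
have := freq_le1 Q m; have := freq_ge0 Q m; rewrite /freq St.
set s := \sum_(j < m) _; set x := s / m%:R => x0 x1.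
have -> : s = x * m%:R by rewrite /x divfK// gt_eqF.
rewrite natrB// in tl *.
have mn' : (m%:R : R) <= n%:R by rewrite ler_nat.
rewrite (_ : _ - x = (t - x * (n%:R - m%:R)) / n%:R); last by field; rewrite gt_eqF.
rewrite normrM normfV (gtr0_norm n0') ler_pM//.
  rewrite ler_norml; apply/andP; split; nra.
by rewrite lef_pV2// posrE.
Qed.

Lemma cvg_freq_shift Q N (l : R) :
  freq (fun j => Q (j + N)%N) n @[n --> \oo] --> l <-> freq Q n @[n --> \oo] --> l.
Proof.
(* Both terms of the numerator on the right lie in [[0, N]], so the two frequencies differ by at
   most [N / (n + N)]. *)
have E n : (0 < n)%N -> freq Q (n + N) - freq (fun j => Q (j + N)%N) n =
    ((\sum_(j < N) (Q j)%:R) - freq (fun j => Q (j + N)%N) n * N%:R) / (n + N)%:R.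
  move=> n0; rewrite /freq.
  have -> : \sum_(j < n + N) (Q j)%:R =
      \sum_(j < N) (Q j)%:R + \sum_(j < n) (Q (j + N)%N)%:R :> R.
    rewrite addnC big_split_ord/=; congr +%R; apply: eq_bigr => j _.
    by rewrite addnC.
  have n0' : (0 : R) < n%:R by rewrite ltr0n.
  have N0' : (0 : R) <= N%:R by [].
  by rewrite natrD; field; rewrite !gt_eqF//; lra.
have d0 : freq Q (n + N) - freq (fun j => Q (j + N)%N) n @[n --> \oo] --> (0 : R).
  apply/cvgrPdist_le => e e0.
  near=> n; rewrite sub0r normrN E; last by near: n; exact: nbhs_infty_gt.
  rewrite normrM normfV [X in _ / X]ger0_norm// (@le_trans _ _ (N%:R / (n + N)%:R))//.
    rewrite ler_wpM2r ?invr_ge0// ler_norml.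
    have : (\sum_(j < N) (Q j)%:R : R) <= N%:R.
      rewrite (le_trans (ler_sum _ (G := fun=> 1) _))//; first by move=> j _; case: (Q j).
      by rewrite sumr_const card_ord.
    have : 0 <= \sum_(j < N) (Q j)%:R :> R by exact: sumr_ge0.
    have := freq_ge0 (fun j => Q (j + N)%N) n.
    have := freq_le1 (fun j => Q (j + N)%N) n.
    have : (0 : R) <= N%:R by [].
    by move=> *; apply/andP; split; nra.
  have [->|N0] := posnP N; first by rewrite mul0r ltW.
  have nN : (0 : R) < (n + N)%:R by rewrite ltr0n addn_gt0 N0 orbT.
  rewrite ler_pdivrMr// -ler_pdivrMl// (@le_trans _ _ n%:R)//; last by rewrite ler_nat leq_addr.
  by near: n; exact: nbhs_infty_ger.
rewrite -(cvg_shiftn N (freq Q)); split=> cl.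
- rewrite (_ : (fun n => _) = fun n => (freq Q (n + N) - freq (fun j => Q (j + N)%N) n)
    + freq (fun j => Q (j + N)%N) n); last by apply/funext => n; rewrite subrK.
  by rewrite -[l]add0r; exact: cvgD.
- rewrite (_ : (fun n => _) = fun n => freq Q (n + N) -
    (freq Q (n + N) - freq (fun j => Q (j + N)%N) n)); last by apply/funext => n; rewrite subKr.
  by rewrite -[l]subr0; exact: cvgB.
Unshelve. all: by end_near. Qed.

Lemma cvg_freq_eventually Q Q' N (l : R) : (forall j, (N <= j)%N -> Q j = Q' j) ->
  freq Q n @[n --> \oo] --> l -> freq Q' n @[n --> \oo] --> l.
Proof.
move=> QQ' /(cvg_freq_shift Q N) Ql; apply/(cvg_freq_shift Q' N).
rewrite (_ : (fun n => _) = freq (fun j => Q (j + N)%N))//; apply/funext => n.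
by congr freq; apply/funext => j; rewrite QQ'// leq_addl.
Qed.

(* Fourth powers are sparse enough for summability and dense enough for interpolation. *)
Lemma is_cvg_freq_pow4 Q : cvgn (fun k => freq Q (k.+1 ^ 4)) -> cvgn (freq Q).
Proof.
move=> /cvg_ex[l /= cl]; apply/cvg_ex; exists l.
apply/cvgrPdist_le => e e0; have e20 : 0 < e / 2 by rewrite divr_gt0.
have /cvgrPdist_le/(_ _ e20)[K1 _ HK1] := cl.
(* The constant 15 bounds [((m + 1)^4 - m^4) / m^3 = 4 + 6/m + 4/m^2 + 1/m^3] for [m >= 1]; here
   [m = k + 1]. *)
have [K2 HK2] : exists K, forall k, (K <= k)%N -> 15 / k.+1%:R <= e / 2 :> R.
  have [K _ HK] := nbhs_infty_ger (15 / (e / 2)).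
  exists K => k /HK /=; rewrite ler_pdivrMr// => H.
  rewrite ler_pdivrMr ?ltr0n// mulrC (le_trans H)// ler_wpM2r ?ler_nat//.
  exact: ltW.
pose K := maxn K1 K2.
exists (K.+1 ^ 4)%N => // n /= Kn.
have [k [Kk kn nk]] : exists k, [/\ (K <= k)%N, (k.+1 ^ 4 <= n)%N & (n < k.+2 ^ 4)%N].
  have ex : exists k, (k.+1 ^ 4 <= n)%N by exists K.
  have ub k : (k.+1 ^ 4 <= n)%N -> (k <= n)%N.
    by apply: leq_trans; rewrite (leq_trans (leqnSn k))// -{1}[k.+1]expn1 leq_pexp2l.
  case: (ex_maxnP ex ub) => k kn max; exists k; split=> //; first exact: max.
  by rewrite ltnNge; apply/negP => /max; rewrite ltnn.
have -> : l - freq Q n = (l - freq Q (k.+1 ^ 4)) - (freq Q n - freq Q (k.+1 ^ 4)) by ring.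
rewrite (le_trans (ler_normB _ _))// [e]splitr lerD//.
  by apply: HK1 => /=; rewrite (leq_trans _ Kk)// leq_maxl.
rewrite (le_trans (freq_dist _ _))//.
apply: le_trans (HK2 k _); last by rewrite (leq_trans _ Kk)// leq_maxr.
rewrite ler_pdivrMr ?ltr0n ?expn_gt0//.
have -> : 15 / k.+1%:R * (k.+1 ^ 4)%:R = (15 * k.+1 ^ 3)%:R :> R.
  rewrite natrM !natrX; have : k.+1%:R != 0 :> R by rewrite pnatr_eq0.
  by move: (k.+1%:R : R) => x x0; field.
rewrite ler_nat leq_subLR (leq_trans (ltnW nk))//.
rewrite -[k.+2]addn1; move: k.+1 (ltn0Sn k) => m m0.
rewrite !expnS !expn0; nia.
Qed.

End Frequency.

Lemma cvg_bigsum (R : realType) (I : Type) (s : seq I) (F : I -> nat -> R) (l : I -> R) :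
  (forall i, F i n @[n --> \oo] --> l i) ->
  \sum_(i <- s) F i n @[n --> \oo] --> \sum_(i <- s) l i.
Proof.
move=> Fl; elim: s => [|i s IH].
  by rewrite big_nil; under eq_fun do rewrite big_nil; exact: cvg_cst.
by rewrite big_cons; under eq_fun do rewrite big_cons; exact: cvgD.
Qed.

Lemma cvg_bigprod (R : realType) (I : Type) (s : seq I) (F : I -> nat -> R) (l : I -> R) :
  (forall i, F i n @[n --> \oo] --> l i) ->
  \prod_(i <- s) F i n @[n --> \oo] --> \prod_(i <- s) l i.
Proof.
move=> Fl; elim: s => [|i s IH].
  by rewrite big_nil; under eq_fun do rewrite big_nil; exact: cvg_cst.
by rewrite big_cons; under eq_fun do rewrite big_cons; exact: cvgM.
Qed.

(** * Law of large numbers for exchangeable events *)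

Section ExchangeableLLN.
Context d (T : measurableType d) (R : realType) (P : probability T R).
Variables (A : nat -> set T) (a b : R).
Hypothesis mA : forall j, measurable (A j).
Hypothesis prA : forall j, pr P (A j) = a.
Hypothesis prA2 : forall i j, i != j -> pr P (A i `&` A j) = b.

(** When the weights sum to 0 the term in [b] disappears. Hence differences of two averages are
    small in mean square, although the events are correlated and a single average may have a random
    limit. *)
Let Ex_sqr m (u : 'I_m -> R) :
  Ex P (fun x => (\sum_(j < m) u j * \1_(A j) x) ^+ 2) =
  (a - b) * \sum_(j < m) u j ^+ 2 + b * (\sum_(j < m) u j) ^+ 2.
Proof.
have -> : (fun x => (\sum_(j < m) u j * \1_(A j) x) ^+ 2) =
    (fun x => \sum_(i < m) \sum_(j < m) (u i * u j) * \1_(A i `&` A j) x).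
  apply/funext => x; rewrite expr2 big_distrlr/=; apply: eq_bigr => i _.
  by apply: eq_bigr => j _; rewrite indicI/= mulrACA.
have bAA u' i j : mbounded (fun x => u' * \1_(A i `&` A j) x : R).
  by apply: mboundedZ; apply: mbounded_indic; exact: measurableI.
rewrite Ex_sum; last by move=> i; exact: mbounded_sum.
rewrite [X in b * X]expr2 big_distrlr/= !mulr_sumr -big_split/=.
apply: eq_bigr => i _; rewrite Ex_sum// mulr_sumr (bigD1 i)//= [in RHS](bigD1 i)//=.
rewrite ExZ; last by apply: mbounded_indic; exact: measurableI.
rewrite Ex_indic; last exact: measurableI.
rewrite setIid prA -expr2 addrA; congr +%R; first by ring.
apply: eq_bigr => j ji; rewrite ExZ; last by apply: mbounded_indic; exact: measurableI.
rewrite Ex_indic; last exact: measurableI.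
by rewrite prA2 1?eq_sym// mulrC.
Qed.

Let avg n x : R := freq R (fun j => x \in A j) n.

Let avg_mb n : mbounded (avg n).
Proof.
rewrite (_ : avg n = fun x => n%:R^-1 * \sum_(j < n) \1_(A j) x).
  by apply: mboundedZ; apply: mbounded_sum => j; exact: mbounded_indic.
by apply/funext => x; rewrite /avg /freq mulrC; under [in RHS]eq_bigr do rewrite indicE.
Qed.

Let avg_dist_sqr n m : (0 < n <= m)%N ->
  Ex P (fun x => (avg n x - avg m x) ^+ 2) <= n%:R^-1.
Proof.
move=> /andP[n0 nm].
have n0' : (0 : R) < n%:R by rewrite ltr0n.
have m0' : (0 : R) < m%:R by rewrite ltr0n (leq_trans n0).
(* The weights of the difference of the two averages: they sum to 0 and their squares sum to
   [1/n - 1/m]. *)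
pose u (j : nat) : R := (if (j < n)%N then n%:R^-1 else 0) - m%:R^-1.
have sumn (c : R) : \sum_(j < m) (if (j < n)%N then c else 0) = n%:R * c.
  rewrite -big_mkcond/= -(big_ord_widen m (fun=> c))//.
  by rewrite sumr_const card_ord mulr_natl.
have -> : (fun x => (avg n x - avg m x) ^+ 2) =
    (fun x => (\sum_(j < m) u j * \1_(A j) x) ^+ 2).
  apply/funext => x; congr (_ ^+ 2); rewrite /u.
  under [RHS]eq_bigr do rewrite mulrBl.
  rewrite big_split/= sumrN; congr (_ - _).
    rewrite /avg /freq (big_ord_widen m (fun j => (x \in A j)%:R : R))// big_mkcond mulr_suml.
    by apply: eq_bigr => j _; rewrite indicE; case: ifP; rewrite ?mul0r// mulrC.
  by rewrite /avg /freq mulr_suml; apply: eq_bigr => j _; rewrite indicE mulrC.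
rewrite Ex_sqr.
have -> : \sum_(j < m) u j = 0.
  rewrite big_split/= sumn sumr_const card_ord -[_ *+ m]mulr_natl mulrN.
  by rewrite !mulfV ?gt_eqF// subrr.
have -> : \sum_(j < m) u j ^+ 2 = n%:R^-1 - m%:R^-1.
  have -> : \sum_(j < m) u j ^+ 2 = \sum_(j < m)
     ((if (j < n)%N then n%:R^-1 ^+ 2 - 2 * n%:R^-1 * m%:R^-1 else 0) + m%:R^-1 ^+ 2).
    by apply: eq_bigr => j _; rewrite /u; case: ifP => _; ring.
  rewrite big_split/= sumn sumr_const card_ord -[_ *+ m]mulr_natl; field.
  by rewrite !gt_eqF.
rewrite expr0n/= mulr0 addr0.
have b0 : 0 <= b by rewrite -(@prA2 0%N 1%N)// pr_ge0.
have a1 : a <= 1 by rewrite -(prA 0) pr_le1.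
have ab : b <= a.
  by rewrite -(@prA2 0%N 1%N)// -(prA 0) le_pr//; exact: measurableI.
have : 0 <= m%:R^-1 :> R by rewrite invr_ge0.
have : m%:R^-1 <= n%:R^-1 :> R by rewrite lef_pV2 ?posrE// ler_nat.
have : 0 <= n%:R^-1 :> R by rewrite invr_ge0.
nra.
Qed.

Let D k x : R := avg (k.+2 ^ 4) x - avg (k.+1 ^ 4) x.

(** With [c = k + 1] the second moment is at most [c^-4], so the first absolute moment is at most
    [c^-2 <= 2 / (c (c + 1))]. The right-hand side is this bound in telescoping form; its sum over
    [k] is at most 2. *)
Let ExD k : Ex P (fun x => `|D k x|) <= k.+1%:R^-1 - k.+2%:R^-1 + k.+1%:R^-1 - k.+2%:R^-1.
Proof.
have k1 : (0 : R) < k.+1%:R by rewrite ltr0n.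
have bD : mbounded (D k) by apply: mboundedB; exact: avg_mb.
have bD2 : mbounded (fun x => D k x ^+ 2) by exact: mboundedM.
have : Ex P (fun x => D k x ^+ 2) <= (k.+1 ^ 4)%:R^-1.
  apply: le_trans (avg_dist_sqr (n := k.+1 ^ 4) (m := k.+2 ^ 4) _).
    by under eq_fun do rewrite -sqrrN opprB.
  by rewrite expn_gt0/= leq_exp2r.
move=> ED.
(* AM-GM: [2 |t| <= c^2 t^2 + c^-2] with [c = k + 1] *)
have le1 : Ex P (fun x => `|D k x|) <=
    Ex P (fun x => k.+1%:R ^+ 2 / 2 * D k x ^+ 2 + (2 * k.+1%:R ^+ 2)^-1).
  apply: le_Ex; first exact: mbounded_norm.
    by apply: mboundedD; [exact: mboundedZ|exact: mbounded_cst].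
  move=> x; set t := D k x; rewrite -(real_normK (num_real t)); set s := `|t|.
  rewrite -subr_ge0 (_ : _ - _ = (k.+1%:R * s - k.+1%:R^-1) ^+ 2 / 2).
    by rewrite divr_ge0// sqr_ge0.
  by move: k1; move: (k.+1%:R : R) => c c0; field; rewrite gt_eqF.
apply: le_trans le1 _; rewrite ExD ?Ex_cst ?ExZ//; last 2 first.
- exact: mboundedZ.
- exact: mbounded_cst.
rewrite natrX in ED.
have k2E : k.+2%:R = k.+1%:R + 1 :> R by rewrite -natr1.
rewrite k2E; have k11 : 1 <= k.+1%:R :> R by rewrite ler1n.
move: ED k1 k11; move: (k.+1%:R : R) (Ex P _) => c e ce c0 c1.
have /le_trans : c ^+ 2 / 2 * e + (2 * c ^+ 2)^-1 <= c ^+ 2 / 2 * (c ^+ 4)^-1 + (2 * c ^+ 2)^-1.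
  by rewrite lerD2r ler_wpM2l// divr_ge0// exprn_ge0// ltW.
apply.
have -> : c ^+ 2 / 2 * (c ^+ 4)^-1 + (2 * c ^+ 2)^-1 = (c ^+ 2)^-1 by field; rewrite gt_eqF.
have -> : c^-1 - (c + 1)^-1 + c^-1 - (c + 1)^-1 = 2 / (c * (c + 1)).
  by field; rewrite !gt_eqF//; lra.
rewrite ler_pdivlMr ?mulr_gt0//; last by lra.
rewrite mulrC ler_pdivrMr ?exprn_gt0//; nra.
Qed.

(** Along fourth powers the increments of the averages have summable first moments, so almost surely
    their series converges absolutely; [is_cvg_freq_pow4] fills the gaps. *)
Lemma ae_cvg_freq0 : {ae P, forall x, cvgn (freq R (fun j => x \in A j))}.
Proof.
have mD k : measurable_fun setT (fun x => `|D k x|).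
  have [] : mbounded (fun x => `|D k x|) => //.
  by apply: mbounded_norm; apply: mboundedB; exact: avg_mb.
pose h x : \bar R := (\sum_(0 <= k <oo) (`|D k x|)%:E)%E.
have mh : measurable_fun setT h.
  by apply: ge0_emeasurable_sum => k *; rewrite ?lee_fin//; exact/measurable_EFinP.
have ih : P.-integrable setT h.
  apply/integrableP; split=> //.
  under eq_integral do rewrite gee0_abs ?nneseries_ge0//.
  rewrite integral_nneseries//; last by move=> k; exact/measurable_EFinP.
  apply: (@le_lt_trans _ _ 2%:E); last by rewrite ltry.
  apply: lime_le; first by apply: is_cvg_nneseries => k _ _; exact: integral_ge0.
  apply: nearW => n; rewrite big_mkord.
  rewrite (eq_bigr (fun k : 'I_n => (Ex P (fun x => `|D k x|))%:E)); last first.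
    by move=> k _; rewrite Ex_EFin//; apply: mbounded_norm; apply: mboundedB; exact: avg_mb.
  rewrite sumEFin lee_fin (le_trans (ler_sum _ (fun (k : 'I_n) _ => ExD k)))//.
  suff -> : \sum_(k < n) (k.+1%:R^-1 - k.+2%:R^-1 + k.+1%:R^-1 - k.+2%:R^-1) =
    2 - n.+1%:R^-1 - n.+1%:R^-1 :> R.
    by rewrite -addrA -opprD gerBl addr_ge0// invr_ge0.
  elim: n => [|n IH]; first by rewrite big_ord0 invr1; ring.
  by rewrite big_ord_recr/= IH; ring.
apply: filterS (integrable_ae measurableT ih) => x /(_ I) hx.
apply: is_cvg_freq_pow4; rewrite -/(avg _ x).
have cD : cvgn (series (fun k => D k x)).
  apply: normed_cvg; apply: nondecreasing_is_cvgn.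
    by apply: nondecreasing_series => k _ _; exact: normr_ge0.
  exists (fine (h x)) => _ [n _ <-].
  rewrite -lee_fin fineK// /series/= -sumEFin big_mkord -(big_mkord xpredT (fun k => (`|D k x|)%:E)).
  exact: nneseries_lim_ge.
have -> : (fun k => freq R (fun j => x \in A j) (k.+1 ^ 4)) =
    (fun n => series (fun k => D k x) n + avg (1 ^ 4) x).
  apply/funext => k; rewrite /series/= (telescope_sumr (fun k => avg (k.+1 ^ 4) x))//.
  by rewrite subrK.
by apply: is_cvgD => //; exact: is_cvg_cst.
Qed.

End ExchangeableLLN.

(** The events to come involve the rows below some [N] and are exchangeable only in the columns from
    [N] on; a limit frequency ignores the first [N] terms. *)
Lemma ae_cvg_freq d (T : measurableType d) (R : realType) (P : probability T R)
    (A : nat -> set T) (a b : R) N : (forall j, measurable (A j)) ->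
    (forall j, (N <= j)%N -> pr P (A j) = a) ->
    (forall i j, (N <= i)%N -> (N <= j)%N -> i != j -> pr P (A i `&` A j) = b) ->
  {ae P, forall x, cvgn (freq R (fun j => x \in A j))}.
Proof.
move=> mA prA prA2.
have : {ae P, forall x, cvgn (freq R (fun j => x \in A (j + N)%N))}.
  apply: (@ae_cvg_freq0 _ T R P (fun j => A (j + N)%N) a b) => [j|j|i j ij].
  - exact: mA.
  - by apply: prA; exact: leq_addl.
  - by apply: prA2; rewrite ?leq_addl// eqn_add2r.
apply: filterS => x /cvg_ex[l cl]; apply/cvg_ex; exists l.
by apply/cvg_freq_shift; exact: cl.
Qed.

(** * Random sequences from nested intervals *)

Section UniformMeasure.
Context (R : realType).

Definition unif : set (measurableTypeR R) -> \bar R :=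
  mrestr (@lebesgue_measure R) (measurable_itv `[0, 1[).

HB.instance Definition _ := Measure.on unif.

Let unif_setT : unif setT = 1%E.
Proof.
by rewrite /unif /mrestr setTI lebesgue_measure_itv/= lte_fin ltr01 oppr0 adde0.
Qed.

HB.instance Definition _ := @Measure_isProbability.Build _ _ R unif unif_setT.

Lemma unifE A : unif A = lebesgue_measure (A `&` `[0, 1[%classic).
Proof. by []. Qed.

End UniformMeasure.
Arguments unif : clear implicits.

(* A consistent weight [q] on words cuts [0, 1) into nested intervals of length [q w]; the
   word of intervals around a uniform point then has law [q] (Kolmogorov extension). *)
Section NestedIntervals.
Context (R : realType) (q : seq nat -> R).
Hypothesis q_ge0 : forall w, 0 <= q w.
Hypothesis q_nil : q [::] = 1.
Hypothesis q_cvg : forall w : seq nat, \sum_(c < n) q (rcons w c) @[n --> \oo] --> q w.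

(** The left end of the interval of [w]: for each letter of [w], the lengths of the siblings that
    precede the prefix ending with that letter. *)
Definition lft (w : seq nat) : R :=
  \sum_(k < size w) \sum_(c < nth 0%N w k) q (rcons (take k w) c).

Lemma lft_rcons w c : lft (rcons w c) = lft w + \sum_(d < c) q (rcons w d).
Proof.
rewrite /lft size_rcons big_ord_recr/= nth_rcons ltnn eqxx.
congr (_ + _); last by rewrite -cats1 take_size_cat.
apply: eq_bigr => k _; rewrite nth_rcons ltn_ord.
by rewrite -cats1 takel_cat// ltnW.
Qed.

Lemma sum_children_le (w : seq nat) n : \sum_(c < n) q (rcons w c) <= q w.
Proof.
have nd : nondecreasing_seq (fun n => \sum_(c < n) q (rcons w c)).
  apply/nondecreasing_seqP => m; rewrite big_ord_recr/= lerDl; exact: q_ge0.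
rewrite -(cvg_lim (@Rhausdorff R) (@q_cvg w)).
apply: (nondecreasing_cvgn_le nd); apply/cvg_ex; exists (q w); exact: q_cvg.
Qed.

Lemma itv_rcons_sub w c : lft w <= lft (rcons w c) /\
  lft (rcons w c) + q (rcons w c) <= lft w + q w.
Proof.
rewrite lft_rcons; split; first by rewrite lerDl sumr_ge0.
rewrite -addrA lerD2l; apply: le_trans (sum_children_le w c.+1).
by rewrite big_ord_recr.
Qed.

Lemma lft_ge0 w : 0 <= lft w.
Proof. by apply: sumr_ge0 => k _; exact: sumr_ge0. Qed.

Lemma lftD_le1 w : lft w + q w <= 1.
Proof.
elim/last_ind: w => [|w c IH]; first by rewrite /lft big_ord0 add0r q_nil.
by apply: le_trans IH; have [] := itv_rcons_sub w c.
Qed.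

Definition next_letter (w : seq nat) (u : R) : nat :=
  if pselect (exists c, u < lft w + \sum_(d < c.+1) q (rcons w d)) is left h
  then ex_minn h else 0%N.

Lemma next_letterP w u c : lft w <= u < lft w + q w ->
  next_letter w u = c <-> lft (rcons w c) <= u < lft (rcons w c) + q (rcons w c).
Proof.
move=> /andP[wu uw]; rewrite /next_letter; case: pselect => [h|]; last first.
  (* Here the children must exhaust the interval: [u] lies strictly before its right end, so some
     partial sum of the lengths passes [u]. *)
  case; have : u - lft w < q w by rewrite ltrBlDl.
  move: (@q_cvg w) => /cvgrPdist_lt/(_ (q w - (u - lft w))) H uq.
  have {}H := H ltac:(by rewrite subr_gt0).
  move: H => [N _ /(_ N.+1 (leqnSn _))] /= /(le_lt_trans (ler_norm _)) H.
  by exists N; lra.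
have mono n m : (n <= m)%N -> \sum_(d < n) q (rcons w d) <= \sum_(d < m) q (rcons w d).
  move=> /subnK <-; elim: (m - n)%N => [//|k IH].
  by rewrite addSn big_ord_recr/= (le_trans IH)// lerDl.
case: ex_minnP => m um minm; rewrite lft_rcons -addrA.
have S : \sum_(d < c) q (rcons w d) + q (rcons w c) = \sum_(d < c.+1) q (rcons w d).
  by rewrite big_ord_recr.
rewrite S; split=> [<-|/andP[cu uc]].
  rewrite um andbT leNgt; apply/negP; case: m um minm => [|m] um minm.
    by rewrite big_ord0 addr0 ltNge wu.
  by move=> /minm; rewrite ltnn.
apply/eqP; rewrite eqn_leq minm//=; rewrite leqNgt; apply/negP => mc.
move: cu; rewrite leNgt => /negP; apply; apply: (lt_le_trans um).
by rewrite lerD2l; exact: mono.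
Qed.

Fixpoint word (u : R) (n : nat) : seq nat :=
  if n is m.+1 then rcons (word u m) (next_letter (word u m) u) else [::].

(** The default 0 outside [[0, 1)] makes the letters total functions on [R]; the uniform measure
    does not charge that region. *)
Definition letter (u : R) (n : nat) : nat :=
  if 0 <= u < 1 then next_letter (word u n) u else 0%N.

Lemma mkseq_letter u n : 0 <= u < 1 -> mkseq (letter u) n = word u n.
Proof. by move=> u01; elim: n => [//|n IH]; rewrite mkseqS IH /letter u01. Qed.

Lemma letterP u w : 0 <= u < 1 ->
  mkseq (letter u) (size w) = w <-> lft w <= u < lft w + q w.
Proof.
move=> u01; elim/last_ind: w => [|w c IH].
  by rewrite /lft big_ord0 q_nil add0r u01.
have nextE : mkseq (letter u) (size w) = w -> letter u (size w) = next_letter w u.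
  by rewrite mkseq_letter// /letter u01 => ->.
rewrite size_rcons mkseqS; split.
  move=> /eqP; rewrite eqseq_rcons => /andP[/eqP E /eqP].
  by rewrite nextE// => /(next_letterP _ ((IH.1 E))).
move=> uwc; have [H1 H2] := itv_rcons_sub w c.
have uw : lft w <= u < lft w + q w.
  by move: uwc => /andP[A B]; rewrite (le_trans H1 A) (lt_le_trans B H2).
by rewrite nextE IH.2//; congr rcons; apply/(next_letterP _ uw).
Qed.

Lemma letter_gt0 u n : 0 <= u < 1 -> 0 < q (mkseq (letter u) n).
Proof.
move=> u01; have [+ _] := letterP (mkseq (letter u) n) u01.
by rewrite size_mkseq => /(_ erefl) /andP[A B]; rewrite -(ltrD2l (lft (mkseq (letter u) n))) addr0 (le_lt_trans A).
Qed.

Lemma letter_dist u n : 0 <= u < 1 ->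
  `|u - lft (mkseq (letter u) n)| <= q (mkseq (letter u) n).
Proof.
move=> u01; have [+ _] := letterP (mkseq (letter u) n) u01.
rewrite size_mkseq => /(_ erefl) /andP[A B].
by rewrite ger0_norm ?subr_ge0// lerBlDl ltW.
Qed.

Let wordset w : [set u | mkseq (letter u) (size w) = w] `&` `[0, 1[%classic =
  `[lft w, lft w + q w[%classic.
Proof.
apply/seteqP; split=> u /=; rewrite !in_itv/=.
  by move=> [uw u01]; apply/letterP.
move=> uw; have u01 : 0 <= u < 1.
  move: uw => /andP[A B].
  by rewrite (le_trans (lft_ge0 w) A) (lt_le_trans B (lftD_le1 w)).
by split=> //; apply/letterP.
Qed.

Lemma measurable_letter w : measurable [set u | mkseq (letter u) (size w) = w].
Proof.
(* Outside [[0, 1)] every letter is the default 0, so that region belongs to the event exactly when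
   [w] is a word of zeros. *)
rewrite (_ : [set u | _] = `[lft w, lft w + q w[%classic `|`
  ([set u | ~ (0 <= u < 1)] `&` [set _ | nseq (size w) 0%N = w])).
  apply: measurableU => //; apply: measurableI; last exact: measurable_cstP.
  have := measurableC (measurable_itv `[0 : R, 1[).
  congr measurable; apply/seteqP; split=> u /=; by rewrite in_itv.
rewrite -wordset; apply/seteqP; split=> u /=; rewrite in_itv/=.
  move=> uw; case/boolP: (0 <= u < 1) => u01; [left|right] => //; split; first exact/negP.
  rewrite -{2}uw; apply: (@eq_from_nth _ 0%N); rewrite ?size_nseq ?size_mkseq// => i iw.
  by rewrite nth_nseq nth_mkseq// iw /letter (negbTE u01).
move=> [[]//|[/negP u01 wE]].
rewrite -{2}wE; apply: (@eq_from_nth _ 0%N); rewrite ?size_nseq ?size_mkseq// => i iw.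
by rewrite nth_nseq nth_mkseq// iw /letter (negbTE u01).
Qed.

Lemma unif_letter w : unif R [set u | mkseq (letter u) (size w) = w] = (q w)%:E.
Proof.
rewrite unifE wordset lebesgue_measure_itv/= lte_fin.
case: ltP => [_|]; first by rewrite -EFinD addrAC subrr add0r.
by rewrite gerDl => q0; congr EFin; apply/le_anti; rewrite q_ge0 q0.
Qed.

Lemma measurable_letter_pred n (Q : seq nat -> Prop) :
  measurable [set u | Q (mkseq (letter u) n)].
Proof.
rewrite (_ : [set u | _] = [set u | exists w, (size w = n /\ Q w) /\
    mkseq (letter u) (size w) = w]).
  apply: measurable_exists => w; apply: measurable_andP; first exact: measurable_cstP.
  exact: measurable_letter.
apply/seteqP; split=> u /=.
  by move=> Qu; exists (mkseq (letter u) n); rewrite !size_mkseq.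
by move=> [w [[<- Qw] uw]]; rewrite uw.
Qed.

End NestedIntervals.

(** * Independent uniform variables *)

Lemma law_exists d d' (T : measurableType d) (T' : measurableType d') (R : realType)
    (P : probability T R) (X : T -> T') : measurable_fun setT X ->
  exists Q : probability T' R, forall B, Q B = P (X @^-1` B).
Proof. by move=> mX; exists (distribution P (mfun_Sub (mem_set mX))). Qed.

Lemma measurable_preimage d d' (T : measurableType d) (T' : measurableType d')
    (f : T -> T') B : measurable_fun setT f -> measurable B -> measurable (f @^-1` B).
Proof. by move=> mf mB; rewrite -[X in measurable X]setTI; exact: mf. Qed.

Lemma eq_mkseq_lt (T : Type) (x y : nat -> T) n :
  (forall k, (k < n)%N -> x k = y k) -> mkseq x n = mkseq y n.
Proof.
move=> xy; elim: n xy => [//|n IH] xy.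
by rewrite !mkseqS IH ?xy// => k kn; rewrite xy// ltnS ltnW.
Qed.

Section SequenceSpace.

Definition cyl (w : seq nat) : set (nat -> nat) := [set x | mkseq x (size w) = w].

(** Two cylinders are nested or disjoint; with the empty set added the family is closed under
    intersection. *)
Definition cyls : set (set (nat -> nat)) := set0 |` range cyl.

Definition seqB : measurableType (sigma_display cyls) := g_sigma_algebraType cyls.

Lemma measurable_cyl w : measurable (cyl w : set seqB).
Proof. by apply: sub_sigma_algebra; right; exists w. Qed.

Lemma measurable_prefix n (Q : seq nat -> Prop) :
  measurable ([set x | Q (mkseq x n)] : set seqB).
Proof.
rewrite (_ : [set x | _] = [set x : seqB | exists w, (size w = n /\ Q w) /\ cyl w x]).
  apply: (@measurable_exists _ seqB) => w; apply: measurable_andP; first exact: measurable_cstP.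
  exact: measurable_cyl.
apply/seteqP; split=> x /=.
  by move=> Qx; exists (mkseq x n); rewrite /cyl/= !size_mkseq.
by move=> [w [[<- Qw] xw]]; rewrite xw.
Qed.

Lemma measurable_fun_seqB d (T : measurableType d) (f : T -> seqB) :
  (forall w, measurable (f @^-1` cyl w)) -> measurable_fun setT f.
Proof.
move=> mf; apply: (@measurability _ _ _ seqB setT f cyls) => // _ [C [->|[w _ <-]] <-].
  by rewrite preimage_set0 setI0.
by rewrite setTI; exact: mf.
Qed.

Lemma take_mkseq_le (x : nat -> nat) m n : (m <= n)%N ->
  take m (mkseq x n) = mkseq x m.
Proof. by move=> mn; rewrite /mkseq -map_take take_iota (minn_idPl mn). Qed.

Lemma setI_closed_cyls : setI_closed cyls.
Proof.
have hle w w' : (size w <= size w')%N -> cyls (cyl w `&` cyl w').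
  move=> ww'; have [E|E] := eqVneq (take (size w) w') w.
    rewrite setIC; right; exists w' => //; apply/esym/setIidl => x /= xw'.
    by rewrite /cyl/= -(take_mkseq_le _ ww') xw'.
  left; apply/seteqP; split=> // x [/= xw xw']; move/eqP: E; apply.
  by rewrite -[w' in LHS]xw' take_mkseq_le.
move=> A B [->|[w _ <-]]; first by rewrite set0I; left.
move=> [->|[w' _ <-]]; first by rewrite setI0; left.
by case: (leqP (size w) (size w')) => [/hle//|/ltnW /hle]; rewrite setIC.
Qed.

Lemma cyl_nil : cyl [::] = setT.
Proof. by apply/seteqP; split. Qed.

Lemma eq_probability_cyl (R : realType) (P Q : probability seqB R) :
  (forall w, P (cyl w) = Q (cyl w)) -> forall B, measurable B -> P B = Q B.
Proof.
move=> PQ B mB.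
apply: (@measure_unique _ R seqB cyls (fun=> setT) erefl setI_closed_cyls) => //.
- by move=> _; right; exists [::] => //; rewrite cyl_nil.
- by rewrite bigcup_const//; exists 0.
- by move=> _ [->|[w _ <-]]; [rewrite !measure0|exact: PQ].
- by move=> _; rewrite (le_lt_trans (probability_le1 _ _)) ?ltry.
Qed.

End SequenceSpace.

Section IidUniform.
Context (R : realType).

(** Fair bits on the alphabet [nat]: the letters 0 and 1 have weight 1/2 and the others weight 0, so
    that [lft] of a word of bits is the binary fraction that it spells. *)
Let g (c : nat) : R := if (c < 2)%N then 2^-1 else 0.

Let q (w : seq nat) : R := \prod_(c <- w) g c.

Let g_ge0 c : 0 <= g c.
Proof. by rewrite /g; case: ifP. Qed.

Let q_ge0 w : 0 <= q w.
Proof. by apply: prodr_ge0 => c _. Qed.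

Let q_nil : q [::] = 1.
Proof. by rewrite /q big_nil. Qed.

Let q_rcons w c : q (rcons w c) = q w * g c.
Proof. by rewrite /q -cats1 big_cat big_seq1. Qed.

Let q_cvg (w : seq nat) : \sum_(c < n) q (rcons w c) @[n --> \oo] --> q w.
Proof.
apply: cvg_near_cst; exists 2%N => // n /= n2.
under eq_bigr do rewrite q_rcons.
rewrite -mulr_sumr -(subnK n2) addn2 !big_ord_recl/= big1; last by move=> i _; rewrite /g.
rewrite /g/= addr0 (_ : 2^-1 + 2^-1 = 1) ?mulr1//; lra.
Qed.

Let q_small w : q w <= 2^-1 ^+ size w.
Proof.
elim/last_ind: w => [|w c IH]; first by rewrite q_nil expr0.
rewrite q_rcons size_rcons exprSr ler_pM// /g.
by case: ifP => // _; rewrite invr_ge0.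
Qed.

Let bits : R -> seqB := letter q.

Let measurable_bits : measurable_fun setT bits.
Proof. by apply: measurable_fun_seqB => w; exact: measurable_letter. Qed.

Let P0 : {P : probability seqB R | forall B, P B = unif R (bits @^-1` B)}.
Proof. by apply/cid; exact: law_exists. Qed.

Let P := sval P0.

Let PE B : P B = unif R (bits @^-1` B).
Proof. exact: (svalP P0). Qed.

Let P_cyl w : P (cyl w) = (q w)%:E.
Proof. by rewrite PE; exact: unif_letter. Qed.

(** A left inverse of [bits] on [[0, 1)]. The limsup is defined and measurable on all sequences,
    also on those that code no point. *)
Let val_of (x : seqB) : R := limn_sup (fun n => lft q (mkseq x n)).

Let measurable_val : measurable_fun setT val_of.
Proof.
have lft_le1 w : lft q w <= 1.
  by apply: le_trans (lftD_le1 q_ge0 q_nil q_cvg w); rewrite lerDl.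
apply: measurable_fun_limn_sup.
- by move=> x _; exists 1 => _ [n _ <-].
- by move=> x _; exists 0 => _ [n _ <-]; exact: lft_ge0.
- move=> n; apply: measurable_lt_rat => r.
  exact: (measurable_prefix n (fun w => lft q w < ratr r)).
Qed.

Let val_bits u : 0 <= u < 1 -> val_of (bits u) = u.
Proof.
move=> u01; have : lft q (mkseq (bits u) n) @[n --> \oo] --> u.
  apply/cvgrPdist_le => e e0.
  have := @cvg_expr R 2^-1; rewrite ger0_norm// => /(_ ltac:(lra)).
  move=> /cvgrPdist_le/(_ _ e0); apply: filterS => n; rewrite sub0r normrN => ne.
  apply: le_trans (letter_dist q_ge0 q_nil q_cvg n u01) _.
  by apply: le_trans (q_small _) _; rewrite size_mkseq; apply: le_trans ne; exact: ler_norm.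
by move=> /cvg_sups /(cvg_lim (@Rhausdorff R)).
Qed.

(* Fair bits interleaved with an independent copy are again fair bits; peeling off the even
   positions repeatedly yields countably many independent copies. *)
Let evens (x : seqB) : seqB := fun k => x k.*2.
Let odds (x : seqB) : seqB := fun k => x k.*2.+1.
Let interleave (z : seqB * seqB) : seqB := fun k => if odd k then z.2 k./2 else z.1 k./2.

Let measurable_evens : measurable_fun setT evens.
Proof.
apply: measurable_fun_seqB => w.
have := measurable_prefix (size w).*2
  (fun s => mkseq (fun k => nth 0%N s k.*2) (size w) = w).
congr measurable; apply/funext => x; congr (_ = w); apply: eq_mkseq_lt => k kw.
by rewrite nth_mkseq// ltn_double.
Qed.

Let measurable_odds : measurable_fun setT odds.
Proof.
apply: measurable_fun_seqB => w.
have := measurable_prefix (size w).*2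
  (fun s => mkseq (fun k => nth 0%N s k.*2.+1) (size w) = w).
congr measurable; apply/funext => x; congr (_ = w); apply: eq_mkseq_lt => k kw.
by rewrite nth_mkseq// ltn_Sdouble.
Qed.

Let interleave_cyl w : interleave @^-1` cyl w =
  cyl (mkseq (fun k => nth 0%N w k.*2) (uphalf (size w))) `*`
  cyl (mkseq (fun k => nth 0%N w k.*2.+1) (size w)./2).
Proof.
apply/seteqP; split=> -[x y] /=.
  rewrite /cyl/= => E; rewrite !size_mkseq; split.
    apply: eq_mkseq_lt => k kw.
    by rewrite -E nth_mkseq /interleave/= ?odd_double ?doubleK//; lia.
  apply: eq_mkseq_lt => k kw.
  by rewrite -E nth_mkseq /interleave/= ?odd_double ?uphalf_double//; lia.
rewrite /cyl/= !size_mkseq => -[E1 E2].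
apply: (@eq_from_nth _ 0%N) => [|k]; rewrite size_mkseq// => kw.
rewrite nth_mkseq// /interleave/=; case: ifP => ok.
  have := congr1 (fun s => nth 0%N s k./2) E2; rewrite !nth_mkseq; try lia.
  by move=> ->; congr nth; lia.
have := congr1 (fun s => nth 0%N s k./2) E1; rewrite !nth_mkseq; try lia.
by move=> ->; congr nth; lia.
Qed.

Let prod_split n (F : nat -> R) : \prod_(k < n) F k =
  (\prod_(k < uphalf n) F k.*2) * \prod_(k < n./2) F k.*2.+1.
Proof.
elim: n => [|n IH]; first by rewrite !big_ord0 mulr1.
rewrite big_ord_recr/= IH uphalf_half -[in F n](odd_double_half n).
case: (odd n) => /=.
  by rewrite add1n !big_ord_recr/=; ring.
by rewrite !add0n big_ord_recr/=; ring.
Qed.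

Let q_nth w : q w = \prod_(k < size w) g (nth 0%N w k).
Proof. by rewrite /q (big_nth 0%N) big_mkord. Qed.

Let split_indep A B : measurable A -> measurable B ->
  P (evens @^-1` A `&` odds @^-1` B) = (P A * P B)%E.
Proof.
move=> mA mB.
have mI : measurable_fun setT interleave.
  apply: measurable_fun_seqB => w; rewrite interleave_cyl.
  by apply: measurableX; exact: measurable_cyl.
(* [Q] is the law of two independent copies interleaved. It agrees with [P] on cylinders because the
   weight of a word is a product over its positions, which splits by parity; under [Q] the claim is
   the product formula. *)
have [Q QE] := law_exists (P \x P)%E mI.
have mAB : measurable (evens @^-1` A `&` odds @^-1` B).
  by apply: measurableI; exact: measurable_preimage.
rewrite (@eq_probability_cyl _ P Q)//.
  rewrite QE -product_measure1E//; congr ((_ \x _)%E _).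
  apply/seteqP; split=> -[x y] /=; rewrite /interleave /evens /odds/=;
    (have -> : (fun k => if odd k.*2 then y k.*2./2 else x k.*2./2) = x
       by apply/funext => k; rewrite odd_double doubleK);
    by have -> : (fun k => if ~~ odd k.*2 then y (uphalf k.*2) else x (uphalf k.*2)) = y
       by apply/funext => k; rewrite odd_double uphalf_double.
move=> w; rewrite QE interleave_cyl.
set w1 := mkseq _ (uphalf _); set w2 := mkseq _ _./2.
transitivity (P (cyl w1) * P (cyl w2))%E; last first.
  by apply/esym/product_measure1E; exact: measurable_cyl.
rewrite !P_cyl -EFinM; congr EFin; rewrite /w1 /w2; rewrite !q_nth !size_mkseq.
rewrite (prod_split (size w) (fun k => g (nth 0%N w k))).
by congr (_ * _); apply: eq_bigr => k _; rewrite nth_mkseq.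
Qed.

Let copy i (x : seqB) : seqB := evens (iter i odds x).

Let measurable_copy i : measurable_fun setT (copy i).
Proof.
rewrite /copy; apply: (measurableT_comp measurable_evens).
elim: i => [|i IH]; first exact: measurable_id.
exact: (measurableT_comp measurable_odds).
Qed.

(** [copy 0] reads the even positions and all further copies read the odd ones only. Measurability
    is carried through the induction because [split_indep] asks for it. *)
Let copy_indep n (A : nat -> set seqB) : (forall i, measurable (A i)) ->
  measurable [set x | forall i, (i < n)%N -> A i (copy i x)] /\
  P [set x | forall i, (i < n)%N -> A i (copy i x)] = (\prod_(i < n) P (A i))%E.
Proof.
elim: n A => [|n IH] A mA.
  rewrite big_ord0 (_ : [set x | _] = setT) ?probability_setT//.
  by apply/seteqP; split.
have [mS PS] := IH (fun i => A i.+1) (fun i => mA i.+1).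
have -> : [set x | forall i, (i < n.+1)%N -> A i (copy i x)] =
    evens @^-1` (A 0) `&` odds @^-1` [set x | forall i, (i < n)%N -> A i.+1 (copy i x)].
  apply/seteqP; split=> x /=.
    move=> H; split; first exact: (H 0).
    by move=> i ni; have := H i.+1 ni; rewrite /copy iterSr.
  by move=> [H0 H] [|i] ni//; rewrite /copy iterSr; exact: H.
split; first by apply: measurableI; exact: measurable_preimage.
by rewrite split_indep// big_ord_recl PS.
Qed.

Lemma iid_uniform_exists : exists U : nat -> R -> R,
  [/\ forall i, measurable_fun setT (U i),
      forall i u, 0 <= U i u < 1 &
      forall n (A : nat -> set R), (forall i, measurable (A i)) ->
        unif R [set u | forall i, (i < n)%N -> A i (U i u)] = (\prod_(i < n) unif R (A i))%E].
Proof.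
(* [val_of] can leave [[0, 1)], for instance at the constant sequence 1, where it equals 1;
   truncation changes nothing at the codes of points of [[0, 1)]. *)
pose tr (v : R) := if 0 <= v < 1 then v else 0.
have mtr : measurable_fun setT tr.
  apply: measurable_fun_ifT => //.
  by apply: measurable_and; [exact: measurable_fun_ler|exact: measurable_fun_ltr].
have mF i : measurable_fun setT (fun x => tr (val_of (copy i x))).
  by apply: (measurableT_comp mtr); apply: (measurableT_comp measurable_val).
exists (fun i u => tr (val_of (copy i (bits u)))); split.
- by move=> i; apply: (measurableT_comp (mF i)).
- by move=> i u; rewrite /tr; case: ifP => //; rewrite lexx ltr01.
move=> n A mA.
have mB i : measurable ((fun x => tr (val_of x)) @^-1` A i).
  by apply: measurable_preimage => //; exact: (measurableT_comp mtr measurable_val).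
have [_] := copy_indep n mB; rewrite PE => ->.
apply: eq_bigr => i _; rewrite PE !unifE; congr (lebesgue_measure _).
by apply/seteqP; split=> u /= []; rewrite in_itv/= => + u01; rewrite /tr val_bits// u01.
Qed.

End IidUniform.

(** * Measurability of the distance map *)

Section DistanceMap.
Context (R : realType) (X : pointedType) (rho : X -> X -> R).
Hypothesis rho_metric : is_metric rho.
Hypothesis rho_sep : rho_separable rho.

Lemma rho_open_ball y (e : R) : rho_open rho [set x | rho x y < e].
Proof.
have [_ [_ [sym tri]]] := rho_metric.
move=> x /= xy; exists (e - rho x y); first by rewrite subr_gt0.
move=> z xz; apply: le_lt_trans (tri _ x _) _.
by rewrite sym -ltrBrDr.
Qed.

Lemma measurable_dist d (T : measurableType d) (f g : T -> XB rho) :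
  measurable_fun setT f -> measurable_fun setT g ->
  measurable_fun setT (fun t => rho (f t) (g t)).
Proof.
move=> mf mg; have [s sP] := rho_sep; have [_ [_ [sym tri]]] := rho_metric.
apply: measurable_lt_rat => q.
(* Separability replaces a condition on the pair by countably many conditions on each point alone:
   pass through a dense point [s n] near [g t] and split [q] at a rational. *)
rewrite (_ : [set t | _] = [set t | exists n (p : rat),
    rho (f t) (s n) < ratr p /\ rho (g t) (s n) < ratr q - ratr p]).
  have mball (h : T -> XB rho) y (e : R) : measurable_fun setT h ->
      measurable [set t | rho (h t) y < e].
    move=> mh; apply: (measurable_preimage mh (B := [set x : XB rho | rho x y < e])).
    by apply: sub_sigma_algebra; exact: rho_open_ball.
  by do 2 apply: measurable_exists => ?; apply: measurable_andP; exact: mball.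
apply/seteqP; split=> t /=; last first.
  move=> [n [p [H1 H2]]]; apply: le_lt_trans (tri _ (s n) _) _.
  by rewrite (sym _ (g t)); lra.
move=> fg; pose e := (ratr q - rho (f t) (g t)) / 2.
have e0 : 0 < e by rewrite divr_gt0// subr_gt0.
have [n gn] := sP (g t) _ e0; exists n.
have fn : rho (f t) (s n) < ratr q - rho (g t) (s n).
  apply: le_lt_trans (tri _ (g t) _) _; rewrite /e in gn; lra.
have [p] := rat_in_itvoo fn; rewrite in_itv/= => /andP[H1 H2].
by exists p; split=> //; lra.
Qed.

Lemma measurable_fun_XNB d (T : measurableType d) (f : T -> XNB rho) :
  (forall i, measurable_fun setT (fun t => f t i : XB rho)) -> measurable_fun setT f.
Proof.
move=> mf; apply: (@measurability _ _ _ (XNB rho) setT f (cylinders rho)) => //.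
move=> _ [_ [n [A [mA ->]]] <-]; rewrite setTI.
exact: (measurable_preimage (mf n) mA).
Qed.

Lemma measurable_XNB_proj i : measurable_fun setT (fun x : XNB rho => x i : XB rho).
Proof. by move=> _ A mA; rewrite setTI; apply: sub_sigma_algebra; exists i, A. Qed.

Lemma measurable_FT : measurable_fun setT (@FT R X rho).
Proof.
apply: measurable_fun_MatB => -[i j].
by apply: measurable_dist; exact: measurable_XNB_proj.
Qed.

Lemma distmat_FT x : distmat (FT (rho := rho) x).
Proof.
have [H0 [H1 [H2 H3]]] := rho_metric.
by split; [move=> i; exact/H1|split; [move=> i j; exact: H0|split => *; [exact: H2|exact: H3]]].
Qed.

(** If no finite subfamily covers, total boundedness yields nested sets [A k] of vanishing diameter
    that are not finitely covered either. Points chosen in them converge by completeness, and a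
    member of [F] around the limit contains some [A k]. *)
Lemma totally_bounded_compact : rho_complete rho ->
  (forall e : R, 0 < e -> exists s : seq X, forall x, exists2 y, y \in s & rho x y < e) ->
  rho_compact rho.
Proof.
move=> cmpl tb F Fo Fcov; apply: contrapT => nofin.
have [H0 [H1 [sym tri]]] := rho_metric.
pose bad (A : set X) := forall s : seq (set X), (forall U, U \in s -> F U) ->
  exists2 x, A x & forall U, U \in s -> ~ U x.
have badT : bad setT.
  move=> s sF; apply: contrapT => nex; apply: nofin; exists s; split=> // x.
  apply: contrapT => nU; apply: nex; exists x => // U Us Ux; apply: nU; by exists U.
pose rad k : R := 2^-1 ^+ k.
have rad0 k : 0 < rad k by rewrite exprn_gt0.
have step (kA : nat * set X) : exists c, bad kA.2 ->
    bad (kA.2 `&` [set x | rho x c < rad kA.1]).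
  case: kA => k A /=; have [s sP] := tb _ (rad0 k).
  apply: contrapT => /forallNP nc.
  have H c : {t : seq (set X) | (forall U, U \in t -> F U) /\
      forall x, A x -> rho x c < rad k -> exists2 U, U \in t & U x}.
    apply: cid; have /not_implyP[_ /existsNP[t /not_implyP[tF nt]]] := nc c.
    exists t; split=> // x Ax xc; apply: contrapT => nU; apply: nt; exists x => // U Ut Ux.
    by apply: nU; exists U.
  have /not_implyP[badA _] := nc point.
  have [|x Ax xP] := badA (flatten [seq sval (H c) | c <- s]).
    by move=> U /flatten_mapP[c cs]; exact: (svalP (H c)).1.
  have [c cs xc] := sP x; have [U Ut Ux] := (svalP (H c)).2 x Ax xc.
  by apply: (xP U) => //; apply/flatten_mapP; exists c.
have [g gP] := choice step.
pose fix A k : set X := if k is k'.+1 then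
  A k' `&` [set x | rho x (g (k', A k')) < rad k'] else setT.
have badA k : bad (A k) by elim: k => [//|k IH]; exact: (gP (k, A k)).
have subA m k : (k <= m)%N -> A m `<=` A k.
  by move=> /subnK <-; elim: (m - k)%N => [//|n IH] x [/IH].
have /choice[x xA] k : exists x, A k x by have [//|x] := badA k [::]; exists x.
have closeA k y z : A k.+1 y -> A k.+1 z -> rho y z < rad k + rad k.
  move=> [_ /= yc] [_ /= zc]; apply: le_lt_trans (tri _ (g (k, A k)) _) _.
  by rewrite (sym _ z) ltrD.
have small (e : R) : 0 < e -> exists k, rad k + rad k < e.
  move=> e0; have := @cvg_expr R 2^-1; rewrite ger0_norm// => /(_ ltac:(lra)).
  have e20 : 0 < e / 2 by rewrite divr_gt0.
  move=> /cvgrPdist_lt/(_ _ e20)[k _ /(_ k (leqnn k))] /=.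
  by rewrite sub0r normrN ger0_norm ?ltW// => ?; exists k; rewrite [e]splitr ltrD.
have [|l lP] := cmpl x.
  move=> e /small[k ke]; exists k.+1 => m n km kn; apply: lt_trans ke.
  by apply: closeA; [exact: subA km _ (xA m)|exact: subA kn _ (xA n)].
have [U FU Ul] : exists2 U, F U & U l.
  by have : (\bigcup_(U in F) U) l by rewrite Fcov.
have [e e0 Ue] := Fo _ FU _ Ul.
have e20 : 0 < e / 2 by rewrite divr_gt0.
have [k ke] := small _ e20; have [N NP] := lP _ e20.
have [U'|y Ay yU] := badA k.+1 [:: U]; first by rewrite inE => /eqP ->.
apply: (yU U); first by rewrite inE.
apply: Ue; apply: le_lt_trans (tri _ (x (maxn N k.+1)) _) _.
rewrite [e]splitr ltrD//; first by rewrite sym; apply: NP; exact: leq_maxl.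
by apply: lt_trans ke; apply: closeA Ay; apply: subA (xA _); exact: leq_maxr.
Qed.

End DistanceMap.

(** * Completion of a distance matrix *)

Lemma real_cauchy_cvg (R : realType) (u : nat -> R) :
  (forall e, 0 < e -> exists N, forall m n, (N <= m)%N -> (N <= n)%N -> `|u m - u n| < e) ->
  cvgn u.
Proof.
move=> cu; apply/cauchy_cvgP/cauchy_exP => e /= e0.
have [N HN] := cu e e0; exists (u N); exists N => // n /= Nn.
by rewrite /ball/=; apply: HN.
Qed.

(* Kuratowski embedding: a point of the completion is its distance function to the rows. *)
Section RowClosure.
Context (R : realType) (r : MatB R).

Definition near_rows (f : nat -> R) : Prop :=
  forall e : R, 0 < e -> exists i, forall n, `|f n - r (i, n)| <= e.

(** Points are functions, so two indices at distance 0, whose rows coincide, give the same point and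
    no quotient is taken. *)
Definition closure_rows : Type := {f : nat -> R | near_rows f}.

HB.instance Definition _ := gen_eqMixin closure_rows.
HB.instance Definition _ := gen_choiceMixin closure_rows.

Definition row_pt (i : nat) : closure_rows.
Proof.
by exists (fun n => r (i, n)) => e e0; exists i => n; rewrite subrr normr0 ltW.
Defined.

HB.instance Definition _ := isPointed.Build closure_rows (row_pt 0).

Definition sup_dist (f g : closure_rows) : R :=
  sup (range (fun n => `|sval f n - sval g n|)).

Hypothesis rdist : distmat r.
Implicit Types f g h : closure_rows.

Let diff_rows i j n : `|r (i, n) - r (j, n)| <= r (i, j).
Proof.
have [_ [_ [sym tri]]] := rdist.
rewrite ler_norml; apply/andP; split.
  by rewrite lerNl opprB lerBlDr (sym i j) tri.
by rewrite lerBlDr tri.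
Qed.

(** The functions themselves may be unbounded, but each is uniformly close to a row, and the rows
    [i] and [j] differ by at most [r (i, j)]. *)
Let sup_dist_has_ub f g : has_ubound (range (fun n => `|sval f n - sval g n|)).
Proof.
have [i Hi] := svalP f 1 ltr01; have [j Hj] := svalP g 1 ltr01.
exists (1 + r (i, j) + 1) => _ [n _ <-].
have -> : sval f n - sval g n = (sval f n - r (i, n)) + (r (i, n) - r (j, n))
  - (sval g n - r (j, n)) by ring.
rewrite (le_trans (ler_normB _ _))// lerD// (le_trans (ler_normD _ _))// lerD//.
Qed.

Lemma le_sup_dist f g n : `|sval f n - sval g n| <= sup_dist f g.
Proof. by apply: ub_le_sup; [exact: sup_dist_has_ub|exists n]. Qed.

Lemma sup_dist_le f g (e : R) : (forall n, `|sval f n - sval g n| <= e) -> sup_dist f g <= e.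
Proof.
move=> fge; apply: ge_sup; first by exists `|sval f 0%N - sval g 0%N|, 0%N.
by move=> _ [n _ <-].
Qed.

Lemma sup_dist_metric : is_metric sup_dist.
Proof.
split; first by move=> f g; apply: le_trans (le_sup_dist f g 0).
split; last split.
- move=> f g; split=> [fg0|->].
    have E : sval f = sval g.
      by apply/funext => n; apply/eqP; rewrite -subr_eq0 -normr_le0 -fg0 le_sup_dist.
    case: f g E {fg0} => f pf [g pg] /= fg; move: pf pg; rewrite fg => pf pg.
    by congr exist; exact: Prop_irrelevance.
  apply/le_anti/andP; split; first by apply: sup_dist_le => n; rewrite subrr normr0.
  by apply: le_trans (le_sup_dist g g 0).
- by move=> f g; congr sup; apply/funext => x; congr image; apply/funext => n; rewrite distrC.
- move=> f g h; apply: sup_dist_le => n.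
  by rewrite (le_trans (ler_distD (sval g n) _ _))// lerD// le_sup_dist.
Qed.

(** The triangle inequality bounds the supremum, and the column [j], where the row [j] vanishes,
    attains it. *)
Lemma sup_dist_row i j : sup_dist (row_pt i) (row_pt j) = r (i, j).
Proof.
have [r0 [rge _]] := rdist.
apply/le_anti/andP; split; first by apply: sup_dist_le => n /=; exact: diff_rows.
apply: le_trans (le_sup_dist (row_pt i) (row_pt j) j) => /=.
by rewrite r0 subr0 ler_norm.
Qed.

Lemma row_pt_dense f (e : R) : 0 < e -> exists i, sup_dist f (row_pt i) < e.
Proof.
move=> e0; have e20 : 0 < e / 2 by rewrite divr_gt0.
have [i Hi] := svalP f _ e20; exists i.
apply: (@le_lt_trans _ _ (e / 2)); first exact: sup_dist_le.
by rewrite ltr_pdivrMr// mulrDr mulr1 ltrDl.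
Qed.

Lemma sup_dist_separable : rho_separable sup_dist.
Proof. by exists row_pt => f e e0; exact: row_pt_dense. Qed.

Lemma sup_dist_complete : rho_complete sup_dist.
Proof.
move=> u cu.
have cvu n : cvgn (fun k => sval (u k) n).
  apply: real_cauchy_cvg => e /cu[N HN]; exists N => k l Nk Nl.
  by apply: le_lt_trans (le_sup_dist _ _ _) (HN _ _ Nk Nl).
pose f n := limn (fun k => sval (u k) n).
have fu (e : R) : 0 < e -> exists N, forall k n, (N <= k)%N -> `|f n - sval (u k) n| <= e.
  move=> /cu[N HN]; exists N => k n Nk.
  have c : `|sval (u l) n - sval (u k) n| @[l --> \oo] --> `|f n - sval (u k) n|.
    by apply: cvg_norm; apply: cvgB; [exact: cvu|exact: cvg_cst].
  rewrite -(cvg_lim (@Rhausdorff R) c); apply: limr_le; first by apply/cvg_ex; eexists; exact: c.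
  exists N => // l /= Nl; apply/ltW/(le_lt_trans (le_sup_dist _ _ _)); exact: HN.
have nf : near_rows f.
  move=> e e0; have e20 : 0 < e / 2 by rewrite divr_gt0.
  have [N HN] := fu _ e20; have [i Hi] := svalP (u N) _ e20.
  exists i => n; rewrite (le_trans (ler_distD (sval (u N) n) _ _))// [e]splitr lerD//.
  exact: HN.
exists (exist _ f nf) => e e0; have e20 : 0 < e / 2 by rewrite divr_gt0.
have [N HN] := fu _ e20; exists N => k Nk.
apply: (@le_lt_trans _ _ (e / 2)); last by rewrite ltr_pdivrMr// mulrDr mulr1 ltrDl.
by apply: sup_dist_le => n /=; rewrite distrC; exact: HN.
Qed.

Lemma sup_dist_polish : polish sup_dist.
Proof.
split; [exact: sup_dist_metric|split; [exact: sup_dist_complete|exact: sup_dist_separable]].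
Qed.

Lemma sup_dist_compact :
  (forall e : R, 0 < e -> exists N, forall j, exists2 i, (i < N)%N & r (i, j) < e) ->
  rho_compact sup_dist.
Proof.
move=> tb; apply: (totally_bounded_compact sup_dist_metric sup_dist_complete).
move=> e e0; have e20 : 0 < e / 2 by rewrite divr_gt0.
have [N HN] := tb _ e20; exists [seq row_pt i | i <- iota 0 N] => f.
have [j fj] := row_pt_dense f e20; have [i iN ij] := HN j.
exists (row_pt i); first by apply: map_f; rewrite mem_iota.
have [_ [_ [sym tri]]] := sup_dist_metric.
apply: le_lt_trans (tri _ (row_pt j) _) _.
by rewrite [e]splitr ltrD// sym sup_dist_row.
Qed.

End RowClosure.

(** * Coding points by nearby indices *)

Section Codes.
Context (R : realType).
Implicit Types (r : MatB R).

Definition rad (k : nat) : R := 2^-1 ^+ k.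

Lemma rad_gt0 k : 0 < rad k.
Proof. by rewrite exprn_gt0. Qed.

Lemma rad_small (e : R) : 0 < e -> exists k, rad k < e.
Proof.
move=> e0; have := @cvg_expr R 2^-1; rewrite ger0_norm// => /(_ ltac:(lra)).
move=> /cvgrPdist_lt/(_ _ e0)[k _ /(_ k (leqnn k))] /=.
by rewrite sub0r normrN ger0_norm ?ltW ?rad_gt0// => ?; exists k.
Qed.

Lemma rad_le k l : (k <= l)%N -> rad l <= rad k.
Proof. by move=> kl; apply: ler_wiXn2l => //; lra. Qed.

(* The search stops before [j], so that the default value is [j] itself. *)
Definition code r k j := find (fun i => r (i, j) < rad k) (iota 0 j).

Definition code_word r n j := mkseq (fun k => code r k j) n.

Lemma code_close r k j : distmat r -> r (code r k j, j) < rad k.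
Proof.
move=> [r0 _]; rewrite /code.
have [has|] := boolP (has (fun i => r (i, j) < rad k) (iota 0 j)).
  have := nth_find 0%N has; rewrite nth_iota//.
  by rewrite -[X in (_ < X)%N](size_iota 0) -has_find.
by move=> /hasNfind ->; rewrite size_iota r0 rad_gt0.
Qed.

Lemma code_trunc r k j M : (M <= j)%N ->
  find (fun i => r (i, j) < rad k) (iota 0 M) = minn M (code r k j).
Proof.
move=> Mj; have E : iota 0 j = iota 0 M ++ iota M (j - M) by rewrite -iotaD subnKC.
rewrite /code E find_cat has_find size_iota.
have := find_size (fun i => r (i, j) < rad k) (iota 0 M); rewrite size_iota => fM.
by case: ltnP => H; lia.
Qed.

Lemma code_lt r k j M : (M <= j)%N ->
  (code r k j < M)%N = has (fun i => r (i, j) < rad k) (iota 0 M).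
Proof. by move=> Mj; rewrite has_find size_iota code_trunc// gtn_min ltnn. Qed.

(** The search range of [code] grows with [j]. For a word with letters below [M] it can be cut at
    [M], and the event becomes one condition on the rows below [M], the same for all columns
    [j >= M], as exchangeability requires. *)
Lemma code_word_trunc r n j M w : (M <= j)%N -> size w = n -> all (fun c => c < M)%N w ->
  (code_word r n j == w) =
  (mkseq (fun k => find (fun i => r (i, j) < rad k) (iota 0 M)) n == w).
Proof.
move=> Mj wn /allP wM.
have key k : (k < n)%N -> (code r k j == nth 0%N w k) =
    (find (fun i => r (i, j) < rad k) (iota 0 M) == nth 0%N w k).
  move=> kn; have := wM _ (mem_nth 0%N (etrans (congr1 _ wn) kn : k < size w)%N).
  rewrite code_trunc//; move: (code r k j) (nth _ w k) => x y yM.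
  by apply/eqP/eqP; lia.
apply/eqP/eqP => E; rewrite -[RHS]E; apply: eq_mkseq_lt => k kn;
  have := key k kn; rewrite -[in nth _ _ _]E nth_mkseq// eqxx.
  by move=> /esym/eqP.
by move=> /eqP.
Qed.

(* Columns of [r] are the points; [code_word r n j] names the j-th point up to [2^-(n-1)]. *)
Record good r : Prop := Good {
  good_distmat : distmat r;
  good_freq : forall w, cvgn (freq R (fun j => code_word r (size w) j == w));
  good_tight : forall k (e : R), 0 < e ->
    exists M, \forall n \near \oo, freq R (fun j => M <= code r k j)%N n <= e }.

Definition wordprob r (w : seq nat) : R := limn (freq R (fun j => code_word r (size w) j == w)).

Lemma cvg_wordprob r w : good r ->
  freq R (fun j => code_word r (size w) j == w) n @[n --> \oo] --> wordprob r w.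
Proof. by move=> gr; have := @good_freq r gr w. Qed.

Lemma wordprob_ge0 r w : good r -> 0 <= wordprob r w.
Proof.
move=> gr; apply: limr_ge; first exact: good_freq.
by apply: nearW => n; exact: freq_ge0.
Qed.

Lemma wordprob_nil r : wordprob r [::] = 1.
Proof.
apply: (cvg_lim (@Rhausdorff R)); apply: cvg_near_cst; exists 1%N => // n /= n0.
rewrite /freq (eq_bigr (fun=> 1)); last by move=> j _; rewrite /code_word eqxx.
by rewrite sumr_const card_ord divff// pnatr_eq0 -lt0n.
Qed.

Lemma code_wordS r n j : code_word r n.+1 j = rcons (code_word r n j) (code r n j).
Proof. by rewrite /code_word mkseqS. Qed.

Lemma freq_children r w M n :
  freq R (fun j => code_word r (size w) j == w) n =
  \sum_(c < M) freq R (fun j => code_word r (size (rcons w c)) j == rcons w c) n +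
  freq R (fun j => (code_word r (size w) j == w) && (M <= code r (size w) j)%N) n.
Proof.
rewrite /freq -mulr_suml -mulrDl; congr (_ / _).
rewrite exchange_big -big_split/=; apply: eq_bigr => j _.
under eq_bigr do rewrite size_rcons code_wordS eqseq_rcons.
case: eqP => [_|_] /=; last by rewrite big1// addr0.
case: leqP => [Mc|cM].
  by rewrite big1 ?add0r// => i _; rewrite eqn_leq leqNgt (leq_trans (ltn_ord i) Mc).
rewrite addr0 (bigD1 (Ordinal cM))//= eqxx big1 ?addr0// => i /eqP ic.
by case: eqP => // E; case: ic; apply: val_inj.
Qed.

(** No mass escapes to infinite letters: the columns whose next letter is at least [M] have
    frequency at most [e] in the limit, and this bounds the defect for every larger cut [M']. *)
Lemma wordprob_cvg r (w : seq nat) : good r ->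
  \sum_(c < n) wordprob r (rcons w c) @[n --> \oo] --> wordprob r w.
Proof.
move=> gr; apply/cvgrPdist_le => e e0.
have [M HM] := good_tight gr (size w) e0; exists M => // M' /= MM'.
have cs : \sum_(c < M') freq R (fun j => code_word r (size (rcons w c)) j == rcons w c) n
    @[n --> \oo] --> \sum_(c < M') wordprob r (rcons w c).
  have cw (c : 'I_M') := @cvg_wordprob r (rcons w c) gr.
  have := @cvg_bigsum R _ (index_enum 'I_M') (fun c n => freq R (fun j =>
    code_word r (size (rcons w c)) j == rcons w c) n) (fun c => wordprob r (rcons w c)).
  by apply; exact: cw.
have cd : freq R (fun j => (code_word r (size w) j == w) && (M' <= code r (size w) j)%N) n
    @[n --> \oo] --> wordprob r w - \sum_(c < M') wordprob r (rcons w c).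
  rewrite [X in X @ _ --> _](_ : _ = fun n => freq R (fun j => code_word r (size w) j == w) n -
    \sum_(c < M') freq R (fun j => code_word r (size (rcons w c)) j == rcons w c) n).
    by apply: cvgB cs; exact: cvg_wordprob.
  by apply/funext => n; rewrite (freq_children r w M') addrC addKr.
have ccd : cvgn (freq R (fun j =>
    (code_word r (size w) j == w) && (M' <= code r (size w) j)%N)).
  by apply/cvg_ex; eexists; exact: cd.
have d0 : 0 <= wordprob r w - \sum_(c < M') wordprob r (rcons w c).
  rewrite -(cvg_lim (@Rhausdorff R) cd); apply: limr_ge => //.
  by apply: nearW => n; exact: freq_ge0.
rewrite ger0_norm// -(cvg_lim (@Rhausdorff R) cd); apply: limr_le => //.
apply: filterS HM => n /= Hn; apply: le_trans Hn; apply: le_freq => j.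
by move=> /andP[_]; exact: leq_trans.
Qed.

(** Turns weights into geometry: what holds for the words of actual columns holds for every word
    that can be sampled. *)
Lemma wordprob_gt0 r w : good r -> 0 < wordprob r w ->
  exists j, code_word r (size w) j = w.
Proof.
move=> gr w0; apply: contrapT => /forallNP nw; move: w0.
rewrite /wordprob (_ : limn _ = 0) ?ltxx//.
apply: (cvg_lim (@Rhausdorff R)); apply: cvg_near_cst; apply: nearW => n.
by rewrite /freq big1 ?mul0r// => j _; case: eqP => // /nw.
Qed.

End Codes.

(** * Random points of the completion *)

Section Sampling.
Context (R : realType) (r : MatB R).
Hypothesis gr : good r.
Let rdist := good_distmat gr.
Let p := wordprob r.
Let p_ge0 w : 0 <= p w := wordprob_ge0 w gr.
Let p_nil : p [::] = 1 := wordprob_nil r.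
Let p_cvg (w : seq nat) : \sum_(c < n) p (rcons w c) @[n --> \oo] --> p w := @wordprob_cvg R r w gr.
Local Notation X := (closure_rows r).
Local Notation rho := (@sup_dist R r).

(** The sampled prefix has positive weight, so it is the word of an actual column [j], and both
    letters are rows close to [j]. *)
Lemma letter_close u k l : 0 <= u < 1 ->
  r (letter p u k, letter p u l) < rad R k + rad R l.
Proof.
move=> u01; pose n := (maxn k l).+1.
have [j] := wordprob_gt0 gr (letter_gt0 p_ge0 p_nil p_cvg n u01).
rewrite size_mkseq => E.
have cl i : (i < n)%N -> code r i j = letter p u i.
  by move=> il; have := congr1 (fun s => nth 0%N s i) E; rewrite !nth_mkseq.
have [_ [_ [sym tri]]] := rdist.
have kn : (k < n)%N by rewrite ltnS leq_maxl.
have ln : (l < n)%N by rewrite ltnS leq_maxr.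
rewrite -(cl _ kn) -(cl _ ln); apply: le_lt_trans (tri _ _ j) _.
by rewrite (sym j) ltrD// code_close.
Qed.

Lemma sample_exists : exists phi : R -> X,
  [/\ forall u k, 0 <= u < 1 -> rho (row_pt r (letter p u k)) (phi u) <= 2 * rad R k &
      measurable_fun setT (phi : R -> XB rho)].
Proof.
have met := sup_dist_metric rdist; have [_ [_ [sym tri]]] := met.
have ex u : exists x : X, (0 <= u < 1 ->
    forall k, rho (row_pt r (letter p u k)) x <= 2 * rad R k) /\
    (~ (0 <= u < 1) -> x = row_pt r 0).
  have [u01|u01] := pselect (0 <= u < 1); last by exists (row_pt r 0).
  have [|x xP] := sup_dist_complete rdist (u := fun k => row_pt r (letter p u k)).
    move=> e e0; have e20 : 0 < e / 2 by rewrite divr_gt0.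
    have [N HN] := rad_small e20; exists N => m n Nm Nn.
    rewrite sup_dist_row//; apply: lt_trans (letter_close _ _ u01) _.
    by rewrite [e]splitr ltrD//; apply: le_lt_trans HN; exact: rad_le.
  (* For [m >= k] the row of the letter [m] is within [rad k + rad m <= 2 rad k] of the row of the
     letter [k]; the bound passes to the limit. *)
  exists x; split=> // _ k; apply/ler_addgt0Pr => e e0.
  have [N HN] := xP e e0; pose m := maxn N k.
  apply: le_trans (tri _ (row_pt r (letter p u m)) _) _; rewrite lerD//.
    rewrite sup_dist_row//; apply/ltW/(lt_le_trans (letter_close _ _ u01)).
    by rewrite mulr_natl mulr2n lerD2l rad_le// leq_maxr.
  by apply/ltW/HN; exact: leq_maxl.
have [phi phiP] := choice ex; exists phi; split; first by move=> u k /(phiP u).1.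
apply: (@measurability _ _ _ (XB rho) setT phi (rho_open rho)) => // _ [U oU <-].
rewrite setTI.
(* Membership in [U] is decided by finitely many letters. Radius 3 strictly exceeds the error 2 of
   the row of letter [k], so the limit point lies in this ball. *)
pose Q k (s : seq nat) :=
  [set x | rho x (row_pt r (nth 0%N s k)) < 3 * rad R k] `<=` U.
rewrite (_ : phi @^-1` U = [set u | (exists k, (0 <= u < 1) /\ Q k (mkseq (letter p u) k.+1)) \/
    (~ (0 <= u < 1) /\ U (row_pt r 0))]).
  have m01 : measurable [set u : R | 0 <= u < 1].
    have := @measurable_itv R `[0, 1[.
    by congr measurable; apply/seteqP; split=> u /=; rewrite in_itv.
  apply: measurableU.
    apply: measurable_exists => k; apply: measurable_andP => //.
    exact: (measurable_letter_pred p_ge0 p_nil p_cvg k.+1 (Q k)).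
  apply: measurable_andP; first exact: measurable_not.
  exact: measurable_cstP.
apply/seteqP; split=> u /=.
  move=> Uu; have [u01|u01] := pselect (0 <= u < 1); last first.
    by right; split=> //; rewrite -(phiP u).2.
  left; have [e e0 He] := oU _ Uu.
  (* 5 = 2 + 3: the limit point is within [2 rad k] of the row and [x] within [3 rad k] of it. *)
  have e50 : 0 < e / 5 by rewrite divr_gt0.
  have [k ke] := rad_small e50; exists k; split=> // x /= xk.
  apply: He; apply: le_lt_trans (tri _ (row_pt r (letter p u k)) _) _.
  rewrite nth_mkseq// in xk.
  have := (phiP u).1 u01 k; rewrite (sym _ (phi u)) (sym _ x).
  move: xk ke; rewrite ltr_pdivlMr//; lra.
move=> [[k [u01 HU]]|[u01 U0]]; last by rewrite (phiP u).2.
apply: HU => /=; rewrite nth_mkseq// sym.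
apply: le_lt_trans ((phiP u).1 u01 k) _.
by rewrite ltr_pM2r ?rad_gt0// ltr_nat.
Qed.

End Sampling.

(** * Convergence of the sample averages *)

Lemma Ex_dist_le d (T : measurableType d) (R : realType) (P : probability T R)
    (f g : T -> R) (e : R) : mbounded f -> mbounded g ->
  (forall x, `|f x - g x| <= e) -> `|Ex P f - Ex P g| <= e.
Proof.
move=> bf bg fg; rewrite -ExB//; apply: le_trans (le_normr_Ex _ (mboundedB bf bg)) _.
rewrite -[leRHS](Ex_cst P); apply: le_Ex => //; last exact: mbounded_cst.
by apply: mbounded_norm; exact: mboundedB.
Qed.

Lemma bernoulli_pow (R : realType) (x : R) m : 0 <= x <= 1 -> 1 - x ^+ m <= m%:R * (1 - x).
Proof.
move=> /andP[x0 x1]; elim: m => [|m IH]; first by rewrite expr0 subrr mul0r.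
rewrite exprS -natr1 mulrDl mul1r.
have -> : 1 - x * x ^+ m = x * (1 - x ^+ m) + (1 - x) by ring.
rewrite lerD2r; apply: le_trans IH; apply: ler_piMl => //.
by rewrite subr_ge0 exprn_ile1.
Qed.

Section FiniteMixing.
Context (R : realType) (S : eqType) (m : nat) (T : finType) (iota_ : T -> S).
Hypothesis iota_inj : injective iota_.
Implicit Types (w : 'I_m -> S) (c : {ffun 'I_m -> T}).

Definition hit w c : bool := [forall a, w a == iota_ (c a)].

Lemma hit_prod w c : (hit w c)%:R = \prod_(a < m) (w a == iota_ (c a))%:R :> R.
Proof.
rewrite /hit; case: forallP => [H|/forallP]; first by rewrite big1// => a _; rewrite H.
rewrite negb_forall => /existsP[a wa].
by rewrite (bigD1 a)//= (negbTE wa) mul0r.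
Qed.

(** A pointwise inequality, to be averaged over index tuples and integrated over samples. By
    injectivity at most one [c] is hit; if one is, both sides vanish, and if none is, the error is
    at most 1. *)
Lemma finite_mixing (G : ('I_m -> S) -> R) w : (forall v, 0 <= G v <= 1) ->
  `|G w - \sum_c (hit w c)%:R * G (fun a => iota_ (c a))| <= 1 - \sum_c (hit w c)%:R.
Proof.
move=> G01; have [[c0 wc0]|nc] := pselect (exists c, hit w c).
  have uc c : hit w c = (c == c0).
    apply/idP/eqP => [/forallP wc|->//]; apply/ffunP => a.
    by apply: iota_inj; rewrite -(eqP (wc a)) (eqP (forallP wc0 a)).
  rewrite (bigD1 c0)//= uc eqxx mul1r big1 ?addr0; last first.
    by move=> c /negbTE; rewrite uc => ->; rewrite mul0r.
  rewrite (bigD1 c0)//= uc eqxx big1 ?addr0; last first.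
    by move=> c /negbTE; rewrite uc => ->.
  have -> : w = fun a => iota_ (c0 a) by apply/funext => a; exact/eqP/(forallP wc0).
  by rewrite !subrr normr0.
have hN c : hit w c = false by apply/negP => wc; apply: nc; exists c.
rewrite big1; last by move=> c _; rewrite hN mul0r.
rewrite big1; last by move=> c _; rewrite hN.
by rewrite !subr0 ger0_norm; have /andP[] := G01 w.
Qed.

End FiniteMixing.

Section SampleAverages.
Context (R : realType).
Implicit Types (f : MatB R -> R) (r : MatB R).

(** Extends an m-tuple by 0 to all of [nat], so that [perm_act] can reindex along tuples, injective
    or not. *)
Definition emb m (c : 'I_m -> nat) (a : nat) : nat := oapp c 0%N (insub a).

Lemma emb_ord m (c : 'I_m -> nat) (a : 'I_m) : emb c a = c a.
Proof. by rewrite /emb valK. Qed.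

(* Indices may repeat, so that a permutation of the first [n] integers permutes the terms. *)
Definition corner_avg f m r n : R :=
  (\sum_(i : {ffun 'I_m -> 'I_n}) f (perm_act (emb (fun a => val (i a))) r)) / n%:R ^+ m.

(** The Lipschitz bound refers to the corner alone; with [e = 0] it says that [f] depends only on
    the corner. *)
Record nice m (C : R) f : Prop := Nice {
  nice_measurable : measurable_fun setT f;
  nice_itv : forall r, 0 <= f r <= 1;
  nice_ge0 : 0 <= C;
  nice_lip : forall r r' e, 0 <= e ->
    (forall a b, (a < m)%N -> (b < m)%N -> `|r (a, b) - r' (a, b)| <= e) ->
    `|f r - f r'| <= C * e }.

Lemma nice_mbounded m C f : nice m C f -> mbounded f.
Proof.
move=> nf; split; first exact: nice_measurable nf.
by exists 1 => r; have /andP[f0 f1] := nice_itv nf r; rewrite ger0_norm.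
Qed.

Lemma nice_emb m C f r r' (c c' : 'I_m -> nat) e : nice m C f -> 0 <= e ->
  (forall a b : 'I_m, `|r (c a, c b) - r' (c' a, c' b)| <= e) ->
  `|f (perm_act (emb c) r) - f (perm_act (emb c') r')| <= C * e.
Proof.
move=> nf e0 H; apply: (nice_lip nf) => // a b am bm; rewrite /perm_act/=.
have E (d : 'I_m -> nat) : emb d a = d (Ordinal am) := emb_ord d (Ordinal am).
have E' (d : 'I_m -> nat) : emb d b = d (Ordinal bm) := emb_ord d (Ordinal bm).
by rewrite !E !E'; exact: H.
Qed.

Lemma sum_ffun_prod (I : finType) m (F : 'I_m -> I -> R) :
  \sum_(i : {ffun 'I_m -> I}) \prod_(a < m) F a (i a) = \prod_(a < m) \sum_i F a i.
Proof. by rewrite bigA_distr_bigA. Qed.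

Lemma sum_ffun_cst m n (x : R) : (0 < n)%N ->
  (\sum_(i : {ffun 'I_m -> 'I_n}) x) / n%:R ^+ m = x.
Proof.
move=> n0; rewrite sumr_const card_ffun !card_ord -[_ *+ _]mulr_natr natrX mulfK//.
by rewrite expf_neq0// pnatr_eq0 -lt0n.
Qed.

Lemma corner_avg_itv f m r n : (forall r, 0 <= f r <= 1) -> 0 <= corner_avg f m r n <= 1.
Proof.
move=> f01; have f0 r' : 0 <= f r' by have /andP[] := f01 r'.
rewrite /corner_avg divr_ge0 ?sumr_ge0 ?exprn_ge0//=.
have [->|n0] := posnP n; last first.
  rewrite -[leRHS](@sum_ffun_cst m n 1)// ler_wpM2r ?invr_ge0 ?exprn_ge0// ler_sum// => i _.
  by have /andP[] := f01 (perm_act (emb (fun a => val (i a))) r).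
case: m => [|m].
  rewrite expr0 divr1 (eq_bigr (fun=> f (perm_act (emb (fun a : 'I_0 => 0%N)) r))).
    by rewrite sumr_const card_ffun !card_ord expn0; have /andP[] := f01 (perm_act (emb (fun a : 'I_0 => 0%N)) r).
  by move=> i _; congr (f (perm_act (emb _) r)); apply/funext => -[].
by rewrite expr0n/= invr0 mulr0.
Qed.

End SampleAverages.

Section SampleAveragesLimit.
Context (R : realType) (r : MatB R).
Hypothesis gr : good r.
Let p := wordprob r.

Let words k M := k.-tuple 'I_M.
Let wval k M (t : words k M) : seq nat := map val t.

Let wval_inj k M : injective (@wval k M).
Proof. by move=> t t' /(inj_map val_inj) /val_inj. Qed.

Let size_wval k M (t : words k M) : size (wval t) = k.
Proof. by rewrite size_map size_tuple. Qed.

Let F k M n (t : words k M) : R := freq R (fun j => code_word r k j == wval t) n.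

Let cvgF k M t : @F k M n t @[n --> \oo] --> p (wval t).
Proof. by have := @cvg_wordprob R r (wval t) gr; rewrite size_wval. Qed.

Let sumF_le1 k M n : \sum_t @F k M n t <= 1.
Proof.
apply: le_trans (freq_le1 R (fun j => [exists t : words k M, code_word r k j == wval t]) n).
rewrite /F /freq -mulr_suml ler_wpM2r ?invr_ge0// exchange_big ler_sum// => j _.
case: existsP => [[t0 /eqP E]|H].
  rewrite (bigD1 t0)//= E eqxx big1 ?addr0// => t tt0.
  by case: eqP => // /wval_inj tE; rewrite tE eqxx in tt0.
rewrite big1// => t _; case: eqP => // E; case: H; exists t; exact/eqP.
Qed.

Let sump_le1 k M : \sum_(t : words k M) p (wval t) <= 1.
Proof.
have c := @cvg_bigsum R _ (index_enum (words k M)) (fun t n => F n t) (fun t => p (wval t)) (@cvgF k M).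
rewrite -(cvg_lim (@Rhausdorff R) c); apply: limr_le; first by apply/cvg_ex; eexists; exact: c.
by apply: nearW => n; exact: sumF_le1.
Qed.

(** Union bound: a column whose word is not over the letters below [M] has one of its [k] letters at
    least [M]. *)
Let sumF_ge k M n : (0 < n)%N ->
  1 - \sum_(l < k) freq R (fun j => M <= code r l j)%N n <= \sum_t @F k M n t.
Proof.
move=> n0; have n0' : (0 : R) < n%:R by rewrite ltr0n.
rewrite lerBlDr /F /freq -!mulr_suml -mulrDl ler_pdivlMr// mul1r.
rewrite exchange_big/= [X in _ <= _ + X]exchange_big/= -big_split/=.
rewrite -[leLHS](_ : \sum_(j < n) 1 = _); last first.
  by rewrite sumr_const card_ord.
apply: ler_sum => j _.
have [/existsP[l Ml]|/existsPn H] := boolP [exists l : 'I_k, (M <= code r l j)%N].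
  rewrite (bigD1 l)//= Ml.
  have A : 0 <= \sum_(t : words k M) (code_word r k j == wval t)%:R :> R by exact: sumr_ge0.
  have B : 0 <= \sum_(i < k | i != l) (M <= code r i j)%:R :> R by exact: sumr_ge0.
  by apply: ler_wpDl => //; apply: ler_wpDr.
have Hl l : (l < k)%N -> (code r l j < M)%N by move=> lk; have := H (Ordinal lk); rewrite -ltnNge.
pose t : words k M := [tuple Ordinal (Hl _ (ltn_ord l)) | l < k].
rewrite (bigD1 t)//= (_ : code_word r k j == wval t) ?addr0; last first.
  apply/eqP/(@eq_from_nth _ 0%N); rewrite ?size_wval ?size_mkseq// => l lk.
  rewrite nth_mkseq// /wval (nth_map (Ordinal (Hl _ lk))) ?size_tuple//.
  have -> : nth (Ordinal (Hl l lk)) t l = tnth t (Ordinal lk) by rewrite (tnth_nth (Ordinal (Hl l lk))).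
  by rewrite tnth_mktuple.
by apply: ler_wpDr; [exact: sumr_ge0|apply: ler_wpDr => //; exact: sumr_ge0].
Qed.

Let words_tight k (e : R) : 0 < e -> exists M, 1 - e <= \sum_(t : words k M) p (wval t).
Proof.
move=> e0; have ek : 0 < e / k.+1%:R by rewrite divr_gt0.
have /choice[M HM] l := good_tight gr l ek.
pose M0 := \max_(l < k) M l; exists M0.
have c := @cvg_bigsum R _ (index_enum (words k M0)) (fun t n => F n t) (fun t => p (wval t)) (@cvgF k M0).
rewrite -(cvg_lim (@Rhausdorff R) c); apply: limr_ge; first by apply/cvg_ex; eexists; exact: c.
have : \forall n \near \oo, forall l : 'I_k, freq R (fun j => M l <= code r l j)%N n <= e / k.+1%:R.
  by apply: filter_forall => l; exact: HM.
move=> near_l; near=> n.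
apply: le_trans (sumF_ge k M0 _); last by near: n; exact: nbhs_infty_gt.
rewrite lerB// (@le_trans _ _ (\sum_(l < k) e / k.+1%:R))//.
  apply: ler_sum => l _; apply: le_trans (_ : freq R (fun j => M l <= code r l j)%N n <= _).
    apply: le_freq => j; apply: leq_trans; exact: (@leq_bigmax _ (fun l : 'I_k => M l)).
  by have : forall l : 'I_k, freq R (fun j => M l <= code r l j)%N n <= e / k.+1%:R by near: n.
rewrite sumr_const card_ord -[_ *+ k]mulr_natr mulrAC ler_pdivrMr//.
by apply: ler_wpM2l; [exact: ltW|rewrite ler_nat].
Unshelve. all: by end_near. Qed.

(** The expectation of [G] at [m] independent words of weights [q]. With the words truncated to
    letters below [M] the weights may sum to less than 1, and [mass] records the total that is
    left. *)
Let mix k M m (q : words k M -> R) (G : ('I_m -> seq nat) -> R) : R :=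
  \sum_(c : {ffun 'I_m -> words k M}) (\prod_(a < m) q (c a)) * G (fun a => wval (c a)).

Let mass k M m (q : words k M -> R) : R := (\sum_t q t) ^+ m.

Let massE k M m (q : words k M -> R) :
  \sum_(c : {ffun 'I_m -> words k M}) \prod_(a < m) q (c a) = mass m q.
Proof. by rewrite (sum_ffun_prod (fun=> q)) prodr_const card_ord. Qed.

(* Counting tuples word by word factorizes, up to the mass of the discarded words. *)
Let avg_mix k M m n (G : ('I_m -> seq nat) -> R) : (0 < n)%N -> (forall v, 0 <= G v <= 1) ->
  `|(\sum_(i : {ffun 'I_m -> 'I_n}) G (fun a => code_word r k (i a))) / n%:R ^+ m
    - mix (@F k M n) G| <= 1 - mass m (@F k M n).
Proof.
move=> n0 G01; have n0' : 0 < (n%:R : R) ^+ m by rewrite exprn_gt0// ltr0n.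
have prodF (c : {ffun 'I_m -> words k M}) : \prod_(a < m) F n (c a) =
    (\sum_(i : {ffun 'I_m -> 'I_n}) (hit (@wval k M) (fun a => code_word r k (i a)) c)%:R)
      / n%:R ^+ m.
  under [in RHS]eq_bigr do rewrite hit_prod.
  rewrite (sum_ffun_prod (fun (a : 'I_m) (j : 'I_n) => (code_word r k j == wval (c a))%:R)).
  rewrite /F /freq big_split/=; congr (_ * _).
  by rewrite prodr_const card_ord exprVn.
have -> : mix (@F k M n) G = (\sum_(i : {ffun 'I_m -> 'I_n})
    \sum_c (hit (@wval k M) (fun a => code_word r k (i a)) c)%:R
      * G (fun a => wval (c a))) / n%:R ^+ m.
  rewrite exchange_big/= mulr_suml; apply: eq_bigr => c _.
  by rewrite prodF -mulr_suml mulrAC.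
rewrite -massE (eq_bigr _ (fun c _ => prodF c)) -mulr_suml -mulrBl -sumrB.
have E1 (x : R) : 1 - x / n%:R ^+ m = ((\sum_(i : {ffun 'I_m -> 'I_n}) 1) - x) / n%:R ^+ m.
  by rewrite mulrBl sum_ffun_cst.
rewrite normrM normfV (gtr0_norm n0') E1.
rewrite ler_wpM2r ?invr_ge0 ?(ltW n0')// [X in _ <= _ - X]exchange_big -sumrB.
apply: le_trans (ler_norm_sum _ _ _) _; apply: ler_sum => i _.
by apply: finite_mixing => //; exact: wval_inj.
Qed.

Let p_ge0 w : 0 <= p w := wordprob_ge0 w gr.
Let p_nil : p [::] = 1 := wordprob_nil r.
Let p_cvg (w : seq nat) : \sum_(c < n) p (rcons w c) @[n --> \oo] --> p w :=
  @wordprob_cvg R r w gr.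

Section Sampled.
Variable U : nat -> R -> R.
Hypothesis mU : forall i, measurable_fun setT (U i).
Hypothesis U01 : forall i u, 0 <= U i u < 1.
Hypothesis iidU : forall n (A : nat -> set R), (forall i, measurable (A i)) ->
  unif R [set u | forall i, (i < n)%N -> A i (U i u)] = (\prod_(i < n) unif R (A i))%E.

Let W k u i := mkseq (letter p (U i u)) k.

Let measurable_W k i (w : seq nat) : measurable [set u | W k u i = w].
Proof.
have := measurable_letter_pred p_ge0 p_nil p_cvg k (fun s => s = w).
exact: (measurable_preimage (mU i)).
Qed.

Let measurable_GW k m (G : ('I_m -> seq nat) -> R) :
  measurable_fun setT (fun u => G (fun a : 'I_m => W k u a)).
Proof.
apply: measurable_lt_rat => q.
rewrite (_ : [set u | _] = [set u | exists c : {ffun 'I_m -> seq nat},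
    G c < ratr q /\ forall a : 'I_m, W k u a = c a]).
  apply: measurable_exists => c; apply: measurable_andP; first exact: measurable_cstP.
  by apply: measurable_forall => a; exact: measurable_W.
apply/seteqP; split=> u /=.
  move=> Gu; exists [ffun a : 'I_m => W k u a].
  rewrite (_ : ([ffun a : 'I_m => W k u a] : _ -> _) = (fun a : 'I_m => W k u a)).
    by split=> // a; rewrite ffunE.
  by apply/funext => a; rewrite ffunE.
move=> [c [Gc Wc]]; rewrite (_ : (fun a : 'I_m => W k u a) = c)//.
exact/funext.
Qed.

Let pr_hit k M m (c : {ffun 'I_m -> words k M}) :
  pr (unif R) [set u | hit (@wval k M) (fun a : 'I_m => W k u a) c] =
  \prod_(a < m) p (wval (c a)).
Proof.
pose A i : set R := if insub i is Some a then
  [set v | mkseq (letter p v) k = wval (c (a : 'I_m))] else setT.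
have mA i : measurable (A i).
  rewrite /A; case: insub => [a|]//.
  exact: (measurable_letter_pred p_ge0 p_nil p_cvg k (fun s => s = wval (c a))).
have AE (a : 'I_m) : A a = [set v | mkseq (letter p v) k = wval (c a)].
  by rewrite /A valK.
have -> : [set u | hit (@wval k M) (fun a : 'I_m => W k u a) c] =
    [set u | forall i, (i < m)%N -> A i (U i u)].
  apply/seteqP; split=> u /=.
    move=> /forallP H i im; have := H (Ordinal im); rewrite /W.
    by rewrite -[i]/(val (Ordinal im)) AE => /eqP.
  by move=> H; apply/forallP => a; apply/eqP; have := H a (ltn_ord a); rewrite AE.
transitivity (fine (\prod_(i < m) unif R (A i))); first by congr fine; exact: iidU.
rewrite (eq_bigr (fun a => (p (wval (c a)))%:E)) ?prodEFin// => a _.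
by rewrite AE; have := unif_letter p_ge0 p_nil p_cvg (wval (c a)); rewrite size_wval.
Qed.

(** The counterpart of [avg_mix], with independent samples in place of index tuples: both are
    compared with the same finite sum. *)
Let Ex_mix k M m (G : ('I_m -> seq nat) -> R) : (forall v, 0 <= G v <= 1) ->
  `|Ex (unif R) (fun u => G (fun a : 'I_m => W k u a)) - mix (fun t : words k M => p (wval t)) G|
  <= 1 - mass m (fun t : words k M => p (wval t)).
Proof.
move=> G01.
have mhit c : measurable [set u | hit (@wval k M) (fun a : 'I_m => W k u a) c].
  apply: measurable_boolP; apply: (measurable_fun_bool true).
  rewrite (_ : _ @^-1` _ = [set u | forall a : 'I_m, W k u a = wval (c a)]).
    by rewrite setTI; apply: measurable_forall => a; exact: measurable_W.
  apply/seteqP; split=> u /=; first by move=> /forallP H a; exact/eqP/H.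
  by move=> H; apply/forallP => a; apply/eqP.
have hitE c : (fun u => (hit (@wval k M) (fun a : 'I_m => W k u a) c)%:R) =
    \1_[set u | hit (@wval k M) (fun a : 'I_m => W k u a) c] :> (R -> R).
  apply/funext => u; rewrite indicE; congr (nat_of_bool _)%:R.
  by apply/idP/idP; rewrite inE.
have bhit c : mbounded (fun u => (hit (@wval k M) (fun a : 'I_m => W k u a) c)%:R : R).
  by rewrite hitE; exact: mbounded_indic.
have Exhit c : Ex (unif R) (fun u => (hit (@wval k M) (fun a : 'I_m => W k u a) c)%:R) =
    \prod_(a < m) p (wval (c a)).
  by rewrite hitE Ex_indic; [exact: pr_hit|exact: mhit].
have bGW : mbounded (fun u => G (fun a : 'I_m => W k u a)).
  split; first exact: measurable_GW.
  by exists 1 => u; have /andP[? ?] := G01 (fun a : 'I_m => W k u a); rewrite ger0_norm.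
have bhG c : mbounded (fun u => (hit (@wval k M) (fun a : 'I_m => W k u a) c)%:R
    * G (fun a => wval (c a)) : R).
  by apply: mboundedM => //; exact: mbounded_cst.
have -> : mix (fun t : words k M => p (wval t)) G = Ex (unif R) (fun u =>
    \sum_(c : {ffun 'I_m -> words k M}) (hit (@wval k M) (fun a : 'I_m => W k u a) c)%:R
    * G (fun a => wval (c a))).
  rewrite Ex_sum//; apply: eq_bigr => c _.
  rewrite -Exhit mulrC -(ExZ (unif R) _ (bhit c)); congr Ex; apply/funext => u.
  by rewrite mulrC.
rewrite -ExB//; last exact: mbounded_sum.
rewrite -massE -(eq_bigr _ (fun c _ => Exhit c)) -Ex_sum// -[X in X - _](Ex_cst (unif R)).
rewrite -ExB//; [|exact: mbounded_cst|exact: mbounded_sum].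
apply: le_trans (le_normr_Ex _ _) _.
  by apply: mboundedB => //; exact: mbounded_sum.
apply: le_Ex.
- by apply: mbounded_norm; apply: mboundedB => //; exact: mbounded_sum.
- by apply: mboundedB; [exact: mbounded_cst|exact: mbounded_sum].
- by move=> u; apply: finite_mixing => //; exact: wval_inj.
Qed.

Local Notation rho := (@sup_dist R r).
Variable phi : R -> closure_rows r.
Hypothesis phiP : forall u k, 0 <= u < 1 ->
  rho (row_pt r (letter p u k)) (phi u) <= 2 * rad R k.
Hypothesis mphi : measurable_fun setT (phi : R -> XB rho).

Let X (u : R) : XNB rho := fun i => phi (U i u).

Let rdist := good_distmat gr.

Let mX : measurable_fun setT X.
Proof. by apply: measurable_fun_XNB => i; exact: (measurableT_comp mphi (mU i)). Qed.

Let mFTX f : measurable_fun setT f -> measurable_fun setT (fun u => f (FT (X u)) : R).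
Proof.
move=> mf; have mFT := measurable_FT (sup_dist_metric rdist) (@sup_dist_separable R r).
exact: (measurableT_comp mf (measurableT_comp mFT mX)).
Qed.

(** The last letter of a word is the finest row that approximates the coded point, so this is [f]
    read off from words. *)
Let G f m (v : 'I_m -> seq nat) : R := f (perm_act (emb (fun a => last 0%N (v a))) r).

(** Each of the two points of an entry is within [2 rad k] of the row of its letter [k], the last
    one of a word of length [k + 1]; hence the factor 4. *)
Let dist_FTX m C f k u : nice m C f ->
  `|f (FT (X u)) - G f (fun a : 'I_m => W k.+1 u a)| <= C * (4 * rad R k).
Proof.
have [_ [_ [sym tri]]] := sup_dist_metric rdist.
move=> nf; apply: (nice_lip nf); first by rewrite mulr_ge0// ltW// rad_gt0.
move=> a b am bm; rewrite /perm_act -[(a, b).1]/a -[(a, b).2]/b.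
have lastW i : last 0%N (W k.+1 u i) = letter p (U i u) k by rewrite /W mkseqS last_rcons.
have embW i (im : (i < m)%N) :
    emb (fun a : 'I_m => last 0%N (W k.+1 u a)) i = letter p (U i u) k.
  transitivity (last 0%N (W k.+1 u i)); last exact: lastW.
  exact: (emb_ord _ (Ordinal im)).
rewrite !embW//.
rewrite -(sup_dist_row rdist) /FT/=.
have := phiP k (U01 b u); have := phiP k (U01 a u); rewrite /X.
set la := row_pt r _; set lb := row_pt r _; set xa := phi _; set xb := phi _ => H1 H2.
have := tri xa la xb; have := tri la lb xb; have := tri la xa lb; have := tri xa xb lb.
rewrite (sym xa la) (sym xb lb) => *.
by rewrite ler_norml; apply/andP; split; lra.
Qed.

(** An index is within [rad k] of its code, so an entry moves by less than [2 rad k]; the factor 4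
    is kept to share the bound of [dist_FTX]. *)
Let dist_corner m C f k n : (0 < n)%N -> nice m C f ->
  `|(\sum_(i : {ffun 'I_m -> 'I_n}) G f (fun a => code_word r k.+1 (i a))) / n%:R ^+ m
    - corner_avg f m r n| <= C * (4 * rad R k).
Proof.
move=> n0 nf; have n0' : 0 < (n%:R : R) ^+ m by rewrite exprn_gt0// ltr0n.
rewrite -mulrBl -sumrB normrM normfV (gtr0_norm n0') -[leRHS](@sum_ffun_cst R m n)//.
rewrite ler_wpM2r ?invr_ge0 ?(ltW n0')//; apply: le_trans (ler_norm_sum _ _ _) _.
apply: ler_sum => i _; rewrite distrC.
apply: (nice_emb nf); first by rewrite mulr_ge0// ltW// rad_gt0.
move=> a b; rewrite !code_wordS !last_rcons.
have [_ [_ [sym tri]]] := rdist.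
have := code_close k (i b) rdist; have := code_close k (i a) rdist.
have r0 := rad_gt0 R k.
set ca := code _ _ (val (i a)); set cb := code _ _ (val (i b)) => H1 H2.
have := tri (val (i a)) (val (i b)) ca; have := tri ca (val (i b)) cb.
have := tri ca cb (val (i a)); have := tri (val (i a)) cb (val (i b)).
rewrite (sym (val (i a)) ca) (sym (val (i b)) cb) => *.
by rewrite ler_norml; apply/andP; split; lra.
Qed.

(** The chain runs from [f] of the sample to [G] of its words, to [mix] with limit weights, to [mix]
    with frequencies, to [G] averaged over tuples, to [f] averaged over tuples. Each link costs
    [e / 6], except the fourth, which costs [2 e / 6]: the lost limit mass plus the fluctuation of
    [mass]. *)
Let cvg_corner_avg m C f : nice m C f ->
  corner_avg f m r n @[n --> \oo] --> Ex (unif R) (fun u => f (FT (X u))).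
Proof.
move=> nf; have C0 := nice_ge0 nf.
have G01 v : 0 <= G f (m := m) v <= 1 by exact: nice_itv nf _.
apply/cvgrPdist_le => e e0.
have [k ke] : exists k, C * (4 * rad R k) <= e / 6.
  have ce : 0 < e / (6 * (4 * C + 1)) by rewrite divr_gt0// mulr_gt0//; lra.
  have [k] := rad_small ce; rewrite ltr_pdivlMr; last by rewrite mulr_gt0//; lra.
  by have := rad_gt0 R k => r0 H; exists k; nra.
(* By [bernoulli_pow] the mass lost by [m] words is at most [m] times that lost by one; [m + 1]
   avoids a zero denominator. *)
have em : 0 < e / (6 * m.+1%:R) by rewrite divr_gt0// mulr_gt0.
have [M HM] := words_tight k.+1 em.
pose q (t : words k.+1 M) := p (wval t).
have q01 : 0 <= \sum_t q t <= 1 by rewrite sumr_ge0 ?sump_le1// => t _; exact: p_ge0.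
have massq : 1 - mass m q <= e / 6.
  apply: le_trans (bernoulli_pow m q01) _.
  have : 1 - \sum_t q t <= e / (6 * m.+1%:R) by rewrite lerBlDl -lerBlDr; exact: HM.
  move=> H; apply: (@le_trans _ _ (m.+1%:R * (e / (6 * m.+1%:R)))).
    by apply: ler_pM => //; [rewrite subr_ge0; case/andP: q01|rewrite ler_nat].
  have : m.+1%:R != 0 :> R by rewrite pnatr_eq0.
  move: (m.+1%:R : R) => x x0; rewrite (_ : x * _ = e / 6)//; by field.
have cmass : mass m (@F k.+1 M n) @[n --> \oo] --> mass m q.
  have c := @cvg_bigsum R _ (index_enum (words k.+1 M)) (fun t n => F n t) q (@cvgF k.+1 M).
  exact: (continuous_cvg _ (@exprn_continuous R m (\sum_t q t)) c).
have cmix : mix (@F k.+1 M n) (G f (m := m)) @[n --> \oo] --> mix q (G f (m := m)).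
  apply: (@cvg_bigsum R _ (index_enum {ffun 'I_m -> words k.+1 M})
    (fun c n => (\prod_(a < m) F n (c a)) * G f (fun a => wval (c a)))
    (fun c => (\prod_(a < m) q (c a)) * G f (fun a => wval (c a)))) => c.
  apply: cvgMl; apply: (@cvg_bigprod R _ (index_enum 'I_m) (fun a n => F n (c a))
    (fun a => q (c a))) => a; exact: cvgF.
have e60 : 0 < e / 6 by rewrite divr_gt0.
have Ex1 : `|Ex (unif R) (fun u => f (FT (X u)))
    - Ex (unif R) (fun u => G f (fun a : 'I_m => W k.+1 u a))| <= e / 6.
  apply: Ex_dist_le.
  - split; first exact: mFTX (nice_measurable nf).
    by exists 1 => u; have /andP[? ?] := nice_itv nf (FT (X u)); rewrite ger0_norm.
  - split; first exact: measurable_GW.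
    by exists 1 => u; have /andP[? ?] := G01 (fun a : 'I_m => W k.+1 u a); rewrite ger0_norm.
  - by move=> u; apply: le_trans ke; exact: dist_FTX.
have Ex2 : `|Ex (unif R) (fun u => G f (fun a : 'I_m => W k.+1 u a)) - mix q (G f (m := m))|
    <= 1 - mass m q by exact: Ex_mix.
near=> n.
have n0 : (0 < n)%N by near: n; exact: nbhs_infty_gt.
have D1 := dist_corner k n0 nf.
have D2 := avg_mix k.+1 M n0 G01.
have D3 : `|mass m q - mass m (@F k.+1 M n)| <= e / 6.
  by near: n; move/cvgrPdist_le : cmass; exact.
have D4 : `|mix q (G f (m := m)) - mix (@F k.+1 M n) (G f (m := m))| <= e / 6.
  by near: n; move/cvgrPdist_le : cmix; exact.
move: Ex1 Ex2 D1 D2 D3 D4 massq ke.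
rewrite !ler_norml; move: (Ex _ _) (Ex _ _) (corner_avg _ _ _ _) (_ / n%:R ^+ m)
  (mix q _) (mix (@F k.+1 M n) _) (mass m q) (mass m (@F k.+1 M n)) (C * _).
move=> x1 x2 x3 x4 x5 x6 x7 x8 x9.
move=> /andP[? ?] /andP[? ?] /andP[? ?] /andP[? ?] /andP[? ?] /andP[? ?] ? ?.
apply/andP; split; lra.
Unshelve. all: by end_near. Qed.

Lemma sampled_law : exists (mu : probability (XB rho) R) (nu : probability (XNB rho) R),
  is_product_measure mu nu /\ forall m C f, nice m C f ->
  corner_avg f m r n @[n --> \oo] --> Ex nu (fun x => f (FT x)).
Proof.
have [mu muE] := law_exists (unif R) mphi; have [nu nuE] := law_exists (unif R) mX.
exists mu, nu; split.
  move=> n A mA; rewrite nuE.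
  transitivity (\prod_(i < n) unif R (phi @^-1` A i))%E; last by apply: eq_bigr => i _; rewrite muE.
  by apply: (@iidU n (fun i => phi @^-1` A i)) => i; exact: (measurable_preimage mphi).
move=> m C f nf; rewrite (Ex_comp (X := X) (P := unif R)) //.
- exact: cvg_corner_avg nf.
- split; last by exists 1 => u; have /andP[? ?] := nice_itv nf (FT u); rewrite ger0_norm.
  have mFT := measurable_FT (sup_dist_metric rdist) (@sup_dist_separable R r).
  exact: (measurableT_comp (nice_measurable nf) mFT).
Qed.

End Sampled.

Lemma good_sampled_law : exists (mu : probability (XB (@sup_dist R r)) R)
    (nu : probability (XNB (@sup_dist R r)) R),
  is_product_measure mu nu /\ forall m C f, nice m C f ->
  corner_avg f m r n @[n --> \oo] --> Ex nu (fun x => f (FT x)).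
Proof.
have [U [mU U01 iidU]] := iid_uniform_exists R.
have [phi [phiP mphi]] := sample_exists gr.
exact: (sampled_law mU U01 iidU phiP mphi).
Qed.

End SampleAveragesLimit.

(** * Almost sure statements and limits *)

Section AlmostEverywhere.
Context d (T : measurableType d) (R : realType) (P : probability T R).

Lemma ae_imp (A B : T -> Prop) : {ae P, forall x, A x} -> (forall x, A x -> B x) ->
  {ae P, forall x, B x}.
Proof. by move=> aeA AB; apply: filterS aeA => x /AB. Qed.

Lemma ae_and (A B : T -> Prop) : {ae P, forall x, A x} -> {ae P, forall x, B x} ->
  {ae P, forall x, A x /\ B x}.
Proof. by move=> aeA aeB; apply: filterS2 aeA aeB => x. Qed.

Lemma ae_measurable1 (A : set T) : measurable A -> pr P A = 1 -> {ae P, forall x, A x}.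
Proof.
move=> mA A1; exists (~` A); split => //; first exact: measurableC.
by rewrite probability_setC// pr_EFin// A1 subee.
Qed.

Lemma pr_ae1 (A : set T) : measurable A -> {ae P, forall x, A x} -> pr P A = 1.
Proof.
move=> mA [N [mN N0 AN]].
have mCA := measurableC mA.
have : P (~` A) = 0%E.
  by apply/eqP; rewrite eq_le measure_ge0 andbT -N0; apply: le_measure; rewrite ?inE.
rewrite probability_setC// pr_EFin// => /eqP.
by rewrite -EFinB eqe subr_eq0 => /eqP.
Qed.

(** No measurability of [Q] is asked: the union of the inner approximations for [e = 1/(n+1)] has
    full measure. *)
Lemma ae_large (Q : set T) :
  (forall e : R, 0 < e -> exists A, [/\ measurable A, A `<=` Q & 1 - e < pr P A]) ->
  {ae P, forall x, Q x}.
Proof.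
move=> H.
have /choice[A HA] n : exists A, [/\ measurable A, A `<=` Q & 1 - n.+1%:R^-1 < pr P A].
  by apply: H; rewrite invr_gt0.
have mA n : measurable (A n) by have [] := HA n.
have mU : measurable (\bigcup_n A n) by exact: bigcup_measurable.
suff : {ae P, forall x, (\bigcup_n A n) x}.
  by apply: filterS => x [n _ Ax]; have [_ + _] := HA n; exact.
apply: ae_measurable1 => //; apply/le_anti/andP; split; first exact: pr_le1.
apply/ler_addgt0Pr => e e0; have [n ne] : exists n, n.+1%:R^-1 < e.
  have [n _ Hn] := near_infty_natSinv_lt (PosNum e0); exists n; exact: (Hn n (leqnn n)).
have [_ _ An] := HA n.
rewrite -lerBlDr; apply: (@le_trans _ _ (pr P (A n))); last first.
  by apply: le_pr => //; exact: bigcup_sup.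
by apply: le_trans (ltW An); rewrite lerD2l lerN2 ltW.
Qed.

Lemma ae_exists (Q : set T) : {ae P, forall x, Q x} -> exists x, Q x.
Proof.
move=> [N [mN N0 QN]]; apply: contrapT => /forallNP nQ.
have : P setT = 0%E.
  rewrite -N0; congr (P _); apply/seteqP; split=> // x _; apply: QN => /=; exact: nQ.
by rewrite probability_setT => /eqP; rewrite onee_eq0.
Qed.

Lemma ae_countable (I : countType) (Q : I -> T -> Prop) :
  (forall i, {ae P, forall x, Q i x}) -> {ae P, forall x, forall i, Q i x}.
Proof.
move=> H; have : {ae P, forall x, forall n : nat,
    if unpickle n is Some i then Q i x else True}.
  by apply: ae_foralln => n; case: unpickle => [i|]; [exact: H|exact: aeW].
by apply: filterS => x Qx i; have := Qx (pickle i); rewrite pickleK.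
Qed.

Lemma pr_nondecreasing_cvg (A : nat -> set T) : (forall n, measurable (A n)) ->
  (forall m n, (m <= n)%N -> A m `<=` A n) ->
  pr P (A n) @[n --> \oo] --> pr P (\bigcup_n A n).
Proof.
move=> mA ndA; have mU : measurable (\bigcup_n A n) by exact: bigcup_measurable.
have : P (A n) @[n --> \oo] --> P (\bigcup_n A n).
  by apply: nondecreasing_cvg_mu => // m n mn; apply/subsetPset; exact: ndA.
by rewrite pr_EFin// => /fine_cvgP[].
Qed.

End AlmostEverywhere.

Section MeasurableLimits.
Context d (T : measurableType d) (R : realType) (u : nat -> T -> R).
Hypothesis mu : forall n, measurable_fun setT (u n).

Lemma measurable_cvgn : measurable [set x | cvgn (fun n => u n x)].
Proof.
(* The Cauchy criterion without absolute value, since [m] and [n] may be exchanged. *)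
rewrite (_ : [set x | _] = [set x | forall p : nat, exists N : nat, forall m : nat, forall n : nat,
   (N <= m)%N -> (N <= n)%N -> u m x - u n x < p.+1%:R^-1]).
  do 4 (first [apply: measurable_forall => ? | apply: measurable_exists => ?]).
  apply: measurable_implyP => _; apply: measurable_implyP => _.
  by apply: measurable_ltP; [exact: measurable_funB|exact: measurable_cst].
apply/seteqP; split=> x /=.
  move=> cu p; have : (0 : R) < p.+1%:R^-1 by rewrite invr_gt0.
  move: (p.+1%:R^-1 : R) => e e0; have p0 : 0 < e / 2 by rewrite divr_gt0.
  move: cu => /cvg_ex[l /cvgrPdist_lt/(_ _ p0)[N _ HN]]; exists N => m n Nm Nn.
  have := HN m Nm; have := HN n Nn; rewrite !ltr_distl => /andP[? ?] /andP[? ?]; lra.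
move=> H; apply: real_cauchy_cvg => e e0.
have [p pe] : exists p, p.+1%:R^-1 < e.
  have [n _ Hn] := near_infty_natSinv_lt (PosNum e0); exists n; exact: (Hn n (leqnn n)).
have [N HN] := H p; exists N => m n Nm Nn.
have H1 := lt_trans (HN m n Nm Nn) pe; have H2 := lt_trans (HN n m Nn Nm) pe.
by rewrite ltr_norml H1 andbT ltrNl opprB.
Qed.

Hypothesis u01 : forall n x, 0 <= u n x <= 1.

Lemma measurable_limsup : measurable_fun setT (fun x => limn_sup (fun n => u n x)).
Proof.
by apply: measurable_fun_limn_sup => // x _;
  [exists 1|exists 0] => _ [n _ <-]; have /andP[] := u01 n x.
Qed.

Lemma limsup_cvg x l : u n x @[n --> \oo] --> l -> limn_sup (fun n => u n x) = l.
Proof. by move=> /cvg_sups /(cvg_lim (@Rhausdorff R)). Qed.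

Lemma measurable_lim_gt (c : R) :
  measurable [set x | exists2 l, u n x @[n --> \oo] --> l & c < l].
Proof.
rewrite (_ : [set x | _] = [set x | cvgn (fun n => u n x) /\ c < limn_sup (fun n => u n x)]).
  apply: measurable_andP; first exact: measurable_cvgn.
  by apply: measurable_ltP; [exact: measurable_cst|exact: measurable_limsup].
apply/seteqP; split=> x /=.
  by move=> [l cl ?]; rewrite (limsup_cvg cl); split=> //; apply/cvg_ex; exists l.
by move=> [/cvg_ex[l cl]]; rewrite (limsup_cvg cl); exists l.
Qed.

Lemma Ex_limsup (P : probability T R) : {ae P, forall x, cvgn (fun n => u n x)} ->
  Ex P (u n) @[n --> \oo] --> Ex P (fun x => limn_sup (fun n => u n x)).
Proof.
move=> ae; apply: (@Ex_dct _ _ _ P u _ 1) => //; first exact: measurable_limsup.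
  by move=> n x; have /andP[? ?] := u01 n x; rewrite ger0_norm.
by apply: filterS ae => x /cvg_ex[l cl]; rewrite (limsup_cvg cl).
Qed.

Lemma limsup_itv x : 0 <= limn_sup (fun n => u n x) <= 1.
Proof.
have cs : cvgn (sups (fun n => u n x)).
  apply/cvg_ex; eexists; apply: cvg_sups_inf;
    by [exists 1 => _ [n _ <-]; have /andP[] := u01 n x|exists 0 => _ [n _ <-]; have /andP[] := u01 n x].
apply/andP; split.
  apply: limr_ge => //; apply: nearW => n.
  apply: (@le_trans _ _ (u n x)); first by have /andP[] := u01 n x.
  apply: ub_le_sup; last by exists n => /=.
  by exists 1 => _ [k _ <-]; have /andP[] := u01 k x.
apply: limr_le => //; apply: nearW => n; apply: ge_sup; first by exists (u n x), n => /=.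
by move=> _ [k _ <-]; have /andP[] := u01 k x.
Qed.

End MeasurableLimits.

(** To append [x], compose with the transposition of [x] and the current image of [size s]. It moves
    no earlier value: [x] is not among them, and neither is that image, by injectivity. *)
Lemma perm_extend (s : seq nat) : uniq s ->
  exists2 p, finite_perm p & forall k, (k < size s)%N -> p k = nth 0%N s k.
Proof.
elim/last_ind: s => [_|s x IH].
  exists id => //; split; first by exists id.
  by exists 0%N.
rewrite rcons_uniq => /andP[xs us]; have [p [bp [n pn]] ps] := IH us.
pose y := p (size s).
have ip := bij_inj bp.
pose t i := if i == y then x else if i == x then y else i.
have tt : involutive t.
  by move=> i; rewrite /t; repeat case: eqP => //; congruence.
exists (fun k => t (p k)).
  split; first by apply: (bij_comp _ bp); exists t.
  exists (maxn n (maxn x y).+1) => i.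
  rewrite geq_max gtn_max => /and3P[ni xi yi].
  by rewrite pn// /t !gtn_eqF.
move=> k; rewrite size_rcons ltnS leq_eqVlt => /orP[/eqP ->|ks] /=.
  by rewrite nth_rcons ltnn eqxx /t /y eqxx.
rewrite nth_rcons ks ps// /t; case: eqVneq => [E|_].
  by have := ip k (size s); rewrite ps// -/y E => /(_ erefl) E'; rewrite E' ltnn in ks.
by case: eqVneq => // E; rewrite -E mem_nth in xs.
Qed.

(** * Column frequencies of an invariant law *)

Section Exchangeable.
Context (R : realType) (D : probability (MatB R) R).
Hypothesis invD : Sinf_invariant D.

(** A finite permutation can fix the indices below [M] and send [M] and [M + 1] to any two distinct
    indices from [M] on. As [Q] reads only the rows below [M], single and pair probabilities are
    constant there. *)
Lemma ae_cvg_freq_rows M (Q : (nat -> R) -> bool) :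
  (forall x y, (forall i, (i < M)%N -> x i = y i) -> Q x = Q y) ->
  (forall j, measurable [set r : MatB R | Q (fun i => r (i, j))]) ->
  [/\ {ae D, forall r, cvgn (freq R (fun j => Q (fun i => r (i, j))))} &
      forall j, (M <= j)%N -> pr D [set r | Q (fun i => r (i, j))] =
        pr D [set r | Q (fun i => r (i, M))]].
Proof.
move=> Qloc mQ; pose A j := [set r : MatB R | Q (fun i => r (i, j))].
have perm_iota s (a b : nat) : (forall k, (k < M.+2)%N -> s k = nth 0%N (iota 0 M ++ [:: a; b]) k) ->
    [/\ forall i, (i < M)%N -> s i = i, s M = a & s M.+1 = b].
  move=> sE; split.
  - by move=> i iM; rewrite sE ?nth_cat ?size_iota ?iM ?nth_iota//; lia.
  - by rewrite sE ?nth_cat ?size_iota ?ltnn ?subnn.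
  - by rewrite sE// nth_cat size_iota ltnNge leqnSn subSnn.
have pair i j : (M <= i)%N -> (M <= j)%N -> i != j -> exists2 s, finite_perm s &
    [/\ forall i, (i < M)%N -> s i = i, s M = i & s M.+1 = j].
  move=> Mi Mj ij; have [|s fs sE] := @perm_extend (iota 0 M ++ [:: i; j]).
    by rewrite cat_uniq iota_uniq/= !inE ij !mem_iota/= add0n orbF andbT negb_or -!leqNgt Mi Mj.
  exists s => //; apply: perm_iota => k kM; apply: sE.
  by rewrite size_cat size_iota addn2.
have actA s j k : (forall i, (i < M)%N -> s i = i) -> s j = k -> perm_act s @^-1` A j = A k.
  move=> sM sj; apply/seteqP; split=> r /=; rewrite /A/= /perm_act/= sj;
    by rewrite (Qloc _ (fun i => r (i, k)))// => i iM; rewrite sM.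
have single j : (M <= j)%N -> pr D (A j) = pr D (A M).
  move=> Mj; have [s fs [sM sj _]] : exists2 s, finite_perm s &
    [/\ forall i, (i < M)%N -> s i = i, s M = j & s M.+1 = j.+1].
    by apply: pair => //; [exact: leqW|rewrite ltn_eqF].
  by rewrite /pr -(invD fs (mQ M)) (actA s M j).
split=> //.
have := @ae_cvg_freq _ _ R D A (pr D (A M)) (pr D (A M `&` A M.+1)) M mQ single.
have h i j : (M <= i)%N -> (M <= j)%N -> i != j -> pr D (A i `&` A j) = pr D (A M `&` A M.+1).
  move=> Mi Mj ij; have [s fs [sM si sj]] := pair i j Mi Mj ij.
  rewrite /pr; have <- := invD fs (measurableI (A M) (A M.+1) (mQ M) (mQ M.+1)).
  by rewrite preimage_setI (actA s M i)// (actA s M.+1 j).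
move=> /(_ h); apply: filterS => r.
rewrite (_ : (fun j => r \in A j) = (fun j => Q (fun i => r (i, j))))//.
by apply/funext => j; apply/idP/idP; rewrite inE.
Qed.

Lemma measurable_find k j (s : seq nat) c :
  measurable [set r : MatB R | find (fun i => r (i, j) < rad R k) s = c].
Proof.
have mc i : measurable [set r : MatB R | r (i, j) < rad R k].
  by apply: measurable_ltP; [exact: measurable_coord|exact: measurable_cst].
elim: s c => [|i s IH] c /=; first exact: measurable_cstP.
rewrite (_ : [set r | _] = [set r : MatB R |
   (r (i, j) < rad R k /\ 0%N = c) \/
   ((~ (r (i, j) < rad R k)) /\
      exists c', (find (fun i => r (i, j) < rad R k) s = c') /\ c'.+1 = c)]).
  apply: measurableU; first by apply: measurable_andP => //; exact: measurable_cstP.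
  apply: measurable_andP; first exact: measurable_not.
  by apply: measurable_exists => c'; apply: measurable_andP => //; exact: measurable_cstP.
apply/seteqP; split=> r /=; case: ifP => H.
- by left.
- by move=> <-; right; split=> //; eexists.
- by move=> [[]//|[]].
- by move=> [[]//|[_ [c' [-> <-]]]].
Qed.

Lemma ae_word_freq w :
  {ae D, forall r, cvgn (freq R (fun j => code_word r (size w) j == w))}.
Proof.
pose M := \max_(c <- w) c.+1.
pose Q (x : nat -> R) :=
  mkseq (fun k => find (fun i => x i < rad R k) (iota 0 M)) (size w) == w.
have [] := @ae_cvg_freq_rows M Q.
- move=> x y xy; congr (_ == w); apply: eq_mkseq_lt => k _; apply: eq_in_find => i.
  by rewrite mem_iota => /= iM; rewrite xy.
- move=> j; rewrite (_ : [set r | _] = [set r : MatB R | forall k, (k < size w)%N ->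
    find (fun i => r (i, j) < rad R k) (iota 0 M) = nth 0%N w k]).
    by apply: measurable_forall => k; apply: measurable_implyP => _; exact: measurable_find.
  apply/seteqP; split=> r /=.
    by move=> /eqP E k kw; have := congr1 (fun s => nth 0%N s k) E; rewrite nth_mkseq.
  move=> H; apply/eqP/(@eq_from_nth _ 0%N); rewrite size_mkseq// => k kw.
  by rewrite nth_mkseq// H.
move=> ae _; apply: (ae_imp ae) => r /cvg_ex[l cl]; apply/cvg_ex; exists l.
apply: (cvg_freq_eventually (N := M) _ cl) => j Mj.
rewrite (@code_word_trunc _ _ _ _ M)//; apply/allP => c cw.
by rewrite /M (big_rem c cw)/= leq_maxl.
Qed.

Lemma close_frac_freq r N (e : R) n :
  close_frac r N e n = freq R (fun j => has (fun i => r (i, j) < e) (iota 0 N)) n.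
Proof.
rewrite /close_frac /freq -sum1_card natr_sum big_mkcond/=; congr (_ / _).
apply: eq_bigr => j _; rewrite inE.
have -> : [exists i : 'I_N, r (nat_of_ord i, nat_of_ord j) < e] =
    has (fun i => r (i, nat_of_ord j) < e) (iota 0 N).
  apply/existsP/hasP => [[i H]|[i]]; first by exists (val i); rewrite ?mem_iota/=.
  by rewrite mem_iota => /= iN H; exists (Ordinal iN).
by case: has.
Qed.

Lemma measurable_has_close N j (e : R) :
  measurable [set r : MatB R | has (fun i => r (i, j) < e) (iota 0 N)].
Proof.
rewrite (_ : [set r | _] = [set r : MatB R | exists i, (i < N)%N /\ r (i, j) < e]).
  apply: measurable_exists => i; apply: measurable_andP; first exact: measurable_cstP.
  by apply: measurable_ltP; [exact: measurable_coord|exact: measurable_cst].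
apply/seteqP; split=> r /=; first by move=> /hasP[i]; rewrite mem_iota => ? ?; exists i.
by move=> [i [iN H]]; apply/hasP; exists i => //; rewrite mem_iota.
Qed.

Lemma measurable_close_frac N (e : R) n :
  measurable_fun setT (fun r : MatB R => close_frac r N e n).
Proof.
rewrite (_ : (fun r => _) = fun r : MatB R =>
  n%:R^-1 * \sum_(j < n) \1_[set r | has (fun i => r (i, val j) < e) (iota 0 N)] r).
  apply: measurable_funM; first exact: measurable_cst.
  apply: measurable_sum => j; apply: measurable_indic; exact: measurable_has_close.
apply/funext => r; rewrite close_frac_freq /freq mulrC; congr (_ * _); apply: eq_bigr => j _.
rewrite indicE; congr (nat_of_bool _)%:R; by apply/idP/idP; rewrite inE.
Qed.

Lemma close_frac_itv r N (e : R) n : 0 <= close_frac r N e n <= 1.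
Proof. by rewrite close_frac_freq freq_ge0 freq_le1. Qed.

Lemma measurable_good_set1 N (e : R) : measurable (@good_set1 R N e).
Proof.
apply: measurable_andP; first exact: measurable_distmat.
apply: measurable_lim_gt; first by move=> n; exact: measurable_close_frac.
by move=> n r; exact: close_frac_itv.
Qed.

Lemma measurable_good_set2 N (e : R) : measurable (@good_set2 R N e).
Proof.
apply: measurable_andP; first exact: measurable_distmat.
apply: measurable_forall => j; apply: measurable_implyP => _.
rewrite (_ : [set r | _] = [set r : MatB R | has (fun i => r (i, j) < e) (iota 0 N)]).
  exact: measurable_has_close.
apply/seteqP; split=> r /=.
  by move=> [i iN H]; apply/hasP; exists i => //; rewrite mem_iota.
by move=> /hasP[i]; rewrite mem_iota => ? ?; exists i.
Qed.

Lemma ae_close_frac N (e : R) : {ae D, forall r, cvgn (close_frac r N e)} /\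
  forall j, (N <= j)%N -> pr D [set r | has (fun i => r (i, j) < e) (iota 0 N)] =
    pr D [set r | has (fun i => r (i, N) < e) (iota 0 N)].
Proof.
pose Q (x : nat -> R) := has (fun i => x i < e) (iota 0 N).
have [|j|ae H] := @ae_cvg_freq_rows N Q.
- by move=> x y xy; apply: eq_in_has => i; rewrite mem_iota => /= iN; rewrite xy.
- exact: measurable_has_close.
split=> //; apply: (ae_imp ae) => r.
by rewrite (_ : close_frac r N e = freq R (fun j => Q (fun i => r (i, j))))//;
  apply/funext => n; rewrite close_frac_freq.
Qed.

Lemma freq_lt_cvg0 N : freq R (fun j => j < N)%N n @[n --> \oo] --> (0 : R).
Proof.
apply: (@cvg_freq_eventually R (fun=> false) _ N) => [j|].
  by move=> Nj; apply/esym/negbTE; rewrite -leqNgt.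
by apply: cvg_near_cst; apply: nearW => n; rewrite /freq big1 ?mul0r.
Qed.

(** A column [j >= N] that is [e]-close to a row below [N] has its code below [N]. The other columns
    have limit frequency less than [e], and the first [N] columns frequency 0 in the limit. *)
Lemma good_set1_tight r N (e e' : R) k : e <= rad R k -> e < e' -> good_set1 N e r ->
  \forall n \near \oo, freq R (fun j => N <= code r k j)%N n <= e'.
Proof.
move=> ek ee' [_ [l cl el]].
have cf0 := @freq_lt_cvg0 N.
have : close_frac r N e n - freq R (fun j => j < N)%N n @[n --> \oo] --> l - 0 by exact: cvgB.
rewrite subr0 => /cvgr_gt/(_ (1 - e')) Hgt.
near=> n.
have n0 : (0 < n)%N by near: n; exact: nbhs_infty_gt.
have H : 1 - e' < close_frac r N e n - freq R (fun j => j < N)%N n.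
  by near: n; apply: Hgt; apply: lt_trans el; rewrite ltrD2l ltrN2.
apply: (@le_trans _ _ (freq R (fun j => (j < N)%N ||
    ~~ has (fun i => r (i, j) < e) (iota 0 N)) n)).
  apply: le_freq => j; case: (ltnP j N) => //= Nj; rewrite leqNgt code_lt// => /hasPn H'.
  by apply/hasPn => i /H'; apply: contra => /lt_le_trans; exact.
apply: le_trans (freqU _ _ _ _) _; rewrite freqC// -close_frac_freq.
move: H; move: (freq _ _ _) (close_frac _ _ _ _) => x y H; lra.
Unshelve. all: by end_near. Qed.

Hypothesis distD : D (@distmat R) = 1%E.

Lemma ae_distmat : {ae D, forall r, distmat r}.
Proof. by apply: ae_measurable1; [exact: measurable_distmat|rewrite /pr distD]. Qed.

Lemma cond1_ae_good : cond1 D -> {ae D, forall r, good r}.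
Proof.
move=> c1.
have ae_tight k p : {ae D, forall r, exists M, \forall n \near \oo,
    freq R (fun j => M <= code r k j)%N n <= p.+1%:R^-1}.
  apply: ae_large => e e0.
  have p0 : (0 : R) < p.+1%:R^-1 by rewrite invr_gt0.
  (* The three bounds serve the probability, the radius and the frequency; halving the last makes it
     strict. *)
  pose e1 := Num.min e (Num.min (rad R k) (p.+1%:R^-1 / 2)).
  have e10 : 0 < e1 by rewrite !lt_min e0 rad_gt0 divr_gt0.
  have [N HN] := c1 _ e10.
  exists (good_set1 N e1); split; first exact: measurable_good_set1.
    move=> r gr; exists N; apply: good_set1_tight gr; first by rewrite !ge_min lexx orbT.
    apply: (@le_lt_trans _ _ (p.+1%:R^-1 / 2)); first by rewrite !ge_min lexx !orbT.
    by rewrite ltr_pdivrMr// mulrDr mulr1 ltrDl.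
  rewrite pr_EFin in HN; last exact: measurable_good_set1.
  rewrite lte_fin in HN.
  by apply: le_lt_trans HN; rewrite lerD2l lerN2 ge_min lexx.
have words := ae_countable (fun w => ae_word_freq w).
have tight := ae_countable (fun kp : nat * nat => ae_tight kp.1 kp.2).
apply: (ae_imp (ae_and ae_distmat (ae_and words tight))) => r [dr [wr tr]].
split=> // k e e0.
have [n _ Hn] := near_infty_natSinv_lt (PosNum e0).
have [M HM] := tr (k, n); exists M; apply: filterS HM => m Hm.
by apply: (le_trans Hm); apply/ltW/(Hn n (leqnn n)).
Qed.

Lemma good_set2_sub N (e : R) : 0 < e -> good_set2 N e `<=` good_set1 N e.
Proof.
move=> e0 r [dr H]; split=> //; exists 1; last by rewrite ltrBlDr ltrDl.
rewrite (_ : close_frac r N e = freq R (fun j => has (fun i => r (i, j) < e) (iota 0 N)));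
  last by apply/funext => n; rewrite close_frac_freq.
apply: (@cvg_freq_eventually R (fun=> true) _ N) => [j Nj|].
  by apply/esym/hasP; have [i iN ri] := H j Nj; exists i; rewrite ?mem_iota.
apply: cvg_near_cst; exists 1%N => // n /= n0.
by rewrite /freq sumr_const card_ord divff// pnatr_eq0 -lt0n.
Qed.

Lemma cond2_cond1 : cond2 D -> cond1 D.
Proof.
move=> c2 e e0; have [N HN] := c2 e e0; exists N; apply: lt_le_trans HN _.
apply: le_measure; rewrite ?inE; [exact: measurable_good_set2|exact: measurable_good_set1|].
exact: good_set2_sub.
Qed.

Lemma cond2_ae_totally_bounded : cond2 D -> {ae D, forall r, forall e : R, 0 < e ->
  exists N, forall j, exists2 i, (i < N)%N & r (i, j) < e}.
Proof.
move=> c2.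
have H p : {ae D, forall r, exists N, forall j, exists2 i, (i < N)%N & r (i, j) < (p.+1%:R^-1 : R)}.
  apply: ae_large => e e0.
  have p0 : (0 : R) < p.+1%:R^-1 by rewrite invr_gt0.
  pose e1 := Num.min e p.+1%:R^-1.
  have e10 : 0 < e1 by rewrite lt_min e0.
  have [N HN] := c2 _ e10; exists (good_set2 N e1); split; first exact: measurable_good_set2.
    move=> r [[r0 _] Hr]; exists N => j; have [jN|Nj] := ltnP j N.
      by exists j; rewrite ?r0.
    by have [i iN ri] := Hr j Nj; exists i => //; apply: lt_le_trans ri _; rewrite ge_min lexx orbT.
  rewrite pr_EFin in HN; last exact: measurable_good_set2.
  rewrite lte_fin in HN.
  by apply: le_lt_trans HN; rewrite lerD2l lerN2 ge_min lexx.
apply: (ae_imp (ae_foralln H)) => r Hr e e0.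
have [n _ Hn] := near_infty_natSinv_lt (PosNum e0).
have [N HN] := Hr n; exists N => j; have [i iN ri] := HN j; exists i => //.
by apply: lt_trans ri _; exact: (Hn n (leqnn n)).
Qed.

End Exchangeable.

(** * Ergodicity *)

(** The proportion of injective tuples among all m-tuples of indices below [n], a product of the
    factors [(n - i) / n]. *)
Lemma cvg_ffact (R : realType) m : (n ^_ m)%:R / n%:R ^+ m @[n --> \oo] --> (1 : R).
Proof.
have c (i : 'I_m) : (n - i)%:R / n%:R @[n --> \oo] --> (1 : R).
  have : freq R (fun j => ~~ (j < i)%N) n @[n --> \oo] --> (1 : R).
    apply: (@cvg_freq_eventually R (fun=> true) _ i) => [j|].
      by move=> ij; rewrite -leqNgt ij.
    apply: cvg_near_cst; exists 1%N => // n /= n0.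
    by rewrite /freq sumr_const card_ord divff// pnatr_eq0 -lt0n.
  apply: cvg_trans; apply: near_eq_cvg; exists i.+1 => // n /= ni.
  have n0 : (0 < n)%N by exact: leq_trans ni.
  have S : \sum_(j < n) (j < i)%N%:R = i%:R :> R.
    rewrite -natr_sum; congr _%:R.
    transitivity (\sum_(j < n | (j < i)%N) 1)%N.
      by rewrite [in RHS]big_mkcond; apply: eq_bigr => j _; case: ltnP.
    by rewrite -(big_ord_widen n (fun=> 1%N)) ?sum1_card ?card_ord// ltnW.
  rewrite freqC// /freq S natrB 1?ltnW// mulrBl divff// pnatr_eq0 -lt0n.
  exact: n0.
have := @cvg_bigprod R _ (index_enum 'I_m) (fun i n => (n - i)%:R / n%:R) (fun=> 1) c.
rewrite [X in _ --> X]big1//; apply: cvg_trans; apply: near_eq_cvg; apply: nearW => n.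
by rewrite ffact_prod natr_prod big_split/= prodr_const card_ord exprVn.
Qed.

Section Ergodic.
Context (R : realType) (D : probability (MatB R) R).
Hypothesis invD : Sinf_invariant D.
Hypothesis ergD : Sinf_ergodic D.
Variables (m : nat) (C : R) (f : MatB R -> R).
Hypothesis nf : nice m C f.

Let f_eq r r' : (forall a b, (a < m)%N -> (b < m)%N -> r (a, b) = r' (a, b)) -> f r = f r'.
Proof.
move=> rr'; apply/eqP; rewrite -subr_eq0 -normr_le0 -(mulr0 C).
apply: (nice_lip nf) => // a b am bm; by rewrite rr'// subrr normr0.
Qed.

Let mfe (c : nat -> nat) : mbounded (fun r => f (perm_act c r)).
Proof.
split; first exact: (measurableT_comp (nice_measurable nf) (@measurable_perm_act R c)).
by exists 1 => r; have /andP[? ?] := nice_itv nf (perm_act c r); rewrite ger0_norm.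
Qed.

Lemma corner_avg_invariant s : finite_perm s -> exists n0, forall n r, (n0 <= n)%N ->
  corner_avg f m (perm_act s r) n = corner_avg f m r n.
Proof.
move=> [bs [n0 sn0]]; exists n0 => n r n0n.
have sn (i : 'I_n) : (s i < n)%N.
  rewrite ltnNge; apply/negP => nsi; have := sn0 (s i) (leq_trans n0n nsi).
  by move=> /(bij_inj bs) E; rewrite E leqNgt ltn_ord in nsi.
pose h (i : {ffun 'I_m -> 'I_n}) : {ffun 'I_m -> 'I_n} := [ffun a => Ordinal (sn (i a))].
have hi : injective h.
  move=> i i' /ffunP E; apply/ffunP => a; have := E a; rewrite !ffunE.
  by move=> /(congr1 val) /= /(bij_inj bs) /val_inj.
rewrite /corner_avg [in RHS](reindex_inj hi); congr (_ / _); apply: eq_bigr => i _.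
apply: f_eq => a b am bm; rewrite /perm_act /=.
have E k (km : (k < m)%N) : emb (fun a => val (h i a)) k = s (emb (fun a => val (i a)) k).
  rewrite (emb_ord _ (Ordinal km) : emb _ k = _).
  by rewrite (emb_ord (fun a => val (i a)) (Ordinal km) : emb _ k = _) ffunE.
by rewrite !E.
Qed.

(** An injective tuple extends to a finite permutation, and [f] does not see the difference beyond
    the corner. *)
Let Ex_injective (c : 'I_m -> nat) : injective c ->
  Ex D (fun r => f (perm_act (emb c) r)) = Ex D f.
Proof.
move=> ci; have [|p fp pE] := @perm_extend [seq c a | a <- enum 'I_m].
  by rewrite map_inj_uniq ?enum_uniq.
rewrite [RHS](Ex_comp (X := perm_act p) (P := D)).
- congr Ex; apply/funext => r; apply: f_eq => a b am bm; rewrite /perm_act/=.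
  have E k (km : (k < m)%N) : emb c k = p k.
    have -> : p k = nth 0%N [seq c a | a <- enum 'I_m] k.
      by apply: pE; rewrite size_map size_enum_ord.
    rewrite (nth_map (Ordinal km)) ?size_enum_ord//.
    rewrite (emb_ord c (Ordinal km) : emb c k = _); congr c; apply: val_inj.
    by rewrite /= nth_enum_ord.
  by rewrite (E a am) (E b bm).
- exact: measurable_perm_act.
- by move=> B mB; rewrite invD.
- exact: nice_mbounded nf.
Qed.

Let measurable_corner_avg n : measurable_fun setT (fun r => corner_avg f m r n).
Proof.
rewrite /corner_avg; under eq_fun do rewrite mulrC.
apply: measurable_funM; first exact: measurable_cst.
by apply: measurable_sum => i; have [] := mfe (emb (fun a => val (i a))).
Qed.

(* Only the non-injective tuples have the wrong expectation. *)
Let Ex_corner_avg n : (0 < n)%N ->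
  `|Ex D (fun r => corner_avg f m r n) - Ex D f| <= 1 - (n ^_ m)%:R / n%:R ^+ m.
Proof.
move=> n0; have n0' : 0 < (n%:R : R) ^+ m by rewrite exprn_gt0// ltr0n.
have -> : Ex D (fun r => corner_avg f m r n) =
    (\sum_(i : {ffun 'I_m -> 'I_n}) Ex D (fun r => f (perm_act (emb (fun a => val (i a))) r)))
      / n%:R ^+ m.
  rewrite -Ex_sum// mulrC -ExZ; last exact: mbounded_sum.
  by congr Ex; apply/funext => r; rewrite mulrC.
rewrite -[X in _ - X](@sum_ffun_cst R m n)// -mulrBl -sumrB.
rewrite normrM normfV (gtr0_norm n0') -[X in X - _](divff (lt0r_neq0 n0')) -mulrBl.
rewrite ler_wpM2r ?invr_ge0 ?(ltW n0')//.
have -> : n%:R ^+ m - (n ^_ m)%:R =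
    \sum_(i : {ffun 'I_m -> 'I_n}) (~~ injectiveb i)%:R :> R.
  rewrite -[n in n ^_ m]card_ord -[m in _ ^_ m]card_ord -card_inj_ffuns -sum1_card natr_sum.
  apply/eqP; rewrite subr_eq [X in _ + X]big_mkcond/= -big_split/= (eq_bigr (fun=> 1)).
    by rewrite sumr_const card_ffun !card_ord -natrX.
  by move=> i _; rewrite inE; case: injectiveb; rewrite ?addr0 ?add0r.
apply: le_trans (ler_norm_sum _ _ _) _; apply: ler_sum => i _.
case: injectiveP => [ij|nij] /=.
  rewrite Ex_injective ?subrr ?normr0// => a b /val_inj; exact: ij.
have E01 g : mbounded g -> (forall r, 0 <= g r <= 1) -> 0 <= Ex D g <= 1.
  move=> bg g01; apply/andP; split; first by apply: Ex_ge0 => r; have /andP[] := g01 r.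
  rewrite -[leRHS](Ex_cst D); apply: le_Ex => //; first exact: mbounded_cst.
  by move=> r; have /andP[] := g01 r.
have /andP[? ?] := E01 f (nice_mbounded nf) (nice_itv nf).
have /andP[? ?] := E01 _ (mfe (emb (fun a => val (i a)))) (fun r => nice_itv nf _).
rewrite ler_norml; apply/andP; split; lra.
Qed.

Let cvg_Ex_corner_avg : Ex D (fun r => corner_avg f m r n) @[n --> \oo] --> Ex D f.
Proof.
have := cvgB (cvg_cst (1 : R)) (@cvg_ffact R m); rewrite subrr => /(_ _) c.
apply/cvgrPdist_le => e e0.
have /cvgrPdist_le/(_ _ e0) : 1 - (n ^_ m)%:R / n%:R ^+ m @[n --> \oo] --> (0 : R) by exact: c.
move=> H; near=> n; rewrite distrC.
have n0 : (0 < n)%N by near: n; exact: nbhs_infty_gt.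
apply: le_trans (Ex_corner_avg n0) _.
have : `|0 - (1 - (n ^_ m)%:R / n%:R ^+ m)| <= e by near: n; exact: H.
by rewrite sub0r normrN; apply: le_trans; exact: ler_norm.
Unshelve. all: by end_near. Qed.

(* The limit exceeds [c] on an invariant event, hence surely or never: it is constant. *)
Lemma ae_corner_avg : {ae D, forall r, cvgn (corner_avg f m r)} ->
  {ae D, forall r, corner_avg f m r n @[n --> \oo] --> Ex D f}.
Proof.
move=> aecv.
pose H (c : R) := [set r | exists2 l, corner_avg f m r n @[n --> \oo] --> l & c < l].
have u01 n r : 0 <= corner_avg f m r n <= 1 by apply: corner_avg_itv; exact: nice_itv nf.
have mH c : measurable (H c) by apply: measurable_lim_gt.
have cvinv s r (l : R) : finite_perm s ->
    corner_avg f m (perm_act s r) n @[n --> \oo] --> l <-> corner_avg f m r n @[n --> \oo] --> l.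
  move=> /corner_avg_invariant[n0 Hn0]; split; apply: cvg_trans; apply: near_eq_cvg;
    by exists n0 => // n /= nn; rewrite Hn0.
have H01 c : pr D (H c) = 0 \/ pr D (H c) = 1.
  have [|E|E] := ergD (mH c); [|by left; rewrite /pr E|by right; rewrite /pr E].
  move=> s fs; apply/seteqP; split=> r [l cl ?]; exists l => //; exact/(cvinv s).
have lim01 r l : corner_avg f m r n @[n --> \oo] --> l -> 0 <= l <= 1.
  move=> cl; rewrite -(cvg_lim (@Rhausdorff R) cl).
  have ccl : cvgn (corner_avg f m r) by apply/cvg_ex; exists l.
  apply/andP; split; [apply: limr_ge|apply: limr_le] => //; apply: nearW => n;
    by have /andP[] := u01 n r.
have HN1 : pr D (H (-1)) = 1.
  apply: pr_ae1 => //; apply: (ae_imp aecv) => r /cvg_ex[l cl]; exists l => //.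
  by have /andP[l0 _] := lim01 _ _ cl; lra.
have H1 c : 1 <= c -> pr D (H c) = 0.
  move=> c1; rewrite (_ : H c = set0) ?/pr ?measure0//.
  apply/seteqP; split=> // r [l cl cl']; have /andP[_ l1] := lim01 _ _ cl.
  by have := lt_le_trans cl' l1; rewrite ltNge c1.
(* [H c] decreases in [c], is almost sure at -1 and empty from 1 on; with probabilities 0 or 1 only,
   the jump at [sup A] is the constant limit. *)
pose A := [set c | pr D (H c) = 1].
have hsA : has_sup A.
  split; first by exists (-1).
  exists 1 => c Ac; rewrite leNgt; apply/negP => /ltW /H1.
  by rewrite Ac => /eqP; rewrite oner_eq0.
have ae_lt c : c < sup A -> {ae D, forall r, H c r}.
  move=> cA; have e0 : 0 < sup A - c by rewrite subr_gt0.
  have [c' Ac' cc'] := sup_adherent e0 hsA; rewrite subKr in cc'.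
  apply: (ae_imp (ae_measurable1 (mH c') Ac')) => r [l cl c'l]; exists l => //.
  exact: lt_trans c'l.
have ae_gt c : sup A < c -> {ae D, forall r, ~ H c r}.
  move=> Ac; have [H0|Hc1] := H01 c; last first.
    by have := sup_upper_bound hsA Hc1; rewrite leNgt Ac.
  apply: (@ae_measurable1 _ _ _ D (~` H c)); first exact: measurableC.
  by rewrite /pr probability_setC// pr_EFin// H0 sube0.
have aesup : {ae D, forall r, corner_avg f m r n @[n --> \oo] --> sup A}.
  have L := ae_foralln (fun k : nat => ae_lt (sup A - k.+1%:R^-1)
    ltac:(by rewrite ltrBlDr ltrDl invr_gt0)).
  have G := ae_foralln (fun k : nat => ae_gt (sup A + k.+1%:R^-1)
    ltac:(by rewrite ltrDl invr_gt0)).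
  apply: (ae_imp (ae_and aecv (ae_and L G))) => r [/cvg_ex[l cl] [Lr Gr]].
  suff -> : sup A = l by [].
  apply/le_anti/andP; split; apply/ler_addgt0Pr => e e0;
    have [k _ Hk] := near_infty_natSinv_lt (PosNum e0); have {Hk} Hk := Hk k (leqnn k).
    have [l' cl' kl'] := Lr k.
    have E : l' = l by apply: (cvg_unique (@Rhausdorff R) cl' cl).
    rewrite E ltrBlDr in kl'; apply: (le_trans (ltW kl')); rewrite lerD2l; exact: ltW.
  have nl : ~ (sup A + k.+1%:R^-1 < l) by move=> ?; apply: (Gr k); exists l.
  move/negP : nl; rewrite -leNgt => /le_trans; apply; rewrite lerD2l; exact: ltW.
(* By dominated convergence the expectations of the averages tend to [sup A]; they also tend to
   [Ex D f]. *)
suff -> : Ex D f = sup A by exact: aesup.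
have c : Ex D (fun r => corner_avg f m r n) @[n --> \oo] --> Ex D (fun=> sup A).
  apply: (@Ex_dct _ _ _ D (fun n r => corner_avg f m r n) _ 1) => //.
  by move=> n r; have /andP[? ?] := u01 n r; rewrite ger0_norm.
rewrite Ex_cst in c; exact: (cvg_unique (@Rhausdorff R) cvg_Ex_corner_avg c).
Qed.

End Ergodic.

(** * Test functions and reconstruction *)

Section TestFunctions.
Context (R : realType).
Implicit Types (L : seq ((nat * nat) * rat)) (r : MatB R).

(* Positive exactly on [boxset L]; clipping its multiples approximates the indicator. *)
Definition box_gap L r : R := foldr (fun c x => Num.min (ratr c.2 - r c.1) x) 1 L.

Definition box_test L (s : nat) r : R := Num.min 1 (Num.max 0 (s%:R * box_gap L r)).

Definition box_dim L : nat := \max_(c <- L) (maxn c.1.1 c.1.2).+1.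

Lemma box_gap_gt0 L r : (0 < box_gap L r) = all (fun c => r c.1 < ratr c.2) L.
Proof. by elim: L => [|c L IH] /=; rewrite ?ltr01// lt_min IH subr_gt0. Qed.

Lemma box_gap_lip L r r' e : 0 <= e ->
  (forall c, c \in L -> `|r c.1 - r' c.1| <= e) -> box_gap L r <= box_gap L r' + e.
Proof.
move=> e0; elim: L => [|c L IH] H /=; first by rewrite lerDl.
have Hc := H c (mem_head _ _); rewrite ler_norml in Hc; case/andP: Hc => c1 c2.
have HL : box_gap L r <= box_gap L r' + e.
  by apply: IH => c' c'L; apply: H; rewrite inE c'L orbT.
rewrite -lerBlDr le_min; apply/andP; split; rewrite lerBlDr ge_min; apply/orP.
  by left; lra.
by right.
Qed.

Lemma nice_box_test L s : nice (box_dim L) s%:R (box_test L s).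
Proof.
split.
- have mg : measurable_fun setT (box_gap L).
    elim: L => [|c L IH]; first exact: measurable_cst.
    apply: measurable_minr => //; apply: measurable_funB; first exact: measurable_cst.
    exact: measurable_coord.
  apply: measurable_minr; first exact: measurable_cst.
  apply: measurable_maxr; first exact: measurable_cst.
  by apply: measurable_funM => //; exact: measurable_cst.
- by move=> r; rewrite /box_test le_min ge_min lexx ler01 le_max lexx.
- exact: ler0n.
- move=> r r' e e0 H.
  have clip (x y d : R) : 0 <= d -> x <= y + d ->
      Num.min 1 (Num.max 0 x) <= Num.min 1 (Num.max 0 y) + d.
    move=> d0 xy; rewrite -lerBlDr le_min; apply/andP; split.
      by rewrite lerBlDr (@le_trans _ _ 1) ?ge_min ?lexx// lerDl.
    rewrite lerBlDr; apply: (@le_trans _ _ (Num.max 0 x)); first by rewrite ge_min lexx orbT.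
    rewrite ge_max; apply/andP; split; first by rewrite addr_ge0// le_max lexx.
    by apply: (le_trans xy); rewrite lerD2r le_max lexx orbT.
  have HL c : c \in L -> `|r c.1 - r' c.1| <= e.
    move=> cL; have cd : ((maxn c.1.1 c.1.2).+1 <= box_dim L)%N.
      by rewrite /box_dim (big_rem c cL)/= leq_maxl.
    rewrite [c.1]surjective_pairing; apply: H; apply: leq_trans cd; rewrite ltnS.
      exact: leq_maxl.
    exact: leq_maxr.
  have HL' c : c \in L -> `|r' c.1 - r c.1| <= e by rewrite distrC; exact: HL.
  have key (q q' : MatB R) : box_gap L q <= box_gap L q' + e ->
      box_test L s q <= box_test L s q' + s%:R * e.
    by move=> qq'; apply: clip; [exact: mulr_ge0|rewrite -mulrDr ler_wpM2l].
  have := key _ _ (box_gap_lip e0 HL); have := key _ _ (box_gap_lip e0 HL').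
  by move=> ? ?; rewrite ler_norml; apply/andP; split; lra.
Qed.

Lemma cvg_Ex_box_test (P : probability (MatB R) R) L :
  Ex P (box_test L s) @[s --> \oo] --> pr P (boxset L).
Proof.
rewrite -Ex_indic; last exact: measurable_boxset.
apply: (@Ex_dct _ _ _ P (fun s => box_test L s) _ 1).
- by move=> s; exact: nice_measurable (nice_box_test L s).
- by apply: measurable_indic; exact: measurable_boxset.
- by move=> s r; have /andP[? ?] := nice_itv (nice_box_test L s) r; rewrite ger0_norm.
apply: aeW => r; apply: cvg_near_cst.
have -> : \1_(boxset L) r = ((0 : R) < box_gap L r)%R%:R :> R.
  by rewrite indicE box_gap_gt0; congr (nat_of_bool _)%:R; apply/idP/idP; rewrite inE.
rewrite /box_test; case: ltP => [g0|g0] /=.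
  near=> s; rewrite max_r ?mulr_ge0 ?(ltW g0)// min_l// -ler_pdivrMr// div1r.
  by near: s; exact: nbhs_infty_ger.
by apply: nearW => s; rewrite max_l ?min_r// mulr_ge0_le0.
Unshelve. all: by end_near. Qed.

Lemma eq_probability_box_test (P Q : probability (MatB R) R) :
  (forall L s, Ex P (box_test L s) = Ex Q (box_test L s)) ->
  forall B, measurable B -> P B = Q B.
Proof.
move=> PQ; apply: eq_probability_boxset => L.
rewrite !pr_EFin; [|exact: measurable_boxset..].
have cP := @cvg_Ex_box_test P L; have cQ := @cvg_Ex_box_test Q L.
rewrite (_ : (fun s => Ex P (box_test L s)) = (fun s => Ex Q (box_test L s))) in cP.
  by congr EFin; exact: (cvg_unique (@Rhausdorff R) cP cQ).
by apply/funext => s; exact: PQ.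
Qed.

End TestFunctions.

Section Reconstruction.
Context (R : realType) (D : probability (MatB R) R).
Hypothesis distD : D (@distmat R) = 1%E.
Hypothesis invD : Sinf_invariant D.
Hypothesis ergD : Sinf_ergodic D.

(** For almost every [r] the averages of each test function tend both to its mean under the law
    sampled from [r] and to its mean under [D]. The null sets depend on the test function, hence the
    countable family. An almost sure statement can be combined with total boundedness under
    [cond2]. *)
Lemma cond1_ae_reconstruct : cond1 D -> {ae D, forall r, distmat r /\
  exists mu : probability (XB (@sup_dist R r)) R, is_matrix_distribution_of mu D}.
Proof.
move=> c1; have aeg := cond1_ae_good invD distD c1.
have aeV L s : {ae D, forall r, corner_avg (box_test L s) (box_dim L) r n
    @[n --> \oo] --> Ex D (box_test L s)}.
  apply: (ae_corner_avg invD ergD (nice_box_test R L s)).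
  apply: (ae_imp aeg) => r gr; have [mu [nu [_ cv]]] := good_sampled_law gr.
  by apply/cvg_ex; eexists; exact: (cv _ _ _ (nice_box_test R L s)).
have aeV2 := ae_countable (fun Ls : seq ((nat * nat) * rat) * nat => aeV Ls.1 Ls.2).
apply: (ae_imp (ae_and aeg aeV2)) => r [gr Vr]; have dr := good_distmat gr.
split=> //; have [mu [nu [pmn cv]]] := good_sampled_law gr; exists mu, nu; split=> // B mB.
have mFT := measurable_FT (sup_dist_metric dr) (@sup_dist_separable R r).
have [Q QE] := law_exists nu mFT; rewrite -QE; move: B mB.
apply: eq_probability_box_test => L s.
rewrite (Ex_comp mFT (fun B _ => QE B) (nice_mbounded (nice_box_test R L s))).
exact: (cvg_unique (@Rhausdorff R) (Vr (L, s)) (cv _ _ _ (nice_box_test R L s))).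
Qed.

Lemma cond1_matrix_distribution : cond1 D -> is_matrix_distribution D.
Proof.
move=> /cond1_ae_reconstruct /ae_exists[r [dr [mu HD]]].
by exists (closure_rows r), (@sup_dist R r), mu; split=> //; exact: sup_dist_polish.
Qed.

Lemma cond2_compact_matrix_distribution : cond2 D -> is_compact_matrix_distribution D.
Proof.
move=> c2; have aeD := cond1_ae_reconstruct (cond2_cond1 c2).
have /ae_exists[r [[dr [mu HD]] tb]] := ae_and aeD (cond2_ae_totally_bounded c2).
exists (closure_rows r), (@sup_dist R r), mu; split; first exact: sup_dist_polish.
by split=> //; exact: sup_dist_compact.
Qed.

End Reconstruction.

(** * Necessity of the compactness condition *)

Section Necessity.
Context (R : realType) (D : probability (MatB R) R).

Lemma compact_matrix_distribution_cond2 : is_compact_matrix_distribution D -> cond2 D.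
Proof.
move=> [X [rho [mu [[met _] [cpt [nu [_ HD]]]]]]] e e0.
have [H0 [H1 [sym tri]]] := met.
have cover (x : XNB rho) : (\bigcup_N good_set2 N e) (FT x).
  have e20 : 0 < e / 2 by rewrite divr_gt0.
  have [||s [sF sc]] := cpt [set U | exists y, U = [set z | rho z y < e / 2]].
  - by move=> _ [y ->]; exact: rho_open_ball.
  - apply/seteqP; split=> // z _; exists [set z' | rho z' z < e / 2]; first by exists z.
    by rewrite /= (H1 z z).2.
  (* A ball that the sequence never visits imposes nothing, and [N = 0] will do. *)
  have hit U : exists N, forall j, U (x j) -> exists2 i, (i < N)%N & U (x i).
    have [[j Uj]|nj] := pselect (exists j, U (x j)); first by exists j.+1 => _ _; exists j.
    by exists 0%N => j Uj; case: nj; exists j.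
  have /choice[N HN] := hit.
  exists (\max_(U <- s) N U)%N => //; split; first exact: distmat_FT.
  move=> j _; have [U Us Uj] := sc (x j); have [i iN Ui] := HN U j Uj.
  exists i; first by apply: (leq_trans iN); rewrite (big_rem U Us)/= leq_maxl.
  have [y UE] := sF U Us; rewrite UE /= in Ui Uj.
  by apply: le_lt_trans (tri _ y _) _; rewrite (sym y) [e]splitr ltrD.
have mg N : measurable (@good_set2 R N e) by exact: measurable_good_set2.
have Dcov : pr D (\bigcup_N good_set2 N e) = 1.
  rewrite /pr HD; last exact: bigcup_measurable.
  rewrite (_ : _ @^-1` _ = setT) ?probability_setT//.
  by apply/seteqP; split=> // x _; exact: cover.
have nd m n : (m <= n)%N -> @good_set2 R m e `<=` good_set2 n e.
  move=> mn r [dr Hr]; split=> // j nj.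
  by have [i im ri] := Hr j (leq_trans mn nj); exists i => //; exact: leq_trans mn.
have := @pr_nondecreasing_cvg _ _ _ D _ mg nd; rewrite Dcov => /cvgr_gt/(_ (1 - e)).
rewrite ltrBlDr ltrDl => /(_ e0)[N _ HN].
by exists N; rewrite pr_EFin// lte_fin; exact: (HN N (leqnn N)).
Qed.

End Necessity.

(** * Necessity of the frequency condition *)

Section NecessityMeasure.
Context (R : realType) (D : probability (MatB R) R).
Hypothesis distD : D (@distmat R) = 1%E.
Hypothesis invD : Sinf_invariant D.

Lemma pr_setU_le (d : measure_display) (T : measurableType d) (P : probability T R) (A B : set T) :
  measurable A -> measurable B -> pr P (A `|` B) <= pr P A + pr P B.
Proof.
move=> mA mB; have mAB := measurableU _ _ mA mB.
by rewrite -lee_fin EFinD -!pr_EFin//; exact: measureU2.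
Qed.

(** Countably many balls of radius [e / 2] cover the space. For one of mass [p], starting in it and
    then missing it [n] times has probability [p (1 - p)^n], which becomes arbitrarily small: either
    [p = 0] or the power tends to 0. *)
Lemma ae_return (X : pointedType) (rho : X -> X -> R) (mu : probability (XB rho) R)
    (nu : probability (XNB rho) R) (e : R) : is_metric rho -> rho_separable rho ->
  is_product_measure mu nu -> 0 < e ->
  {ae nu, forall x, exists i : nat, rho (x i.+1) (x 0) < e}.
Proof.
move=> met [s sP] pmn e0; have [_ [_ [sym tri]]] := met.
have e20 : 0 < e / 2 by rewrite divr_gt0.
pose U k : set (XB rho) := [set z | rho z (s k) < e / 2].
have mU k : measurable (U k) by apply: sub_sigma_algebra; exact: rho_open_ball.
have aek k : {ae nu, forall x, ~ (U k (x 0) /\ forall i, ~ U k (x i.+1))}.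
  apply: ae_large => e' e'0.
  pose p := pr mu (U k).
  pose A i : set (XB rho) := if i is 0%N then U k else ~` U k.
  have mA i : measurable (A i) by case: i => [|i] //=; exact: measurableC.
  have prn n : pr nu [set x | forall i, (i < n.+1)%N -> A i (x i)] = p * (1 - p) ^+ n.
    rewrite /pr (pmn n.+1 A mA) (eq_bigr (fun i : 'I_n.+1 =>
      (if val i is 0%N then p else 1 - p)%:E)).
      rewrite prodEFin/= big_ord_recl/=; congr (_ * _).
      by rewrite prodr_const card_ord.
    move=> [[|i] ?] _ /=; first by rewrite pr_EFin.
    by rewrite probability_setC// pr_EFin.
  have p01 : 0 <= p <= 1 by rewrite pr_ge0 pr_le1.
  have [n pn] : exists n, p * (1 - p) ^+ n < e'.
    have [p0|p0] := eqVneq p 0; first by exists 0%N; rewrite p0 mul0r.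
    have : `|1 - p| < 1 by rewrite ger0_norm; [|lra]; rewrite ltrBlDr ltrDl lt0r p0; case/andP: p01.
    move=> /(@cvg_expr R) /cvgrPdist_lt/(_ _ e'0)[n _ /(_ n (leqnn n))] /=.
    rewrite sub0r normrN ger0_norm; last by rewrite exprn_ge0//; lra.
    move=> H; exists n; apply: le_lt_trans H; apply: ler_piMl; last by case/andP: p01.
    by rewrite exprn_ge0//; lra.
  have mN : measurable [set x : XNB rho | forall i, (i < n.+1)%N -> A i (x i)].
    apply: measurable_forall => i; apply: measurable_implyP => _.
    exact: (measurable_preimage (measurable_XNB_proj (rho := rho) i)).
  exists (~` [set x | forall i, (i < n.+1)%N -> A i (x i)]); split.
  - exact: measurableC.
  - by move=> x nA [U0 UN]; apply: nA => -[|i] _ //=; exact: UN.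
  - by rewrite /pr probability_setC// pr_EFin// prn -EFinB/= ltrD2l ltrN2.
apply: (ae_imp (ae_foralln aek)) => x Hx.
have [k xk] := sP (x 0) _ e20.
apply: contrapT => /forallNP nx; apply: (Hx k); split=> // i Ui; apply: (nx i).
by apply: le_lt_trans (tri _ (s k) _) _; rewrite (sym _ (x 0)) [e]splitr ltrD.
Qed.

Let close N j (e : R) : set (MatB R) := [set r | has (fun i => r (i, j) < e) (iota 0 N)].

Lemma matrix_distribution_close (e d : R) : is_matrix_distribution D -> 0 < e -> 0 < d ->
  exists N, 1 - d < pr D (close N N e).
Proof.
move=> [X [rho [mu [[met [_ sep]] [nu [pmn HD]]]]]] e0 d0.
pose B N : set (MatB R) := [set r | exists i, (i < N)%N /\ r (i.+1, 0%N) < e].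
have mB N : measurable (B N).
  apply: measurable_exists => i; apply: measurable_andP; first exact: measurable_cstP.
  by apply: measurable_ltP; [exact: measurable_coord|exact: measurable_cst].
have mUB : measurable (\bigcup_N B N) by exact: bigcup_measurable.
have BU : pr D (\bigcup_N B N) = 1.
  rewrite /pr HD//.
  have mF : measurable (FT (rho := rho) @^-1` \bigcup_N B N).
    exact: (measurable_preimage (measurable_FT met sep)).
  apply: (pr_ae1 mF); apply: (ae_imp (ae_return met sep pmn e0)) => x [i xi].
  by exists i.+1 => //; exists i.
have nd m n : (m <= n)%N -> B m `<=` B n.
  by move=> mn r [i [im ri]]; exists i; split=> //; exact: leq_trans mn.
have := @pr_nondecreasing_cvg _ _ _ D _ mB nd; rewrite BU => /cvgr_gt/(_ (1 - d)).
rewrite ltrBlDr ltrDl => /(_ d0)[N _ /(_ N (leqnn N))] /= HN; exists N.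
apply: lt_le_trans HN _.
(* the reversal of [0, N] exchanges the roles of the indices 0 and N *)
pose s i := if (i <= N)%N then (N - i)%N else i.
have fs : finite_perm s.
  split; last by exists N.+1 => i iN; rewrite /s leqNgt iN.
  by exists s => i; rewrite /s; case: (leqP i N) => iN; rewrite ?leq_subr ?subKn// leqNgt iN.
rewrite /pr -(invD fs (mB N)) (_ : _ @^-1` _ = close N N e)//.
apply/seteqP; split=> r /=; rewrite /close /B/= /perm_act/= /s/= subn0.
  move=> [i [iN]]; rewrite iN => ri; apply/hasP; exists (N - i.+1)%N => //.
  by rewrite mem_iota/= add0n; lia.
move=> /hasP[i]; rewrite mem_iota/= add0n => iN ri; exists (N - i.+1)%N; split; first lia.
have -> : ((N - i.+1).+1 <= N)%N by lia.
by have -> : (N - (N - i.+1).+1 = i)%N by lia.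
Qed.

Lemma matrix_distribution_cond1 : is_matrix_distribution D -> cond1 D.
Proof.
(* Markov's inequality at level [e]: if the mean limit frequency exceeds [1 - e^2], the limit is at
   most [1 - e] with probability less than [e]. *)
move=> HD e e0; have e20 : 0 < e * e by rewrite mulr_gt0.
have [N HN] := matrix_distribution_close HD e0 e20; exists N.
have [aecv prj] := ae_close_frac invD N e.
set a := pr D (close N N e) in HN.
pose u n (r : MatB R) := close_frac r N e n.
have u01 n r : 0 <= u n r <= 1 := close_frac_itv r N e n.
have mu n : measurable_fun setT (u n) := @measurable_close_frac R N e n.
pose L r := limn_sup (fun n => u n r).
(* The columns from [N] on all have probability [a] of being close; the first [N] shift the mean by
   at most their own frequency, which tends to 0. *)
have Exu : Ex D (u n) @[n --> \oo] --> a.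
  apply/cvgrPdist_le => d d0; have /cvgrPdist_le/(_ _ d0) f0 := @freq_lt_cvg0 R N.
  near=> n; have n0 : (0 < n)%N by near: n; exact: nbhs_infty_gt.
  have n0' : (0 : R) < n%:R by rewrite ltr0n.
  have uE : u n = (fun r => n%:R^-1 * \sum_(j < n) \1_(close N (val j) e) r).
    apply/funext => r; rewrite /u close_frac_freq /freq mulrC; congr (_ * _).
    apply: eq_bigr => j _; rewrite indicE; congr (nat_of_bool _)%:R.
    by apply/idP/idP; rewrite inE.
  have bc j : mbounded (\1_(close N j e) : MatB R -> R).
    by apply: mbounded_indic; exact: measurable_has_close.
  rewrite uE ExZ; last exact: mbounded_sum.
  rewrite Ex_sum// distrC.
  have -> : n%:R^-1 * (\sum_(j < n) Ex D \1_(close N (val j) e)) - a =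
      (\sum_(j < n) (Ex D \1_(close N (val j) e) - a)) / n%:R.
    rewrite sumrB sumr_const card_ord -[a *+ n]mulr_natr mulrBl mulfK ?gt_eqF//.
    by rewrite mulrC.
  apply: (@le_trans _ _ (freq R (fun j => j < N)%N n)); last first.
    have : `|0 - freq R (fun j => j < N)%N n| <= d by near: n; exact: f0.
    by rewrite sub0r normrN; apply: le_trans; exact: ler_norm.
  rewrite normrM normfV (gtr0_norm n0') ler_wpM2r ?invr_ge0//.
  apply: le_trans (ler_norm_sum _ _ _) _; apply: ler_sum => j _.
  have mc k : measurable (close N k e) by exact: measurable_has_close.
  rewrite Ex_indic//; case: (ltnP j N) => [jN|Nj].
    have := pr_ge0 D (close N j e); have := pr_le1 D (mc j).
    have := pr_ge0 D (close N N e); have := pr_le1 D (mc N); rewrite -/a.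
    rewrite (_ : true%:R = 1 :> R)//; move: (pr D (close N j e)) a {HN} => x y *.
    by rewrite ler_norml; apply/andP; split; lra.
  by rewrite [X in X - _]prj// subrr normr0.
have ExL : Ex D L = a.
  exact: (cvg_unique (@Rhausdorff R) (Ex_limsup mu u01 aecv) Exu).
have mL : measurable_fun setT L := measurable_limsup mu u01.
have L01 r : 0 <= L r <= 1 := limsup_itv u01 r.
pose bad := [set r | L r <= 1 - e].
have mbad : measurable bad by apply: measurable_leP => //; exact: measurable_cst.
have bL : mbounded L.
  by split=> //; exists 1 => r; have /andP[? ?] := L01 r; rewrite ger0_norm.
have prbad : e * pr D bad <= 1 - a.
  rewrite -ExL -(Ex_cst D 1) -ExB//; last exact: mbounded_cst.
  rewrite -Ex_indic// -ExZ; last exact: mbounded_indic.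
  apply: le_Ex.
  - by apply: mboundedZ; exact: mbounded_indic.
  - by apply: mboundedB => //; exact: mbounded_cst.
  - move=> r; have /andP[L0 L1] := L01 r; rewrite indicE.
    by case: (boolP (r \in bad)) => [/set_mem H|_] /=;
      [rewrite mulr1 lerBrDr -lerBrDl|rewrite mulr0 subr_ge0].
have mg := @measurable_good_set1 R N e.
have prU : pr D (good_set1 N e `|` bad) = 1.
  apply: pr_ae1; first exact: measurableU.
  apply: (ae_imp (ae_and (ae_distmat distD) aecv)) => r [dr /cvg_ex[l cl]].
  have Ll : L r = l := limsup_cvg cl.
  have [lt|ge] := ltP (1 - e) l; last by right; rewrite /bad/= Ll.
  by left; split=> //; exists l.
rewrite pr_EFin// lte_fin.
have := pr_setU_le D mg mbad; rewrite prU => H.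
have : e * pr D bad < e * e by lra.
by rewrite ltr_pM2l// => ?; lra.
Unshelve. all: by end_near. Qed.

End NecessityMeasure.

Unset Implicit Arguments.
Set Strict Implicit.

Theorem theorem5 (R : realType) (D : probability (MatB R) R) :
  D (@distmat R) = 1%E -> Sinf_invariant D -> Sinf_ergodic D ->
  (is_matrix_distribution D <-> cond1 D) /\
  (is_compact_matrix_distribution D <-> cond2 D).
Proof.
move=> distD invD ergD; split; split.
- exact: matrix_distribution_cond1.
- exact: cond1_matrix_distribution.
- exact: compact_matrix_distribution_cond2.
- exact: cond2_compact_matrix_distribution.
Qed.
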